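(* Let $\mathbf{k}$ be an algebraically closed field. For any integers $u\geq 1$ and $v\geq 1$, there are derived equivalences $$\mathrm{D}^{b}(A(u)_v)\simeq\mathrm{D}^{b}(A(u)^v)\simeq\mathrm{D}^{b}({}_vA(u))\simeq\mathrm{D}^{b}({}^vA(u)).$$
   Context: $\mathrm{D}^b(A)$ is the bounded derived category of the category of finitely generated left modules over a finite-dimensional $\mathbf{k}$-algebra $A$, and $\simeq$ means equivalence of triangulated categories. Bound quivers. The ''rectangle'' $Q(u)$ has vertices $t_1,\dots,t_u$ (top row) and $b_1,\dots,b_u$ (bottom row), arrows $t_i\to t_{i+1}$ and $b_i\to b_{i+1}$ for $1\le i\le u-1$, and $t_i\to b_i$ for $1\le i\le u$, with the relations that every square commutes, i.e. the paths $t_i\to t_{i+1}\to b_{i+1}$ and $t_i\to b_i\to b_{i+1}$ are equal for $1\le i\le u-1$. The four one-branch extensions are obtained from $Q(u)$ by adding $v$ new vertices $c_1,\dots,c_v$, the arrows $c_i\to c_{i+1}$ ($1\le i\le v-1$), and one more arrow (and no further relations): - $Q(u)_v$: the arrow $b_u\to c_1$; - $Q(u)^v$: the arrow $t_u\to c_1$; - ${}_vQ(u)$: the arrow $c_v\to b_1$; - ${}^vQ(u)$: the arrow $c_v\to t_1$. $A(u)_v$, $A(u)^v$, ${}_vA(u)$, ${}^vA(u)$ denote the corresponding algebras (path algebra over $\mathbf{k}$ modulo the ideal generated by the commutativity relations). *)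

(* Defs.v *)
From HB Require Import structures.
From mathcomp Require Import all_boot all_order all_algebra.
From mathcomp Require Import finmap monalg generic_quotient ring_quotient boolp zify.

Set Implicit Arguments.
Unset Strict Implicit.
Unset Printing Implicit Defensive.

Import GRing.Theory Quotient.

Local Open Scope ring_scope.
Local Open Scope quotient_scope.

(** * Path algebras

    A quiver without parallel arrows is a finite type [V] of vertices with a
    relation [e]: there is one arrow from [x] to [y] when [e x y].  A path is
    then the sequence of vertices that it visits.  The product [q * p] of two
    paths is "first [p], then [q]", so that left modules over the path algebra
    are covariant representations of the quiver. *)

Section PathAlgebra.
Variables (k : fieldType) (V : finType) (e : rel V).

Definition qpath := {p : V * seq V | path e p.1 p.2}.

Definition qsrc (p : qpath) : V := (val p).1.
Definition qtgt (p : qpath) : V := last (val p).1 (val p).2.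

Definition qcomp (q p : qpath) : option qpath :=
  if qtgt p == qsrc q then insub (qsrc p, (val p).2 ++ (val q).2) : option qpath
  else None.

Definition qtriv (x : V) : qpath := exist _ (x, [::]) isT.

Definition path_algebra := {malg k[qpath]}.
HB.instance Definition _ := GRing.Lmodule.on path_algebra.

Implicit Types (f g h : path_algebra) (p q r : qpath).

(* [pbasis] and [pamul] are locked because unfolding them down to finitely
   supported functions makes unification intractable. *)
Fact path_algebra_key : unit. Proof. by []. Qed.

Definition pbasis_def (p : qpath) : path_algebra := << p >>.
Definition pbasis := locked_with path_algebra_key pbasis_def.
Canonical pbasis_unlockable := [unlockable fun pbasis].

Definition pamul_basis (q p : qpath) : path_algebra := oapp pbasis 0 (qcomp q p).

Definition pamul_def f g : path_algebra :=
  \sum_(q <- msupp f) \sum_(p <- msupp g) (f@_q * g@_p) *: pamul_basis q p.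

Definition pamul := locked_with path_algebra_key pamul_def.
Canonical pamul_unlockable := [unlockable fun pamul].

Definition paone : path_algebra := \sum_(x : V) pbasis (qtriv x).

(* Extension by linearity of a function given on the basis of paths. *)
Let ext (F : qpath -> path_algebra) f : path_algebra :=
  \sum_(p <- msupp f) f@_p *: F p.

Let extw F f (d : {fset qpath}) :
  (msupp f `<=` d)%fset -> ext F f = \sum_(p <- d) f@_p *: F p.
Proof.
move=> le; rewrite /ext (big_fset_incl _ le) // => p _ /mcoeff_outdom ->.
by rewrite scale0r.
Qed.

Let ext_lin F a f g : ext F (a *: f + g) = a *: ext F f + ext F g.
Proof.
pose d := (msupp f `|` msupp g)%fset.
have lf : (msupp f `<=` d)%fset by apply: fsubsetUl.
have lg : (msupp g `<=` d)%fset by apply: fsubsetUr.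
have lfg : (msupp (a *: f + g) `<=` d)%fset.
  apply: fsubset_trans (msuppD_le _ _) _.
  by rewrite fsubUset lg (fsubset_trans (msuppZ_le _ _)).
rewrite (extw _ lf) (extw _ lg) (extw _ lfg) scaler_sumr -big_split /=.
by apply: eq_bigr => p _; rewrite mcoeffD mcoeffZ scalerDl scalerA.
Qed.

Let extB F p : ext F (pbasis p) = F p.
Proof. by rewrite /ext [pbasis]unlock msuppU oner_eq0 big_seq_fset1 mcoeffUU scale1r. Qed.

Let pamulE f g :
  pamul f g = ext (fun q => ext (fun p => pamul_basis q p) g) f.
Proof.
rewrite [pamul]unlock; apply: eq_bigr => q _; rewrite scaler_sumr.
by apply: eq_bigr => p _; rewrite scalerA.
Qed.

Lemma pamul_linl h a f g : pamul (a *: f + g) h = a *: pamul f h + pamul g h.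
Proof. by rewrite !pamulE ext_lin. Qed.

Lemma pamul_linr h a f g : pamul h (a *: f + g) = a *: pamul h f + pamul h g.
Proof.
rewrite !pamulE /ext scaler_sumr -big_split; apply: eq_bigr => q _ /=.
by rewrite -!/(ext _ _) ext_lin scalerDr !scalerA [a * _]mulrC.
Qed.

Lemma pamulB q p : pamul (pbasis q) (pbasis p) = pamul_basis q p.
Proof. by rewrite pamulE !extB. Qed.

Let monalgUZ a p : << a *g p >> = a *: pbasis p.
Proof.
rewrite [pbasis]unlock; suff -> : << a *g p >> = a *: << p >> :> {malg k[qpath]}.
  by [].
by apply/malgP => q; rewrite mcoeffZ [LHS]mcoeffU mcoeffU mulrnAr mulr1.
Qed.

Lemma path_algebra_ind (P : path_algebra -> Prop) :
    P 0 -> (forall a p f, P f -> P (a *: pbasis p + f)) ->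
  forall f, P f.
Proof.
move=> P0 Pl f; rewrite [f]monalgE; elim: (enum_fset (msupp f)) => [|p s IH].
  by rewrite big_nil.
rewrite big_cons monalgUZ; exact: Pl.
Qed.

Lemma pamul0l f : pamul 0 f = 0.
Proof. by rewrite [pamul]unlock /pamul_def msupp0 big_seq_fset0. Qed.

Lemma pamul0r f : pamul f 0 = 0.
Proof. by rewrite [pamul]unlock /pamul_def big1 // => q _; rewrite msupp0 big_seq_fset0. Qed.

Lemma pamul_basis_cat x y (p q : seq V) xp yq xpq : last x p = y ->
  pamul_basis (exist _ (y, q) yq) (exist _ (x, p) xp)
    = pbasis (exist _ (x, p ++ q) xpq).
Proof.
move=> exy; rewrite /pamul_basis /qcomp /qtgt /qsrc [val _]/= [val _]/=.
by rewrite [last _ _]exy eqxx insubT.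
Qed.

Lemma pamul_basis_eq0 x y (p q : seq V) xp yq : last x p != y ->
  pamul_basis (exist _ (y, q) yq) (exist _ (x, p) xp) = 0.
Proof.
move=> nxy; rewrite /pamul_basis /qcomp /qtgt /qsrc [val _]/= [val _]/=.
by rewrite (negPf nxy).
Qed.

Let pamul_basisA r q p :
  pamul (pbasis r) (pamul_basis q p) = pamul (pamul_basis r q) (pbasis p).
Proof.
case: p q r => [[x p] xp] [[y q] yq] [[z r] zr].
have [eyx|nyx] := eqVneq (last x p) y; last first.
  rewrite [in LHS](pamul_basis_eq0 _ _ nyx) pamul0r.
  have [ezy|nzy] := eqVneq (last y q) z; last first.
    by rewrite (pamul_basis_eq0 _ _ nzy) pamul0l.
  have yqr : path e y (q ++ r) by rewrite cat_path [path _ _ _]yq ezy.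
  by rewrite (pamul_basis_cat _ _ yqr ezy) pamulB (pamul_basis_eq0 _ _ nyx).
have xpq : path e x (p ++ q) by rewrite cat_path [path _ _ _]xp eyx.
rewrite (pamul_basis_cat _ _ xpq eyx) pamulB.
have elpq : last x (p ++ q) = last y q by rewrite last_cat eyx.
have [ezy|nzy] := eqVneq (last y q) z; last first.
  rewrite [in RHS](pamul_basis_eq0 _ _ nzy) pamul0l; apply: pamul_basis_eq0.
  by rewrite -elpq in nzy.
have yqr : path e y (q ++ r) by rewrite cat_path [path _ _ _]yq ezy.
have xpqr : path e x (p ++ q ++ r) by rewrite cat_path [path _ _ _]xp eyx.
have xpqr' : path e x ((p ++ q) ++ r) by rewrite -catA.
rewrite (pamul_basis_cat _ _ xpqr' (etrans elpq ezy)).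
rewrite (pamul_basis_cat _ _ yqr ezy) pamulB (pamul_basis_cat _ _ xpqr eyx).
by congr (pbasis _); apply: val_inj; rewrite /= catA.
Qed.

Let pamulA : associative pamul.
Proof.
elim/path_algebra_ind => [|a r f IHf] g h; first by rewrite !pamul0l.
suff eqr : pamul (pbasis r) (pamul g h) = pamul (pamul (pbasis r) g) h.
  by rewrite !pamul_linl IHf eqr.
elim/path_algebra_ind: g => [|b q g IHg]; first by rewrite pamul0l pamul0r pamul0l.
suff eqq : pamul (pbasis r) (pamul (pbasis q) h) =
           pamul (pamul (pbasis r) (pbasis q)) h.
  by rewrite (pamul_linr _ b) !(pamul_linl h) (pamul_linr _ b) IHg eqq.
elim/path_algebra_ind: h {IHf IHg} => [|c p h IHh]; first by rewrite !pamul0r.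
by rewrite !(pamul_linr _ c) IHh !pamulB pamul_basisA.
Qed.

Let pamulDl : left_distributive pamul +%R.
Proof. by move=> f g h; rewrite -[f]scale1r pamul_linl !scale1r. Qed.

Let pamulDr : right_distributive pamul +%R.
Proof. by move=> h f g; rewrite -[f]scale1r pamul_linr !scale1r. Qed.

Let pamul_suml (I : finType) (F : I -> path_algebra) g :
  pamul (\sum_i F i) g = \sum_i pamul (F i) g.
Proof.
exact: (big_morph (pamul^~ g) (fun f f' => pamulDl f f' g) (pamul0l g)).
Qed.

Let pamul_sumr (I : finType) (F : I -> path_algebra) g :
  pamul g (\sum_i F i) = \sum_i pamul g (F i).
Proof. exact: (big_morph (pamul g) (pamulDr g) (pamul0r g)). Qed.

Let pamul1 : left_id paone pamul.
Proof.
elim/path_algebra_ind => [|a p f IH]; first by rewrite pamul0r.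
suff eqp : pamul paone (pbasis p) = pbasis p by rewrite pamul_linr IH eqp.
rewrite pamul_suml (bigD1 (qtgt p)) //= big1 => [|x /negPf nx]; last first.
  by rewrite pamulB /pamul_basis /qcomp /qsrc /= eq_sym nx.
rewrite addr0 pamulB /pamul_basis /qcomp /qsrc /= eqxx cats0.
by case: p => [[x p] xp]; rewrite insubT.
Qed.

Let pamulr1 : right_id paone pamul.
Proof.
elim/path_algebra_ind => [|a p f IH]; first by rewrite pamul0l.
suff eqp : pamul (pbasis p) paone = pbasis p by rewrite pamul_linl IH eqp.
rewrite pamul_sumr (bigD1 (qsrc p)) //= big1 => [|x /negPf nx]; last first.
  by rewrite pamulB /pamul_basis /qcomp /qtgt /= nx.
rewrite addr0 pamulB /pamul_basis /qcomp /qtgt /= eqxx.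
by case: p => [[x p] xp]; rewrite insubT.
Qed.

HB.instance Definition _ := GRing.Zmodule_isPzRing.Build path_algebra
  pamulA pamul1 pamulr1 pamulDl pamulDr.

End PathAlgebra.

(** * Quotient of a ring by the two-sided ideal generated by a set *)

Section QuotientRing.
Variables (R : pzRingType) (S : R -> Prop).

Inductive in_ideal : R -> Prop :=
| in_ideal_gen x : S x -> in_ideal x
| in_ideal0 : in_ideal 0
| in_idealB x y : in_ideal x -> in_ideal y -> in_ideal (x - y)
| in_idealMl a x : in_ideal x -> in_ideal (a * x)
| in_idealMr a x : in_ideal x -> in_ideal (x * a).

Definition ideal : {pred R} := fun x => `[< in_ideal x >].

Let ideal_zmod_closed : zmod_closed ideal.
Proof.
split=> [|x y /asboolP Ix /asboolP Iy]; apply/asboolP; first exact: in_ideal0.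
exact: in_idealB.
Qed.

HB.instance Definition _ := GRing.isZmodClosed.Build R ideal ideal_zmod_closed.

Definition quotient_ring := {quot ideal}.
HB.instance Definition _ := GRing.Zmodule.on quotient_ring.
HB.instance Definition _ := ZmodQuotient.on quotient_ring.

Definition qrone : quotient_ring := lift_cst quotient_ring 1.
Definition qrmul := lift_op2 quotient_ring *%R.

Lemma pi_qrmul : {morph (\pi_quotient_ring) : x y / x * y >-> qrmul x y}.
Proof.
move=> x y; unlock qrmul; apply/eqP; rewrite piE Quotient.equivE.
have [/= x' ex] := piP; have [/= y' ey] := piP.
have {}ex : ideal (x - x').
  by move/eqP: ex; rewrite piE Quotient.equivE.
have {}ey : ideal (y - y').
  by move/eqP: ey; rewrite piE Quotient.equivE.
have -> : x * y - x' * y' = x * (y - y') - (x' - x) * y'.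
  by rewrite mulrBr mulrBl opprB addrA subrK.
have ex' : ideal (x' - x) by rewrite -opprB -[ideal _]/(_ \in ideal) rpredN.
apply: rpredB; apply/asboolP.
  by apply: in_idealMl; apply/asboolP.
by apply: in_idealMr; apply/asboolP.
Qed.
Canonical pi_qrone_morph := PiConst qrone.
Canonical pi_qrmul_morph := PiMorph2 pi_qrmul.

Let qrmulA : associative qrmul.
Proof.
by move=> x y z; rewrite -[x]reprK -[y]reprK -[z]reprK !piE mulrA.
Qed.

Let qrmul1 : left_id qrone qrmul.
Proof. by move=> x; rewrite -[x]reprK !piE mul1r. Qed.

Let qrmulr1 : right_id qrone qrmul.
Proof. by move=> x; rewrite -[x]reprK !piE mulr1. Qed.

Let qrmulDl : left_distributive qrmul +%R.
Proof.
by move=> x y z; rewrite -[x]reprK -[y]reprK -[z]reprK !piE mulrDl.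
Qed.

Let qrmulDr : right_distributive qrmul +%R.
Proof.
by move=> x y z; rewrite -[x]reprK -[y]reprK -[z]reprK !piE mulrDr.
Qed.

HB.instance Definition _ := GRing.Zmodule_isPzRing.Build quotient_ring
  qrmulA qrmul1 qrmulr1 qrmulDl qrmulDr.

End QuotientRing.

#[local] Obligation Tactic := idtac.

(** * Categories and triangulated categories

    Morphisms form a type with an equivalence relation [heq], the equality of
    morphisms. *)

Record category := Category {
  Ob :> Type;
  Hom : Ob -> Ob -> Type;
  heq : forall X Y, Hom X Y -> Hom X Y -> Prop;
  idm : forall X, Hom X X;
  compm : forall X Y Z, Hom Y Z -> Hom X Y -> Hom X Z;
  heq_refl : forall X Y (f : Hom X Y), heq f f;
  heq_sym : forall X Y (f g : Hom X Y), heq f g -> heq g f;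
  heq_trans : forall X Y (f g h : Hom X Y), heq f g -> heq g h -> heq f h;
  compm_heq : forall X Y Z (g g' : Hom Y Z) (f f' : Hom X Y),
    heq g g' -> heq f f' -> heq (compm g f) (compm g' f');
  compmA : forall X Y Z W (h : Hom Z W) (g : Hom Y Z) (f : Hom X Y),
    heq (compm h (compm g f)) (compm (compm h g) f);
  comp1m : forall X Y (f : Hom X Y), heq (compm (idm Y) f) f;
  compm1 : forall X Y (f : Hom X Y), heq (compm f (idm X)) f }.

Arguments heq {c X Y}.
Arguments idm {c}.
Arguments compm {c X Y Z}.

Declare Scope cat_scope.
Delimit Scope cat_scope with cat.
Local Open Scope cat_scope.
Notation "f === g" := (heq f g) (at level 70, no associativity) : cat_scope.
Notation "g '\oc' f" := (compm g f) (at level 50, left associativity)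
  : cat_scope.

Definition is_iso (C : category) (X Y : C) (f : Hom X Y) :=
  exists g : Hom Y X, g \oc f === idm X /\ f \oc g === idm Y.

Record functor (C D : category) := Functor {
  fob :> C -> D;
  fmap : forall X Y : C, Hom X Y -> Hom (fob X) (fob Y);
  fmap_heq : forall (X Y : C) (f g : Hom X Y), f === g -> fmap f === fmap g;
  fmap_id : forall X : C, fmap (idm X) === idm (fob X);
  fmap_comp : forall (X Y Z : C) (g : Hom Y Z) (f : Hom X Y),
    fmap (g \oc f) === fmap g \oc fmap f }.

Arguments fmap {C D} F {X Y} : rename.

Program Definition idF (C : category) : functor C C :=
  @Functor C C id (fun _ _ f => f) _ _ _.
Next Obligation. by []. Qed.
Next Obligation. by move=> C X; apply: heq_refl. Qed.
Next Obligation. by move=> C X Y Z g f; apply: heq_refl. Qed.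

Program Definition compF (C D E : category) (G : functor D E) (F : functor C D)
    : functor C E :=
  @Functor C E (fun X => G (F X)) (fun _ _ f => fmap G (fmap F f)) _ _ _.
Next Obligation. by move=> C D E G F X Y f g fg; do 2! apply: fmap_heq. Qed.
Next Obligation.
move=> C D E G F X.
by apply: heq_trans (fmap_id _ _); apply: fmap_heq; apply: fmap_id.
Qed.
Next Obligation.
move=> C D E G F X Y Z g f.
by apply: heq_trans (fmap_comp _ _ _); apply: fmap_heq; apply: fmap_comp.
Qed.

Record nat_iso (C D : category) (F G : functor C D) := NatIso {
  niso :> forall X : C, Hom (F X) (G X);
  niso_iso : forall X : C, is_iso (niso X);
  niso_nat : forall (X Y : C) (f : Hom X Y),
    niso Y \oc fmap F f === fmap G f \oc niso X }.

Definition is_equivalence (C D : category) (F : functor C D) :=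
  exists G : functor D C,
    inhabited (nat_iso (compF G F) (idF C)) /\
    inhabited (nat_iso (compF F G) (idF D)).

(* The data of a triangulated category: the translation functor [tshift] and the
   distinguished triangles X -> Y -> Z -> X[1].  The axioms of triangulated
   categories are not recorded: triangle functors and equivalences only depend
   on the data. *)
Record tricat := TriCat {
  tcat :> category;
  tshift : functor tcat tcat;
  distinguished : forall X Y Z : tcat,
    Hom X Y -> Hom Y Z -> Hom Z (tshift X) -> Prop }.

Arguments tshift {t}.
Arguments distinguished {t X Y Z}.

(* The additivity of F, which is part of the usual definition of a triangle
   functor, is automatic when F is an equivalence, the addition of morphisms
   in an additive category being determined by its finite products. *)
Record tri_functor (C D : tricat) := TriFunctor {
  tfun :> functor C D;
  tfun_shift : nat_iso (compF tfun tshift) (compF tshift tfun);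
  tfun_dist : forall (X Y Z : C) (f : Hom X Y) (g : Hom Y Z)
                     (h : Hom Z (tshift X)),
    distinguished f g h ->
    distinguished (fmap tfun f) (fmap tfun g) (tfun_shift X \oc fmap tfun h) }.

Definition tri_equivalent (C D : tricat) :=
  exists F : tri_functor C D, is_equivalence F.

(** * The bounded derived category of finitely generated left modules *)

Section DerivedCategory.
Variable A : pzRingType.

Definition fin_gen (M : lmodType A) :=
  exists (n : nat) (g : 'I_n -> M),
    forall x : M, exists c : 'I_n -> A, x = \sum_i c i *: g i.

Lemma fin_genX (M N : lmodType A) :
  fin_gen M -> fin_gen N -> fin_gen (M * N)%type.
Proof.
move=> [m [g gM]] [n [h hN]]; exists (m + n)%N.
exists (fun i => match split i with inl a => (g a, 0) | inr b => (0, h b) end).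
move=> [x y]; have [a ->] := gM x; have [b ->] := hN y.
exists (fun i => match split i with inl i => a i | inr j => b j end).
have spl i : split (lshift n i) = inl i := @unsplitK m n (inl i).
have spr j : split (rshift m j) = inr j := @unsplitK m n (inr j).
have sumE (I : finType) (F : I -> (M * N)%type) :
    \sum_i F i = (\sum_i (F i).1, \sum_i (F i).2).
  by elim/big_rec3: _ => [|i u v w _ ->] //=; case: (F i).
rewrite big_split_ord /= !sumE; congr pair => /=.
  rewrite [X in _ + X]big1 => [|i _]; last by rewrite spr /= scaler0.
  by rewrite addr0; apply: eq_bigr => i _; rewrite spl.
rewrite [X in X + _]big1 => [|i _]; last by rewrite spl /= scaler0.
by rewrite add0r; apply: eq_bigr => i _; rewrite spr.
Qed.

Record complex := Complex {
  cobj :> int -> lmodType A;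
  cdiff : forall n, {linear cobj n -> cobj (n + 1)};
  cdiffK : forall n (x : cobj n), cdiff (n + 1) (cdiff n x) = 0;
  cobj_fg : forall n, fin_gen (cobj n);
  cobj_bounded : exists N : nat,
    forall n : int, (N < `|n|)%N -> forall x : cobj n, x = 0 }.

Arguments cdiff X {n} : rename.

Record chain_map (X Y : complex) := ChainMap {
  chain_fun :> forall n, {linear X n -> Y n};
  chain_comm : forall n (x : X n),
    chain_fun (n + 1) (cdiff X x) = cdiff Y (chain_fun n x) }.

Program Definition chain_id X : chain_map X X :=
  @ChainMap X X (fun n => idfun) _.
Next Obligation. by []. Qed.

Program Definition chain_comp X Y Z (g : chain_map Y Z) (f : chain_map X Y)
    : chain_map X Z :=
  @ChainMap X Z (fun n => g n \o f n) _.
Next Obligation. by move=> X Y Z g f n x; rewrite /= !chain_comm. Qed.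

Definition chain_eq X Y (f g : chain_map X Y) := forall n, f n =1 g n.

(* Injectivity and surjectivity of H^(n + 1)(f), for all n. *)
Definition quasi_iso X Y (f : chain_map X Y) := forall n,
  (forall x : X (n + 1), cdiff X x = 0 ->
     (exists y : Y n, f (n + 1) x = cdiff Y y) ->
     exists x' : X n, x = cdiff X x') /\
  (forall y : Y (n + 1), cdiff Y y = 0 ->
     exists x : X (n + 1), cdiff X x = 0 /\
     exists y' : Y n, y = f (n + 1) x + cdiff Y y').

Lemma bounded_shift (X : complex) : exists N : nat,
  forall n : int, (N < `|n|)%N -> forall x : X (n + 1), x = 0.
Proof.
have [N XN] := cobj_bounded X; exists N.+1 => n nN; apply: XN; lia.
Qed.

Program Definition shift (X : complex) : complex :=
  @Complex (fun n => X (n + 1)) (fun n => \- @cdiff X (n + 1)) _ _ _.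
Next Obligation. move=> X n x; rewrite /= raddfN opprK; exact: cdiffK. Qed.
Next Obligation. by move=> X n; apply: cobj_fg. Qed.
Next Obligation. exact: bounded_shift. Qed.

Program Definition shift_map X Y (f : chain_map X Y)
    : chain_map (shift X) (shift Y) :=
  @ChainMap (shift X) (shift Y) (fun n => f (n + 1)) _.
Next Obligation. by move=> X Y f n x; rewrite /= linearN; congr (- _); exact: chain_comm. Qed.

Lemma quasi_iso_shift X Y (f : chain_map X Y) :
  quasi_iso f -> quasi_iso (shift_map f).
Proof.
move=> qf n; have [inj_f surj_f] := qf (n + 1); split=> [x /= dx [y fx]|y /= dy].
  have dx' : cdiff X x = 0 by apply/eqP; rewrite -oppr_eq0; apply/eqP.
  have [|x' ->] := inj_f x dx'; last first.
    by exists (- x'); rewrite /= raddfN opprK.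
  by exists (- y); rewrite raddfN.
have dy' : cdiff Y y = 0 by apply/eqP; rewrite -oppr_eq0; apply/eqP.
have [x [dx [y' ->]]] := surj_f y dy'; exists x; rewrite /= dx oppr0; split=> //.
by exists (- y'); rewrite raddfN opprK.
Qed.

(* The mapping cone: d (x, y) = (- d x, f x + d y) on X^(n + 1) x Y^n. *)
Section Cone.
Variables (X Y : complex) (f : chain_map X Y).

Definition cone_obj (n : int) : lmodType A := (X (n + 1)%R * Y n)%type.

Definition cone_diff n (p : cone_obj n) : cone_obj (n + 1) :=
  (- cdiff X p.1, f (n + 1) p.1 + cdiff Y p.2).

Let cone_diff_linear n : linear (@cone_diff n).
Proof.
move=> a [x y] [x' y']; rewrite /cone_diff /= !linearP.
rewrite [RHS]surjective_pairing; congr pair.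
by rewrite /= scalerDr addrACA.
Qed.
HB.instance Definition _ n := GRing.isLinear.Build A (cone_obj n)
  (cone_obj (n + 1)) *:%R (@cone_diff n) (@cone_diff_linear n).

Program Definition cone : complex :=
  @Complex cone_obj (fun n => @cone_diff n) _ _ _.
Next Obligation.
move=> n [x y]; rewrite [LHS]surjective_pairing [RHS]surjective_pairing /=.
congr pair; rewrite linearN; first by rewrite opprK; apply: cdiffK.
by rewrite linearD cdiffK addr0 -chain_comm addNr.
Qed.
Next Obligation. by move=> n; apply: fin_genX; apply: cobj_fg. Qed.
Next Obligation.
have [N XN] := bounded_shift X; have [M YM] := cobj_bounded Y.
exists (maxn N M) => n; rewrite gtn_max => /andP[nN nM] [x y].
by rewrite (XN n nN x) (YM n nM y).
Qed.

Definition cone_in_fun n (y : Y n) : cone n := (0, y).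
Definition cone_out_fun n (p : cone n) : shift X n := p.1.

Let cone_in_linear n : linear (@cone_in_fun n).
Proof. by move=> a y y'; rewrite [RHS]surjective_pairing /= scaler0 addr0. Qed.
HB.instance Definition _ n := GRing.isLinear.Build A (Y n) (cone n) *:%R
  (@cone_in_fun n) (@cone_in_linear n).

Let cone_out_linear n : linear (@cone_out_fun n).
Proof. by []. Qed.
HB.instance Definition _ n := GRing.isLinear.Build A (cone n) (shift X n) *:%R
  (@cone_out_fun n) (@cone_out_linear n).

Program Definition cone_in : chain_map Y cone :=
  @ChainMap Y cone (fun n => @cone_in_fun n) _.
Next Obligation.
by move=> n y; congr pair; rewrite /= !linear0 ?oppr0 ?add0r.
Qed.

Program Definition cone_out : chain_map cone (shift X) :=
  @ChainMap cone (shift X) (fun n => @cone_out_fun n) _.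
Next Obligation. by []. Qed.

End Cone.

(* Morphisms of the localization of the category of bounded complexes at the
   quasi-isomorphisms (Gabriel-Zisman): words in chain maps and formal inverses
   of quasi-isomorphisms, modulo the congruence [dheq]. *)
Inductive dhom : complex -> complex -> Type :=
| did X : dhom X X
| dmap X Y (f : chain_map X Y) : dhom X Y
| dinv X Y (s : chain_map X Y) (qs : quasi_iso s) : dhom Y X
| dcomp X Y Z (g : dhom Y Z) (f : dhom X Y) : dhom X Z.

Inductive dheq : forall X Y, dhom X Y -> dhom X Y -> Prop :=
| dheq_refl X Y (f : dhom X Y) : dheq f f
| dheq_sym X Y (f g : dhom X Y) : dheq f g -> dheq g f
| dheq_trans X Y (f g h : dhom X Y) : dheq f g -> dheq g h -> dheq f h
| dheq_comp X Y Z (g g' : dhom Y Z) (f f' : dhom X Y) :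
    dheq g g' -> dheq f f' -> dheq (dcomp g f) (dcomp g' f')
| dheqA X Y Z W (h : dhom Z W) (g : dhom Y Z) (f : dhom X Y) :
    dheq (dcomp h (dcomp g f)) (dcomp (dcomp h g) f)
| dheq1m X Y (f : dhom X Y) : dheq (dcomp (did Y) f) f
| dheqm1 X Y (f : dhom X Y) : dheq (dcomp f (did X)) f
| dheq_map X Y (f g : chain_map X Y) : chain_eq f g -> dheq (dmap f) (dmap g)
| dheq_map_id X : dheq (dmap (chain_id X)) (did X)
| dheq_map_comp X Y Z (g : chain_map Y Z) (f : chain_map X Y) :
    dheq (dmap (chain_comp g f)) (dcomp (dmap g) (dmap f))
| dheq_invl X Y (s : chain_map X Y) (qs : quasi_iso s) :
    dheq (dcomp (dinv qs) (dmap s)) (did X)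
| dheq_invr X Y (s : chain_map X Y) (qs : quasi_iso s) :
    dheq (dcomp (dmap s) (dinv qs)) (did Y).

Definition derived_cat : category :=
  Category dheq_refl dheq_sym dheq_trans dheq_comp dheqA dheq1m dheqm1.

Definition dmor X Y (f : chain_map X Y) : @Hom derived_cat X Y := dmap f.

Fixpoint dshift_hom X Y (f : dhom X Y) : dhom (shift X) (shift Y) :=
  match f with
  | did X => did (shift X)
  | dmap X Y f => dmap (shift_map f)
  | dinv X Y s qs => dinv (quasi_iso_shift qs)
  | dcomp X Y Z g f => dcomp (dshift_hom g) (dshift_hom f)
  end.

Lemma dshift_heq X Y (f g : dhom X Y) :
  dheq f g -> dheq (dshift_hom f) (dshift_hom g).
Proof.
elim=> /= {X Y f g}.
- by move=> X Y f; apply: dheq_refl.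
- by move=> X Y f g _; apply: dheq_sym.
- by move=> X Y f g h _ fg _; apply: dheq_trans.
- by move=> X Y Z g g' f f' _ gg' _ ff'; apply: dheq_comp.
- by move=> X Y Z W h g f; apply: dheqA.
- by move=> X Y f; apply: dheq1m.
- by move=> X Y f; apply: dheqm1.
- by move=> X Y f g fg; apply: dheq_map => n; apply: fg.
- by move=> X; apply: dheq_trans (dheq_map_id _); apply: dheq_map.
- move=> X Y Z g f; apply: dheq_trans (dheq_map_comp _ _).
  exact: dheq_map.
- by move=> X Y s qs; apply: dheq_invl.
- by move=> X Y s qs; apply: dheq_invr.
Qed.

Definition dshift : functor derived_cat derived_cat :=
  @Functor derived_cat derived_cat shift dshift_hom dshift_heq
    (fun X => dheq_refl _) (fun X Y Z g f => dheq_refl _).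

(* Triangles isomorphic to X' -> Y' -> cone(f) -> X'[1], f a chain map. *)
Definition ddist (X Y Z : derived_cat)
    (a : Hom X Y) (b : Hom Y Z) (c : Hom Z (dshift X)) : Prop :=
  exists (X' Y' : complex) (f : chain_map X' Y'),
  exists (i : @Hom derived_cat X X') (j : @Hom derived_cat Y Y')
         (l : @Hom derived_cat Z (cone f)),
    [/\ is_iso i, is_iso j & is_iso l] /\
    [/\ j \oc a === dmor f \oc i,
        l \oc b === dmor (cone_in f) \oc j &
        fmap dshift i \oc c === dmor (cone_out f) \oc l].

Definition Db : tricat := @TriCat derived_cat dshift ddist.

End DerivedCategory.

(** * The rectangle with one branch

    The rectangle has top row t_1, ..., t_u and bottom row b_1, ..., b_u; the
    branch c_1, ..., c_v is attached by b_u -> c_1, t_u -> c_1, c_v -> b_1 or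
    c_v -> t_1, according to the corner [w]. *)

Variant corner := lower_right | upper_right | lower_left | upper_left.

Section RectangleWithBranch.
Variables (k : fieldType) (u v : nat) (w : corner).

(* [vt i], [vb i], [vc i] are the vertices t_(i+1), b_(i+1), c_(i+1). *)
Definition vertex : finType := ('I_u + 'I_u + 'I_v)%type.
Definition vt (i : 'I_u) : vertex := inl (inl i).
Definition vb (i : 'I_u) : vertex := inl (inr i).
Definition vc (i : 'I_v) : vertex := inr i.

Definition arrow (x y : vertex) : bool :=
  match x, y with
  | inl (inl i), inl (inl j) => j == i.+1 :> nat
  | inl (inr i), inl (inr j) => j == i.+1 :> nat
  | inl (inl i), inl (inr j) => i == j
  | inl (inr _), inl (inl _) => false
  | inr i, inr j => j == i.+1 :> nat
  | inl (inr i), inr j =>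
    if w is lower_right then (i.+1 == u) && (j == 0 :> nat) else false
  | inl (inl i), inr j =>
    if w is upper_right then (i.+1 == u) && (j == 0 :> nat) else false
  | inr i, inl (inr j) =>
    if w is lower_left then (i.+1 == v) && (j == 0 :> nat) else false
  | inr i, inl (inl j) =>
    if w is upper_left then (i.+1 == v) && (j == 0 :> nat) else false
  end.

Definition commutativity (x : path_algebra k arrow) : Prop :=
  exists (i j : 'I_u) (p q : qpath arrow),
    [/\ j = i.+1 :> nat,
        val p = (vt i, [:: vt j; vb j]),
        val q = (vt i, [:: vb i; vb j]) &
        x = pbasis k p - pbasis k q].

Definition rect_algebra := quotient_ring commutativity.
HB.instance Definition _ := GRing.PzRing.on rect_algebra.

End RectangleWithBranch.

(* A(u)_v, A(u)^v, _vA(u) and ^vA(u), in this order. *)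
Definition A_lower_right k u v : pzRingType := rect_algebra k u v lower_right.
Definition A_upper_right k u v : pzRingType := rect_algebra k u v upper_right.
Definition A_lower_left k u v : pzRingType := rect_algebra k u v lower_left.
Definition A_upper_left k u v : pzRingType := rect_algebra k u v upper_left.

(* Main.v *)
From Stdlib Require Import Setoid Morphisms.
From HB Require Import structures.
From mathcomp Require Import all_boot all_algebra.
From mathcomp Require Import finmap monalg generic_quotient ring_quotient.
From mathcomp Require Import boolp zify.
Require Import Defs.

Set Implicit Arguments.
Unset Strict Implicit.
Unset Printing Implicit Defensive.

Import GRing.Theory Quotient.
Local Open Scope ring_scope.
Local Open Scope quotient_scope.
Local Open Scope cat_scope.
#[local] Obligation Tactic := idtac.

(** All four algebras are incidence algebras of finite partially ordered sets:
    in each of them two paths with the same ends are equal.  A complex of modules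
    over such an algebra is thus a diagram of complexes of vector spaces on the
    ordered set, and the equivalences come from a construction of Ladkani on
    these diagrams, the flip.

    Let X and Y be ordered sets and f : X -> Y a monotone map.  On the disjoint
    union of X and Y there are two orders that extend those of X and Y: in the
    source order, x <= y when f x <= y; in the target order, y <= x when
    y <= f x.  A diagram R on the source order gives a diagram on the target
    order, equal to R on Y and to the cone of R x -> R (f x) at x in X; the
    canonical maps R (f x) -> cone give the structure maps from Y to X.
    Conversely, a diagram S on the target order gives a diagram on the source
    order, with the cone of S (f x) -> S x at x, which maps to the shift of
    S (f x), and the shift of S y at y.  By the rotation of triangles
    ([rotate_in_qis], [rotate_out_qis]) both composites are naturally
    quasi-isomorphic to the shift, so that the two diagram categories have
    equivalent derived categories ([flip_equivalent], [unflip_equivalent]).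

    The branch is moved by three flips.  With X the top row, Y the rest and f the
    vertical arrows, the two rows exchange their roles: this moves a branch
    attached to the bottom row to the top row, whether it is attached on the
    right or on the left ([lower_upper]).  A branch that leaves the top right
    corner becomes a branch that enters the top left corner in two steps
    ([right_to_left]).  First X consists of all columns but the last one, Y of the
    last column and the branch, and f projects to the last column; after the
    flip, the last column comes first, and the branch leaves its top vertex.  Then
    X is the branch and f the constant map to this vertex; undoing a flip turns
    the outgoing branch into an incoming one.

    To compare the derived categories, the localization at quasi-isomorphisms is
    taken for an abstract [model], a category with weak equivalences, shifts and
    cones.  A functor of models induces a triangle functor
    ([loc_tri_functor]), and a natural weak equivalence a natural isomorphism
    ([loc_niso]).  This applies to complexes of modules and to diagrams of
    complexes alike, and modules over an incidence algebra are compared with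
    diagrams in [modules_to_diagrams] and [diagrams_to_modules]. *)

(** * Functors, natural isomorphisms and equivalences *)

#[local] Instance heq_equivalence (C : category) (X Y : C) :
  Equivalence (@heq C X Y).
Proof.
split; [exact: heq_refl | exact: heq_sym | move=> f g h; exact: heq_trans].
Qed.

#[local] Instance compm_proper (C : category) (X Y Z : C) :
  Proper (heq ==> heq ==> heq) (@compm C X Y Z).
Proof. by move=> g g' gg' f f' ff'; apply: compm_heq. Qed.

#[local] Instance fmap_proper (C D : category) (F : functor C D) (X Y : C) :
  Proper (heq ==> heq) (@fmap C D F X Y).
Proof. by move=> f g; apply: fmap_heq. Qed.

#[local] Hint Resolve heq_refl : core.

Lemma is_iso_id (C : category) (X : C) : is_iso (idm X).
Proof. by exists (idm X); split; apply: comp1m. Qed.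

Lemma is_iso_comp (C : category) (X Y Z : C) (g : Hom Y Z) (f : Hom X Y) :
  is_iso g -> is_iso f -> is_iso (g \oc f).
Proof.
move=> [g' [g'g gg']] [f' [f'f ff']]; exists (f' \oc g'); split.
  by rewrite -compmA (compmA g') g'g comp1m.
by rewrite -compmA (compmA f) ff' comp1m.
Qed.

Lemma is_iso_fmap (C D : category) (F : functor C D) (X Y : C) (f : Hom X Y) :
  is_iso f -> is_iso (fmap F f).
Proof.
by move=> [g [gf fg]]; exists (fmap F g); rewrite -!fmap_comp gf fg !fmap_id.
Qed.

(** The naturality square of a transformation whose components are identities. *)
Lemma heq_id_square (C : category) (X Y : C) (f g : Hom X Y) :
  f === g -> idm Y \oc f === g \oc idm X.
Proof. by move=> fg; rewrite comp1m compm1. Qed.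

Section NaturalIsos.
Variables B C D E : category.

(** The inverses are obtained by choice, since [is_iso] is a mere existence. *)
Definition niso_sym (F G : functor C D) (n : nat_iso F G) : nat_iso G F.
Proof.
have [m mP] : {m : forall X, Hom (G X) (F X) |
    forall X, m X \oc n X === idm _ /\ n X \oc m X === idm _}.
  exists (fun X => projT1 (cid (niso_iso n X))) => X.
  exact: (projT2 (cid (niso_iso n X))).
have [mn nm] := (fun X => proj1 (mP X), fun X => proj2 (mP X)).
exists m => [X|X Y f]; first by exists (n X); split; [apply: nm | apply: mn].
have e : m Y \oc (n Y \oc fmap F f) \oc m X === m Y \oc fmap G f.
  by rewrite niso_nat -!compmA nm compm1.
by rewrite -e compmA mn comp1m.
Defined.

Definition niso_trans (F G H : functor C D) (m : nat_iso G H) (n : nat_iso F G) :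
  nat_iso F H.
Proof.
exists (fun X => m X \oc n X) => [X|X Y f].
  by apply: is_iso_comp; apply: niso_iso.
by rewrite -compmA niso_nat compmA niso_nat compmA.
Defined.

Definition niso_whisker_left (H : functor D E) (F G : functor C D)
  (n : nat_iso F G) : nat_iso (compF H F) (compF H G).
Proof.
exists (fun X => fmap H (n X)) => [X|X Y f] /=.
  by apply: is_iso_fmap; apply: niso_iso.
by rewrite -!fmap_comp niso_nat.
Defined.

Definition niso_whisker_right (F G : functor C D) (n : nat_iso F G)
  (H : functor B C) : nat_iso (compF F H) (compF G H).
Proof.
exists (fun X => n (H X)) => [X|X Y f] /=; first exact: niso_iso.
exact: niso_nat.
Defined.

Definition niso_assoc (H : functor D E) (G : functor C D) (F : functor B C) :
  nat_iso (compF H (compF G F)) (compF (compF H G) F).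
Proof.
exists (fun X => idm (H (G (F X)))) => [X|X Y f] /=; first exact: is_iso_id.
by rewrite comp1m compm1.
Defined.

Definition niso_idl (F : functor C D) : nat_iso (compF (idF D) F) F.
Proof.
apply: (@NatIso _ _ (compF (idF D) F) F (fun X => idm (F X))) => [X|X Y f] /=.
  exact: is_iso_id.
by rewrite comp1m compm1.
Defined.

Definition niso_idr (F : functor C D) : nat_iso (compF F (idF C)) F.
Proof.
apply: (@NatIso _ _ (compF F (idF C)) F (fun X => idm (F X))) => [X|X Y f] /=.
  exact: is_iso_id.
by rewrite comp1m compm1.
Defined.

End NaturalIsos.

(** A left inverse G and a right inverse H are isomorphic, to G F H, so that G is a
    two-sided inverse. *)
Lemma equivalence_of_inverses (C D : category) (F : functor C D)
    (G H : functor D C) :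
  nat_iso (compF G F) (idF C) -> nat_iso (compF F H) (idF D) ->
  is_equivalence F.
Proof.
move=> gf fh; exists G; split; constructor=> //.
have gh : nat_iso G H.
  apply: niso_trans (niso_idl H) _.
  apply: niso_trans (niso_whisker_right gf H) _.
  apply: niso_trans (niso_assoc G F H) _.
  apply: niso_trans (niso_sym (niso_idr G)).
  exact: niso_whisker_left (niso_sym fh).
exact: niso_trans fh (niso_whisker_left F gh).
Qed.

(** The form in which flips are inverted: going forth and back is the shift. *)
Lemma equivalence_of_quasi_inverse (C D : category) (F : functor C D)
    (G : functor D C) (S : functor C C) (T : functor D D) :
  is_equivalence S -> is_equivalence T ->
  nat_iso (compF G F) S -> nat_iso (compF F G) T -> is_equivalence F.
Proof.
move=> [S' [[s's] _]] [T' [_ [tt']]] gf fg.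
apply: (@equivalence_of_inverses _ _ _ (compF S' G) (compF G T')).
  apply: niso_trans s's _; apply: niso_trans (niso_sym (niso_assoc _ _ _)).
  exact: niso_whisker_left.
apply: niso_trans tt' _; apply: niso_trans (niso_assoc _ _ _).
exact: niso_whisker_right.
Qed.

Lemma equivalence_comp (C D E : category) (G : functor D E) (F : functor C D) :
  is_equivalence G -> is_equivalence F -> is_equivalence (compF G F).
Proof.
move=> [G' [[g'g] [gg']]] [F' [[f'f] [ff']]].
apply: (@equivalence_of_inverses _ _ _ (compF F' G') (compF F' G')).
  apply: niso_trans f'f _; apply: niso_trans (niso_sym (niso_assoc _ _ _)).
  apply: niso_whisker_left; apply: niso_trans (niso_idl F) _.
  apply: niso_trans (niso_whisker_right g'g F) (niso_assoc _ _ _).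
apply: niso_trans gg' _; apply: niso_trans (niso_sym (niso_assoc _ _ _)).
apply: niso_whisker_left; apply: niso_trans (niso_idl G') _.
apply: niso_trans (niso_whisker_right ff' G') (niso_assoc _ _ _).
Qed.

(** The equality of morphisms is a relation, which distinguished triangles need
    not respect in an arbitrary [tricat].  Only the third morphism of a triangle is
    affected when the comparisons of two triangle functors with the shift are
    composed. *)
Definition dist_stable (T : tricat) := forall (X Y Z : T) (f : Hom X Y)
  (g : Hom Y Z) (h h' : Hom Z (tshift X)),
  h === h' -> distinguished f g h -> distinguished f g h'.

Lemma tri_equivalent_trans (C D E : tricat) : dist_stable E ->
  tri_equivalent C D -> tri_equivalent D E -> tri_equivalent C E.
Proof.
move=> distE [F eqF] [G eqG].
unshelve eexists (@TriFunctor C E (compF G F) (@NatIso _ _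
  (compF (compF G F) tshift) (compF tshift (compF G F))
  (fun X => tfun_shift G (F X) \oc fmap G (tfun_shift F X)) _ _) _).
- move=> X; apply: (is_iso_comp (niso_iso (tfun_shift G) (F X))).
  exact: is_iso_fmap (niso_iso (tfun_shift F) X).
- move=> X Y f /=; have /= natG := niso_nat (tfun_shift G) (fmap F f).
  rewrite -compmA -fmap_comp (niso_nat (tfun_shift F) f) fmap_comp compmA natG.
  by rewrite compmA.
- move=> X Y Z f g h /(tfun_dist F) /(tfun_dist G); apply: distE => /=.
  by rewrite fmap_comp compmA.
exact: equivalence_comp.
Qed.

(** * Localization of a category with shifts and cones *)

(** What the derived category of bounded complexes is made from: a category
    with weak equivalences, a shift and mapping cones.  Besides complexes of
    modules, it covers diagrams of complexes. *)
Record model := Model {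
  mcat :> category;
  weq : forall X Y : mcat, Hom X Y -> Prop;
  mshift : functor mcat mcat;
  weq_shift : forall (X Y : mcat) (f : Hom X Y), weq f -> weq (fmap mshift f);
  mcone : forall X Y : mcat, Hom X Y -> mcat;
  mcone_in : forall (X Y : mcat) (f : Hom X Y), Hom Y (mcone f);
  mcone_out : forall (X Y : mcat) (f : Hom X Y), Hom (mcone f) (mshift X) }.

Arguments weq {m X Y}.
Arguments mshift {m}.
Arguments mcone {m X Y}.
Arguments mcone_in {m X Y}.
Arguments mcone_out {m X Y}.

Section Localization.
Variable M : model.

(** Morphisms are words in the morphisms of the model and in formal inverses of
    its weak equivalences, modulo the congruence [lheq], as in the localization of
    Gabriel and Zisman. *)
Inductive lhom : M -> M -> Type :=
| lid X : lhom X X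
| lmap (X Y : M) (f : Hom X Y) : lhom X Y
| linv (X Y : M) (s : Hom X Y) (ws : weq s) : lhom Y X
| lcomp X Y Z (g : lhom Y Z) (f : lhom X Y) : lhom X Z.

Inductive lheq : forall X Y, lhom X Y -> lhom X Y -> Prop :=
| lheq_refl X Y (f : lhom X Y) : lheq f f
| lheq_sym X Y (f g : lhom X Y) : lheq f g -> lheq g f
| lheq_trans X Y (f g h : lhom X Y) : lheq f g -> lheq g h -> lheq f h
| lheq_comp X Y Z (g g' : lhom Y Z) (f f' : lhom X Y) :
    lheq g g' -> lheq f f' -> lheq (lcomp g f) (lcomp g' f')
| lheqA X Y Z W (h : lhom Z W) (g : lhom Y Z) (f : lhom X Y) :
    lheq (lcomp h (lcomp g f)) (lcomp (lcomp h g) f)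
| lheq1m X Y (f : lhom X Y) : lheq (lcomp (lid Y) f) f
| lheqm1 X Y (f : lhom X Y) : lheq (lcomp f (lid X)) f
| lheq_map (X Y : M) (f g : Hom X Y) : f === g -> lheq (lmap f) (lmap g)
| lheq_map_id X : lheq (lmap (idm X)) (lid X)
| lheq_map_comp (X Y Z : M) (g : Hom Y Z) (f : Hom X Y) :
    lheq (lmap (g \oc f)) (lcomp (lmap g) (lmap f))
| lheq_invl (X Y : M) (s : Hom X Y) (ws : weq s) :
    lheq (lcomp (linv ws) (lmap s)) (lid X)
| lheq_invr (X Y : M) (s : Hom X Y) (ws : weq s) :
    lheq (lcomp (lmap s) (linv ws)) (lid Y).

Definition loc_cat : category :=
  Category lheq_refl lheq_sym lheq_trans lheq_comp lheqA lheq1m lheqm1.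

Definition lmor (X Y : M) (f : Hom X Y) : @Hom loc_cat X Y := lmap f.

Lemma lmor_heq (X Y : M) (f g : Hom X Y) : f === g -> lmor f === lmor g.
Proof. exact: lheq_map. Qed.

Lemma lmor_comp (X Y Z : M) (g : Hom Y Z) (f : Hom X Y) :
  lmor (g \oc f) === lmor g \oc lmor f.
Proof. exact: lheq_map_comp. Qed.

Lemma lmor_iso (X Y : M) (s : Hom X Y) : weq s -> is_iso (lmor s).
Proof.
by move=> ws; exists (linv ws); split; [apply: lheq_invl | apply: lheq_invr].
Qed.

End Localization.

Section LocalizedFunctor.
Variables (M N : model) (F : functor M N).
Hypothesis F_weq : forall (X Y : M) (s : Hom X Y), weq s -> weq (fmap F s).

Fixpoint loc_hom X Y (f : lhom X Y) : lhom (F X) (F Y) :=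
  match f with
  | lid X => lid (F X)
  | lmap X Y f => lmap (fmap F f)
  | linv X Y s ws => linv (F_weq ws)
  | lcomp X Y Z g f => lcomp (loc_hom g) (loc_hom f)
  end.

Lemma loc_hom_heq X Y (f g : lhom X Y) :
  lheq f g -> lheq (loc_hom f) (loc_hom g).
Proof.
elim=> /= {X Y f g}.
- by move=> X Y f; apply: lheq_refl.
- by move=> X Y f g _; apply: lheq_sym.
- by move=> X Y f g h _ fg _; apply: lheq_trans.
- by move=> X Y Z g g' f f' _ gg' _ ff'; apply: lheq_comp.
- by move=> X Y Z W h g f; apply: lheqA.
- by move=> X Y f; apply: lheq1m.
- by move=> X Y f; apply: lheqm1.
- by move=> X Y f g fg; apply: lheq_map; apply: fmap_heq.
- move=> X; apply: lheq_trans (lheq_map_id _); apply: lheq_map.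
  exact: fmap_id.
- move=> X Y Z g f; apply: lheq_trans (lheq_map_comp _ _).
  by apply: lheq_map; apply: fmap_comp.
- by move=> X Y s ws; apply: lheq_invl.
- by move=> X Y s ws; apply: lheq_invr.
Qed.

Definition locF : functor (loc_cat M) (loc_cat N) :=
  @Functor (loc_cat M) (loc_cat N) F loc_hom loc_hom_heq
    (fun X => lheq_refl _) (fun X Y Z g f => lheq_refl _).

End LocalizedFunctor.

(** A transformation that is natural for the morphisms of the model is natural
    for their formal inverses, hence for all morphisms of the localization. *)
Definition loc_niso (M N : model) (F G : functor (loc_cat M) (loc_cat N))
    (t : forall X : M, @Hom (loc_cat N) (F X) (G X)) :
    (forall X, is_iso (t X)) ->
    (forall (X Y : M) (f : Hom X Y),
       t Y \oc fmap F (lmor f) === fmap G (lmor f) \oc t X) ->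
  nat_iso F G.
Proof.
move=> t_iso t_nat; exists t => // X Y f.
elim: f => {X Y} [X|X Y f|X Y s ws|X Y Z g IHg f IHf].
- have F1 : fmap F (lid X) === _ := fmap_id F X.
  have G1 : fmap G (lid X) === _ := fmap_id G X.
  by rewrite F1 G1 comp1m compm1.
- exact: t_nat.
- have Fs : fmap F (lmor s) \oc fmap F (linv ws) === idm _.
    rewrite -fmap_comp -(fmap_id F); apply: fmap_heq; exact: lheq_invr.
  have Gs : fmap G (linv ws) \oc fmap G (lmor s) === idm _.
    rewrite -fmap_comp -(fmap_id G); apply: fmap_heq; exact: lheq_invl.
  by rewrite -[X in X === _]comp1m -Gs -compmA (compmA (fmap G (lmor s)))
       -t_nat -!compmA Fs compm1.
- have Fc : fmap F (lcomp g f) === _ := fmap_comp F g f.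
  have Gc : fmap G (lcomp g f) === _ := fmap_comp G g f.
  by rewrite Fc Gc compmA IHg -compmA IHf compmA.
Defined.

Section LocTricat.
Variable M : model.

Definition lshift : functor (loc_cat M) (loc_cat M) := locF (@weq_shift M).

Definition ldist (X Y Z : loc_cat M)
    (a : Hom X Y) (b : Hom Y Z) (c : Hom Z (lshift X)) : Prop :=
  exists (X' Y' : M) (f : Hom X' Y'),
  exists (i : @Hom (loc_cat M) X X') (j : @Hom (loc_cat M) Y Y')
         (l : @Hom (loc_cat M) Z (mcone f)),
    [/\ is_iso i, is_iso j & is_iso l] /\
    [/\ j \oc a === lmor f \oc i,
        l \oc b === lmor (mcone_in f) \oc j &
        fmap lshift i \oc c === lmor (mcone_out f) \oc l].

Definition Loc : tricat := @TriCat (loc_cat M) lshift ldist.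

Lemma Loc_dist_stable : dist_stable Loc.
Proof.
move=> X Y Z a b c c' cc' [X' [Y' [f [i [j [l [isos [sa sb sc]]]]]]]].
exists X', Y', f, i, j, l; split=> //; split=> //.
have -> : fmap lshift i \oc c' === fmap lshift i \oc c.
  by apply: compm_heq; [apply: heq_refl | apply: heq_sym].
exact: sc.
Qed.

End LocTricat.

(** Shifts and cones are preserved up to weak equivalences that are compatible
    with the maps of the triangle X -> Y -> cone -> X[1]; this is enough for the
    localized functor to preserve distinguished triangles. *)
Record model_functor (M N : model) := ModelFunctor {
  mfun :> functor M N;
  mf_weq : forall (X Y : M) (s : Hom X Y), weq s -> weq (fmap mfun s);
  mf_shift : forall X : M, Hom (mfun (mshift X)) (mshift (mfun X));
  mf_shift_weq : forall X, weq (mf_shift X);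
  mf_shift_nat : forall (X Y : M) (f : Hom X Y),
    mf_shift Y \oc fmap mfun (fmap mshift f)
      === fmap mshift (fmap mfun f) \oc mf_shift X;
  mf_cone : forall (X Y : M) (f : Hom X Y),
    Hom (mfun (mcone f)) (mcone (fmap mfun f));
  mf_cone_weq : forall (X Y : M) (f : Hom X Y), weq (mf_cone f);
  mf_cone_in : forall (X Y : M) (f : Hom X Y),
    mf_cone f \oc fmap mfun (mcone_in f) === mcone_in (fmap mfun f);
  mf_cone_out : forall (X Y : M) (f : Hom X Y),
    mf_shift X \oc fmap mfun (mcone_out f)
      === mcone_out (fmap mfun f) \oc mf_cone f }.

Section LocalizedModelFunctor.
Variables (M N : model) (F : model_functor M N).

Let LF := locF (@mf_weq M N F).

Let LF_shift : nat_iso (compF LF (@lshift M)) (compF (@lshift N) LF).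
Proof.
apply: (@loc_niso M N (compF LF (@lshift M)) (compF (@lshift N) LF)
          (fun X => lmor (mf_shift F X))) => [X|X Y f].
  exact: lmor_iso (mf_shift_weq F X).
apply: heq_trans (lmor_comp _ _).
apply: heq_trans (heq_sym (lmor_comp _ _)) _.
by apply: lmor_heq; apply: mf_shift_nat.
Defined.

Lemma loc_dist (X Y Z : Loc M) (f : Hom X Y) (g : Hom Y Z)
    (h : Hom Z (tshift X)) :
  distinguished f g h ->
  @distinguished (Loc N) _ _ _ (fmap LF f) (fmap LF g) (LF_shift X \oc fmap LF h).
Proof.
move=> [X' [Y' [p [i [j [l [[isoi isoj isol] [sa sb sc]]]]]]]].
exists (F X'), (F Y'), (fmap F p), (fmap LF i), (fmap LF j).
exists (lmor (mf_cone F p) \oc fmap LF l); split.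
  split; try exact: is_iso_fmap.
  apply: is_iso_comp (lmor_iso (mf_cone_weq F _)) _.
  exact: is_iso_fmap.
split.
- by have := fmap_heq LF sa; rewrite !fmap_comp.
- have := fmap_heq LF sb; rewrite !fmap_comp => e.
  rewrite -compmA e compmA; apply: compm_heq; last exact: heq_refl.
  apply: heq_trans (heq_sym (lmor_comp _ _)) _.
  by apply: lmor_heq; apply: mf_cone_in.
have := fmap_heq LF sc; rewrite !fmap_comp => e.
have natS := niso_nat LF_shift i.
apply: heq_trans (compmA _ _ _) _.
apply: (heq_trans (compm_heq (heq_sym natS) (heq_refl _))).
apply: heq_trans (heq_sym (compmA _ _ _)) _.
apply: (heq_trans (compm_heq (heq_refl _) e)).
rewrite !compmA; apply: compm_heq; last exact: heq_refl.
apply: heq_trans (lmor_comp _ _).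
apply: heq_trans (heq_sym (lmor_comp _ _)) _.
by apply: lmor_heq; apply: mf_cone_out.
Qed.

Definition loc_tri_functor : tri_functor (Loc M) (Loc N) :=
  @TriFunctor (Loc M) (Loc N) LF LF_shift loc_dist.

End LocalizedModelFunctor.

(** * The derived category as a localization *)

Arguments cdiff {A} c {n}.

Definition mklin (K : pzRingType) (U V : lmodType K) (f : U -> V)
    (fl : linear f) : {linear U -> V} :=
  HB.pack f (GRing.isLinear.Build K U V *:%R f fl).

Definition mkchain (K : pzRingType) (X Y : complex K) (f : forall n, X n -> Y n)
    (fl : forall n, linear (f n))
    (fd : forall n (x : X n), f (n + 1) (cdiff X x) = cdiff Y (f n x)) :
    chain_map X Y :=
  @ChainMap K X Y (fun n => mklin (fl n)) fd.

Section ComplexModel.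
Variable K : pzRingType.

Program Definition chain_cat : category :=
  @Category (complex K) (@chain_map K) (@chain_eq K) (@chain_id K)
    (@chain_comp K) _ _ _ _ _ _ _.
Next Obligation. by []. Qed.
Next Obligation. by move=> X Y f g fg n x; rewrite fg. Qed.
Next Obligation. by move=> X Y f g h fg gh n x; rewrite fg gh. Qed.
Next Obligation. by move=> X Y Z g g' f f' gg' ff' n x; rewrite /= ff' gg'. Qed.
Next Obligation. by []. Qed.
Next Obligation. by []. Qed.
Next Obligation. by []. Qed.

Program Definition chain_shift : functor chain_cat chain_cat :=
  @Functor chain_cat chain_cat (@shift K) (@shift_map K) _ _ _.
Next Obligation. by move=> X Y f g fg n x; apply: fg. Qed.
Next Obligation. by []. Qed.
Next Obligation. by []. Qed.

Definition cplx : model :=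
  @Model chain_cat (@quasi_iso K) chain_shift (@quasi_iso_shift K)
    (@cone K) (@cone_in K) (@cone_out K).

(** [Db K] and [Loc cplx] have the same objects and their morphisms are words in
    the same letters, so that translating words letter by letter, in either
    direction, gives triangle functors that are inverse to each other. *)
Fixpoint loc_of_db (X Y : complex K) (f : dhom X Y) : @lhom cplx X Y :=
  match f with
  | did X => @lid cplx X
  | dmap X Y f => @lmap cplx X Y f
  | dinv X Y s qs => @linv cplx X Y s qs
  | dcomp X Y Z g f => lcomp (loc_of_db g) (loc_of_db f)
  end.

Fixpoint db_of_loc (X Y : complex K) (f : @lhom cplx X Y) : dhom X Y :=
  match f with
  | lid X => did X
  | lmap X Y f => dmap f
  | linv X Y s ws => dinv ws
  | lcomp X Y Z g f => dcomp (db_of_loc g) (db_of_loc f)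
  end.

Lemma loc_of_db_heq X Y (f g : @dhom K X Y) :
  dheq f g -> lheq (loc_of_db f) (loc_of_db g).
Proof.
elim=> /= {X Y f g}.
- by move=> X Y f; apply: lheq_refl.
- by move=> X Y f g _; apply: lheq_sym.
- by move=> X Y f g h _ fg _; apply: lheq_trans.
- by move=> X Y Z g g' f f' _ gg' _ ff'; apply: lheq_comp.
- by move=> X Y Z W h g f; apply: lheqA.
- by move=> X Y f; apply: lheq1m.
- by move=> X Y f; apply: lheqm1.
- by move=> X Y f g fg; apply: lheq_map.
- by move=> X; apply: lheq_map_id.
- by move=> X Y Z g f; apply: lheq_map_comp.
- by move=> X Y s qs; apply: lheq_invl.
- by move=> X Y s qs; apply: lheq_invr.
Qed.

Lemma db_of_loc_heq (X Y : cplx) (f g : lhom X Y) :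
  lheq f g -> dheq (db_of_loc f) (db_of_loc g).
Proof.
elim=> /= {X Y f g}.
- by move=> X Y f; apply: dheq_refl.
- by move=> X Y f g _; apply: dheq_sym.
- by move=> X Y f g h _ fg _; apply: dheq_trans.
- by move=> X Y Z g g' f f' _ gg' _ ff'; apply: dheq_comp.
- by move=> X Y Z W h g f; apply: dheqA.
- by move=> X Y f; apply: dheq1m.
- by move=> X Y f; apply: dheqm1.
- by move=> X Y f g fg; apply: dheq_map.
- by move=> X; apply: dheq_map_id.
- by move=> X Y Z g f; apply: dheq_map_comp.
- by move=> X Y s qs; apply: dheq_invl.
- by move=> X Y s qs; apply: dheq_invr.
Qed.

Definition loc_of_dbF : functor (Db K) (Loc cplx) :=
  @Functor (Db K) (Loc cplx) id loc_of_db loc_of_db_heq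
    (fun X => lheq_refl _) (fun X Y Z g f => lheq_refl _).

Definition db_of_locF : functor (Loc cplx) (Db K) :=
  @Functor (Loc cplx) (Db K) id db_of_loc db_of_loc_heq
    (fun X => dheq_refl _) (fun X Y Z g f => dheq_refl _).

Lemma loc_of_dbK : nat_iso (compF db_of_locF loc_of_dbF) (idF (Db K)).
Proof.
apply: (@NatIso _ _ (compF db_of_locF loc_of_dbF) (idF (Db K))
  (fun X => @idm (Db K) X)) => [X|X Y f]; first exact: is_iso_id.
apply: heq_id_square => /=.
elim: f => {X Y} [X|X Y f|X Y s qs|X Y Z g IHg f IHf];
  by [apply: dheq_refl | apply: dheq_comp].
Qed.

Lemma db_of_locK : nat_iso (compF loc_of_dbF db_of_locF) (idF (Loc cplx)).
Proof.
apply: (@NatIso _ _ (compF loc_of_dbF db_of_locF) (idF (Loc cplx))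
  (fun X => @idm (Loc cplx) X)) => [X|X Y f]; first exact: is_iso_id.
apply: heq_id_square => /=.
elim: f => {X Y} [X|X Y f|X Y s qs|X Y Z g IHg f IHf];
  by [apply: lheq_refl | apply: lheq_comp].
Qed.

Definition loc_of_db_shift :
  nat_iso (compF loc_of_dbF tshift) (compF tshift loc_of_dbF).
Proof.
apply: (@NatIso _ _ (compF loc_of_dbF tshift) (compF tshift loc_of_dbF)
  (fun X => @idm (Loc cplx) (shift X))) => [X|X Y f]; first exact: is_iso_id.
apply: heq_id_square => /=.
elim: f => {X Y} [X|X Y f|X Y s qs|X Y Z g IHg f IHf];
  by [apply: lheq_refl | apply: lheq_comp].
Defined.

Definition db_of_loc_shift :
  nat_iso (compF db_of_locF tshift) (compF tshift db_of_locF).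
Proof.
apply: (@NatIso _ _ (compF db_of_locF tshift) (compF tshift db_of_locF)
  (fun X => @idm (Db K) (shift X))) => [X|X Y f]; first exact: is_iso_id.
apply: heq_id_square => /=.
elim: f => {X Y} [X|X Y f|X Y s qs|X Y Z g IHg f IHf];
  by [apply: dheq_refl | apply: dheq_comp].
Defined.

Lemma Db_dist_stable : dist_stable (Db K).
Proof.
move=> X Y Z a b c c' cc' [X' [Y' [f [i [j [l [isos [sa sb sc]]]]]]]].
exists X', Y', f, i, j, l; split=> //; split=> //.
by apply: heq_trans sc; apply: compm_heq => //; apply: heq_sym.
Qed.

Lemma loc_of_db_dist (X Y Z : Db K) (f : Hom X Y) (g : Hom Y Z)
    (h : Hom Z (tshift X)) :
  distinguished f g h ->
  distinguished (fmap loc_of_dbF f) (fmap loc_of_dbF g)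
    (loc_of_db_shift X \oc fmap loc_of_dbF h).
Proof.
move=> [X' [Y' [p [i [j [l [[isoi isoj isol] [sa sb sc]]]]]]]].
apply: (Loc_dist_stable (heq_sym (comp1m _))).
exists X', Y', p, (fmap loc_of_dbF i), (fmap loc_of_dbF j), (fmap loc_of_dbF l).
split; first by split; apply: is_iso_fmap.
have := niso_nat loc_of_db_shift i; rewrite comp1m compm1 => ei.
split; [exact: (fmap_heq loc_of_dbF sa) | exact: (fmap_heq loc_of_dbF sb) |].
apply: heq_trans (fmap_heq loc_of_dbF sc).
by apply: compm_heq => //; apply: heq_sym.
Qed.

Lemma db_of_loc_dist (X Y Z : Loc cplx) (f : Hom X Y) (g : Hom Y Z)
    (h : Hom Z (tshift X)) :
  distinguished f g h ->
  distinguished (fmap db_of_locF f) (fmap db_of_locF g)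
    (db_of_loc_shift X \oc fmap db_of_locF h).
Proof.
move=> [X' [Y' [p [i [j [l [[isoi isoj isol] [sa sb sc]]]]]]]].
apply: (Db_dist_stable (heq_sym (comp1m _))).
exists X', Y', p, (fmap db_of_locF i), (fmap db_of_locF j), (fmap db_of_locF l).
split; first by split; apply: is_iso_fmap.
have := niso_nat db_of_loc_shift i; rewrite comp1m compm1 => ei.
split; [exact: (fmap_heq db_of_locF sa) | exact: (fmap_heq db_of_locF sb) |].
apply: heq_trans (fmap_heq db_of_locF sc).
by apply: compm_heq => //; apply: heq_sym.
Qed.

Lemma tri_equivalent_Db_Loc : tri_equivalent (Db K) (Loc cplx).
Proof.
exists (TriFunctor loc_of_db_dist).
exact: equivalence_of_inverses loc_of_dbK db_of_locK.
Qed.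

Lemma tri_equivalent_Loc_Db : tri_equivalent (Loc cplx) (Db K).
Proof.
exists (TriFunctor db_of_loc_dist).
exact: equivalence_of_inverses db_of_locK loc_of_dbK.
Qed.

End ComplexModel.

(** * Cones of complexes *)

(* These rearrangements are proved in an abelian group because in a complex the
   additions of degrees, on which the types depend, get in the way. *)
Section AdditiveIdentities.
Variable V : zmodType.
Implicit Types p q r s t : V.

Lemma add_cross p q r s : p + q = r + s -> p - r = s - q.
Proof. by move=> e; rewrite -[p](addrK q) e addrAC [r + s]addrC addrK. Qed.

Lemma add_cancel_cross p q r : p + q + (r - p) = r + q.
Proof. by rewrite [LHS]addrC addrA subrK. Qed.

Lemma add_telescope p q r : - (p + q) + (p - r) = - (q + r).
Proof. by rewrite [p + q]addrC !opprD -addrA addKr. Qed.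

Lemma add_solve p q r s t : p + (q + r) = s + t -> q = s - p + (- r + t).
Proof.
by move=> e; rewrite [- r + t]addrC addrACA -e addrACA subrr add0r addrK.
Qed.

End AdditiveIdentities.

Section Cones.
Variable K : pzRingType.
Implicit Types X Y Z W : complex K.

(** The inverses in each degree commute with the differentials automatically. *)
Lemma quasi_iso_of_cancel X Y (s : chain_map X Y) (r : forall n, Y n -> X n) :
  (forall n, cancel (s n) (r n)) -> (forall n, cancel (r n) (s n)) ->
  quasi_iso s.
Proof.
move=> sK rK n; split=> [x dx [y sx]|y dy].
  exists (r n y); rewrite -[x]sK sx -[in LHS](rK n y) -chain_comm sK.
  by [].
exists (r (n + 1) y); split; last by exists 0; rewrite rK linear0 addr0.
by rewrite -[LHS]sK chain_comm rK dy -(linear0 (s (n + 1 + 1))) sK.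
Qed.

(** On cohomology r is a left inverse of s, and also a right inverse because the
    homotopy h is only needed on cycles. *)
Lemma quasi_iso_retraction X Y (s : chain_map X Y) (r : chain_map Y X)
    (h : forall n, Y (n + 1) -> Y n) :
  (forall n x, r n (s n x) = x) ->
  (forall n (y : Y (n + 1)), cdiff Y y = 0 ->
     y = s (n + 1) (r (n + 1) y) + cdiff Y (h n y)) ->
  quasi_iso s /\ quasi_iso r.
Proof.
move=> rs hP; split=> n; split=> [x dx [y e]|y dy].
- by exists (r n y); rewrite -chain_comm -e rs.
- exists (r (n + 1) y); split; first by rewrite -chain_comm dy linear0.
  by exists (h n y); apply: hP.
- by exists (s n y + h n x); rewrite linearD -chain_comm -e -hP.
exists (s (n + 1) y); split; first by rewrite -chain_comm dy linear0.
by exists 0; rewrite rs linear0 addr0.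
Qed.

Section ConeMap.
Variables (X Y X' Y' : complex K) (f : chain_map X Y) (f' : chain_map X' Y').
Variables (a : chain_map X X') (b : chain_map Y Y').
Hypothesis sq : chain_eq (chain_comp b f) (chain_comp f' a).

Definition cone_map : chain_map (cone f) (cone f').
Proof.
apply: (@mkchain _ (cone f) (cone f') (fun n p => (a (n + 1) p.1, b n p.2))).
  by move=> n t [x y] [x' y']; rewrite /= !linearP.
move=> n [x y] /=; congr pair; first by rewrite /= linearN chain_comm.
by rewrite /= linearD chain_comm; congr (_ + _); apply: sq.
Defined.

(** The five lemma for the long exact sequences of the two cones, by a direct
    chase: classes in the cone are modified by the boundaries of elements of X
    until their first component vanishes. *)
Lemma quasi_iso_cone_map : quasi_iso a -> quasi_iso b -> quasi_iso cone_map.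
Proof.
move=> qa qb n; have sqE m x : b m (f m x) = f' m (a m x) := sq x.
split=> [[x y] [dx dy] [[x' y'] [ax ay]]|[x' y'] [dx' dy']].
  have {}dx : cdiff X x = 0 by rewrite -[LHS]opprK dx oppr0.
  have [|x1 ex1] := proj1 (qa (n + 1)) x dx.
    by exists (- x'); rewrite linearN.
  have [|x2 [dx2 [x3' ex3']]] := proj2 (qa n) (a (n + 1) x1 + x').
    by rewrite linearD -chain_comm -ex1 ax addNr.
  have ea : a (n + 1) (x1 - x2) = cdiff X' x3' - x'.
    by rewrite linearB; apply: add_cross ex3'.
  have ex : cdiff X (x1 - x2) = x by rewrite linearB dx2 subr0 -ex1.
  have [||y1 ey1] := proj1 (qb n) (y + f (n + 1) (x1 - x2)).
  - by rewrite linearD -chain_comm ex [LHS]addrC.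
  - exists (f' n x3' + y'); rewrite linearD ay sqE ea linearB linearD -chain_comm.
    exact: add_cancel_cross.
  exists (- (x1 - x2), y1); congr pair; rewrite /= linearN ?ex ?opprK //.
  by rewrite -ey1 [RHS]addrC addrK.
have {}dx' : cdiff X' x' = 0 by rewrite -[LHS]opprK dx' oppr0.
have [x [dx [x1' ex']]] := proj2 (qa (n + 1)) x' dx'.
have bfx : b (n + 1 + 1) (f (n + 1 + 1) x) + (cdiff Y' y' +
   cdiff Y' (f' (n + 1) x1')) = 0.
  by rewrite -[RHS]dy' ex' linearD sqE -chain_comm [RHS]addrAC [LHS]addrA.
have [||y0 ey0] := proj1 (qb (n + 1)) (f (n + 1 + 1) x).
- by rewrite -chain_comm dx linear0.
- exists (- (y' + f' (n + 1) x1')); rewrite linearN linearD.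
  by apply/eqP; rewrite -addr_eq0 bfx.
have [|y1 [dy1 [y2' ey2']]] := proj2 (qb n) (b (n + 1) y0 +
   (y' + f' (n + 1) x1')).
  by rewrite !linearD -chain_comm -ey0.
exists (x, y1 - y0); split.
  by congr pair; rewrite /= ?dx ?oppr0 // linearB dy1 sub0r -ey0 subrr.
exists (- x1', y2'); congr pair; rewrite /= ?linearN ?opprK //.
by rewrite linearB; apply: add_solve ey2'.
Qed.

End ConeMap.

(** The differential of a shift is the opposite one; the sign on the first
    component restores the commutation with f, which keeps its sign. *)
Definition cone_shift X Y (f : chain_map X Y) :
  chain_map (cone (shift_map f)) (shift (cone f)).
Proof.
apply: (@mkchain _ (cone (shift_map f)) (shift (cone f))
          (fun n p => (- p.1, p.2))) => [n t [x y] [x' y']|n [x y]].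
  by congr pair; rewrite /= scalerN opprD.
congr pair; simpl; first by rewrite !opprK linearN.
by rewrite linearN opprD opprK.
Defined.

Lemma cone_shift_qis X Y (f : chain_map X Y) : quasi_iso (cone_shift f).
Proof.
apply: (@quasi_iso_of_cancel (cone (shift_map f)) (shift (cone f)) _
  (fun n p => (- p.1, p.2))) => n [x y];
  by congr pair; rewrite /= opprK.
Qed.

(** Exchanging two shifts costs a sign, as does moving a shift past a cone. *)
Definition shift_neg Z : chain_map (shift (shift Z)) (shift (shift Z)).
Proof.
apply: (@mkchain _ (shift (shift Z)) (shift (shift Z))
  (fun n (z : Z (n + 1 + 1)) => - z)) => [n t z z'|n z].
  by rewrite scalerN opprD.
by rewrite /= linearN.
Defined.

Lemma shift_neg_qis Z : quasi_iso (shift_neg Z).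
Proof.
by apply: (@quasi_iso_of_cancel (shift (shift Z)) (shift (shift Z)) _
  (fun n z => - z)) => n z; apply: opprK.
Qed.

Definition shift_cone Z W (g : chain_map Z W) :
  chain_map (shift (cone g)) (cone (shift_map g)).
Proof.
apply: (@mkchain _ (shift (cone g)) (cone (shift_map g))
  (fun n z => (- z.1, z.2))) => [n t [z w] [z' w']|n [z w]].
  by congr pair; rewrite /= scalerN opprD.
congr pair; simpl; first by rewrite !opprK linearN.
by rewrite linearN opprD.
Defined.

Lemma shift_cone_qis Z W (g : chain_map Z W) : quasi_iso (shift_cone g).
Proof.
by apply: (@quasi_iso_of_cancel (shift (cone g)) (cone (shift_map g)) _
  (fun n z => (- z.1, z.2))) => n [z w]; congr pair; apply: opprK.
Qed.

(** The total complex of a commutative square can be formed by rows or by columns.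
    The sign is on the component of X, which is shifted twice, as the two shifts
    are exchanged. *)
Section ConeSwap.
Variables (X Y X' Y' : complex K) (f : chain_map X Y) (f' : chain_map X' Y').
Variables (a : chain_map X X') (b : chain_map Y Y').
Hypothesis sq : chain_eq (chain_comp b f) (chain_comp f' a).
Hypothesis sq' : chain_eq (chain_comp f' a) (chain_comp b f).

Definition cone_swap : chain_map (cone (cone_map sq)) (cone (cone_map sq')).
Proof.
apply: (@mkchain _ (cone (cone_map sq)) (cone (cone_map sq'))
   (fun n p => ((- p.1.1, p.2.1), (p.1.2, p.2.2))))
   => [n t [[x y] [x' y']] [[x1 y1] [x1' y1']]|n [[x y] [x' y']]].
  by congr (_, _, _); rewrite /= scalerN opprD.
congr (_, _, (_, _)); simpl.
- by rewrite !opprK linearN.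
- by rewrite linearN opprD opprK.
- by rewrite linearN opprD.
exact: addrCA.
Defined.

Lemma cone_swap_qis : quasi_iso cone_swap.
Proof.
apply: (@quasi_iso_of_cancel (cone (cone_map sq)) (cone (cone_map sq')) _
   (fun n p => ((- p.1.1, p.2.1), (p.1.2, p.2.2))))
  => n [[x y] [x' y']]; by congr (_, _, (_, _)); rewrite /= ?opprK.
Qed.

End ConeSwap.

(** For a map f from X to Y, the rotated triangles identify the cone of
    Y -> cone f with X[1] and the cone of cone f -> X[1] with Y[1].  The maps i and
    o are only required to be pointwise equal to the canonical ones, since the
    structure maps of diagrams satisfy the axioms only in this sense. *)
Section Rotation.
Variables (X Y : complex K) (f : chain_map X Y).

Section RotateIn.
Variables (i : chain_map Y (cone f)) (iE : chain_eq i (cone_in f)).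

Definition rotate_in : chain_map (shift X) (cone i).
Proof.
apply: (@mkchain _ (shift X) (cone i) (fun n x => (f (n + 1) x, (- x, 0))))
  => [n t x x'|n x].
  congr (_, (_, _)); simpl; first exact: linearP.
    by rewrite scalerN opprD.
  by rewrite scaler0 addr0.
rewrite [LHS]surjective_pairing [RHS]surjective_pairing /= iE.
congr (_, (_, _)); simpl.
- by rewrite linearN chain_comm.
- by rewrite add0r !linearN !opprK.
by rewrite linearN linear0 addr0 subrr.
Defined.

Lemma rotate_in_qis : quasi_iso rotate_in.
Proof.
(* The retraction takes the component in X, with the sign of [rotate_in]; the
   homotopy contracts the two copies of Y, which form the cone of an identity. *)
have fl n : linear (fun p : cone i n => - p.2.1 : shift X n).
  by move=> t [y [x y']] [y1 [x1 y1']]; rewrite /= scalerN opprD.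
have fd n (p : cone i n) :
    - (cdiff (cone i) p).2.1 = cdiff (shift X) (- p.2.1 : shift X n).
  by case: p => y [x y']; rewrite /= iE /= add0r !linearN.
apply: (proj1 (@quasi_iso_retraction (shift X) (cone i) rotate_in (mkchain fl fd)
  (fun n p => (p.2.2, (0, 0)) : cone i n) _ _)) => [n x|n [y [x y']]] /=.
  exact: opprK.
move=> e; have := congr1 (fun p => p.2.2) e; rewrite /= iE /= => e2.
rewrite /cone_diff /= iE; congr (_, (_, _)); simpl.
- by move/eqP: e2; rewrite addr_eq0 linearN -opprD => /eqP.
- by rewrite opprK linear0 subr0 addr0.
by rewrite !linear0 !addr0 add0r.
Qed.

End RotateIn.

Section RotateOut.
Variables (o : chain_map (cone f) (shift X)) (oE : chain_eq o (cone_out f)).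

Definition rotate_out : chain_map (cone o) (shift Y).
Proof.
apply: (@mkchain _ (cone o) (shift Y) (fun n p => p.1.2 + f (n + 1) p.2))
  => [n t [[x y] x'] [[x1 y1] x1']|n [[x y] x']] /=.
  by rewrite linearP scalerDr addrACA.
have -> : cdiff Y (y + f (n + 1) x') = cdiff Y y + f (n + 1 + 1) (cdiff X x').
  by rewrite linearD -chain_comm.
by rewrite oE linearB /=; apply: add_telescope.
Defined.

Lemma rotate_out_qis : quasi_iso rotate_out.
Proof.
(* Y[1] is a subcomplex and [rotate_out] a retraction to it; the two copies of X in the
   quotient form the cone of an identity, which the homotopy contracts. *)
have sl n : linear (fun y : shift Y n => ((0, y), 0) : cone o n).
  by move=> t y y1; congr (_, _, _); rewrite /= scaler0 addr0.
have sd n (y : shift Y n) :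
    ((0, cdiff (shift Y) y), 0) = cdiff (cone o) (((0, y), 0) : cone o n).
  rewrite /= /cone_diff /= oE; congr (_, _, _); simpl;
    by rewrite ?(linear0 (f _)) ?(linear0 (cdiff _)) ?oppr0 ?add0r ?subr0.
apply: (proj2 (@quasi_iso_retraction (shift Y) (cone o) (mkchain sl sd)
  rotate_out (fun n p => ((p.2, 0), 0) : cone o n) _ _)) => [n y|n [[x y] x']].
  by rewrite /= linear0 addr0.
move=> e; have := congr1 snd e; rewrite /= oE /= => /eqP.
rewrite subr_eq0 => /eqP ->.
rewrite /cone_diff /= oE; congr (_, _, _); simpl.
- by rewrite sub0r opprK.
- by rewrite linear0 addr0 addrK.
by rewrite linear0 subr0 add0r.
Qed.

End RotateOut.
End Rotation.

(** * The inverse of the shift *)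

(** The degrees n - 1 + 1, n + 1 - 1 and n are equal but not convertible, so that
    elements are transported along equalities of degrees. *)
Definition ccast X m n (e : m = n) (x : X m) : X n :=
  eq_rect m (fun i => X i) x n e.

Lemma ccast_id X n (e : n = n) (x : X n) : ccast e x = x.
Proof. by rewrite (eq_axiomK e). Qed.

Lemma ccast_linear X m n (e : m = n) : linear (@ccast X m n e).
Proof. by case: n / e. Qed.

Lemma ccast_diff X m n (e : m = n) (e' : m + 1 = n + 1) (x : X m) :
  cdiff X (ccast e x) = ccast e' (cdiff X x).
Proof. by case: n / e e' => e'; rewrite !ccast_id. Qed.

Lemma ccast_trans X m n p (e : m = n) (e' : n = p) (x : X m) :
  ccast e' (ccast e x) = ccast (etrans e e') x.
Proof. by case: p / e'; case: n / e. Qed.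

Lemma ccast_chain X Y (f : chain_map X Y) m n (e : m = n) (x : X m) :
  f n (ccast e x) = ccast e (f m x).
Proof. by case: n / e. Qed.

Lemma ccastN X m n (e : m = n) (x : X m) : ccast e (- x) = - ccast e x.
Proof. by case: n / e. Qed.

Lemma ccastD X m n (e : m = n) (x y : X m) :
  ccast e (x + y) = ccast e x + ccast e y.
Proof. by case: n / e. Qed.

Lemma ccast0 X m n (e : m = n) : ccast e (0 : X m) = 0.
Proof. by case: n / e. Qed.

Lemma ccast_shift X m n (e : m = n) (e' : m + 1 = n + 1) (x : shift X m) :
  ccast e x = @ccast X _ _ e' x.
Proof. by case: n / e e' => e'; rewrite !ccast_id. Qed.

Lemma predz_succ (n : int) : n - 1 + 1 = n + 1 - 1.
Proof. lia. Qed.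

(** The sign is there for the one in the differential of [shift] to undo it. *)
Definition unshift_diff X n (x : X (n - 1)) : X (n + 1 - 1) :=
  - ccast (predz_succ n) (cdiff X x).

Lemma unshift_diff_linear X n : linear (@unshift_diff X n).
Proof.
move=> t x y; rewrite /unshift_diff linearP ccast_linear opprD.
by rewrite scalerN.
Qed.

Program Definition unshift X : complex K :=
  @Complex K (fun n => X (n - 1)) (fun n => mklin (@unshift_diff_linear X n))
    _ _ _.
Next Obligation.
move=> X n x /=; rewrite /unshift_diff linearN ccastN opprK.
have e' : n - 1 + 1 + 1 = n + 1 - 1 + 1 by lia.
by rewrite (ccast_diff _ e') cdiffK !ccast0.
Qed.
Next Obligation. by move=> X n; apply: cobj_fg. Qed.
Next Obligation.
move=> X; have [N XN] := cobj_bounded X; exists N.+1 => n nN; apply: XN; lia.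
Qed.

Definition unshift_map X Y (f : chain_map X Y) :
  chain_map (unshift X) (unshift Y).
Proof.
apply: (@mkchain _ (unshift X) (unshift Y) (fun n => f (n - 1))) => [n|n x].
  exact: linearP.
by rewrite /= /unshift_diff linearN ccast_chain chain_comm.
Defined.

Definition unshiftK X : chain_map (shift (unshift X)) X.
Proof.
apply: (@mkchain _ (shift (unshift X)) X (fun n x => ccast (addrK 1 n) x))
  => [n|n x]; first exact: (@ccast_linear X _ _ (addrK 1 n)).
rewrite /= /unshift_diff opprK ccast_trans.
by rewrite (ccast_diff _ (etrans (predz_succ _) (addrK 1 (n + 1)))).
Defined.

Definition shiftK X : chain_map (unshift (shift X)) X.
Proof.
apply: (@mkchain _ (unshift (shift X)) X (fun n x => ccast (subrK 1 n) x))
  => [n|n x]; first exact: (@ccast_linear X _ _ (subrK 1 n)).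
have e1 : n - 1 + 1 + 1 = n + 1 - 1 + 1 by lia.
rewrite /= /unshift_diff (ccast_shift _ e1) /= !ccastN opprK.
by rewrite ccast_trans (ccast_diff _ (etrans e1 (subrK 1 (n + 1)))).
Defined.

Lemma unshiftK_qis X : quasi_iso (unshiftK X).
Proof.
apply: (@quasi_iso_of_cancel (shift (unshift X)) X _
  (fun n x => ccast (esym (addrK 1 n)) x)) => n x;
  by rewrite /= ccast_trans ccast_id.
Qed.

Lemma shiftK_qis X : quasi_iso (shiftK X).
Proof.
apply: (@quasi_iso_of_cancel (unshift (shift X)) X _
  (fun n x => ccast (esym (subrK 1 n)) x)) => n x;
  by rewrite /= ccast_trans ccast_id.
Qed.

Lemma quasi_iso_unshift X Y (f : chain_map X Y) :
  quasi_iso f -> quasi_iso (unshift_map f).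
Proof.
move=> qf n; have [f_inj f_surj] := qf (n - 1).
have ceq0 Z m p (e : m = p) (z : Z m) : ccast e z = 0 -> z = 0.
  by case: p / e.
have cdiff0 Z (z : Z (n + 1 - 1)) : cdiff Z z = 0 ->
    cdiff Z (ccast (esym (predz_succ n)) z) = 0.
  have e' : n + 1 - 1 + 1 = n - 1 + 1 + 1 by lia.
  by move=> dz; rewrite (ccast_diff _ e') dz ccast0.
have diff0 Z (z : unshift Z (n + 1)) : cdiff (unshift Z) z = 0 ->
    cdiff Z z = 0.
  move=> dz; apply: (ceq0 _ _ _ (predz_succ (n + 1))).
  by rewrite -[LHS]opprK [- ccast _ _]dz oppr0.
have diffE Z (z : unshift Z n) : cdiff (unshift Z) z
    = ccast (predz_succ n) (cdiff Z (- z : Z (n - 1))).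
  by rewrite linearN ccastN.
split=> [x dx [y e]|y dy].
  have [|x' ex'] := f_inj _ (cdiff0 _ _ (diff0 _ _ dx)).
    exists (- y); rewrite ccast_chain [f _ x]e diffE ccast_trans ccast_id.
    by [].
  exists (- x'); rewrite diffE opprK -ex' ccast_trans ccast_id.
  by [].
have [x [dx [y' e]]] := f_surj _ (cdiff0 _ _ (diff0 _ _ dy)).
exists (ccast (predz_succ n) x); split.
  rewrite /= /unshift_diff.
  have e' : n - 1 + 1 + 1 = n + 1 - 1 + 1 by lia.
  by rewrite (ccast_diff _ e') dx !ccast0 oppr0.
exists (- y'); rewrite diffE opprK /= ccast_chain -ccastD -e.
by rewrite ccast_trans ccast_id.
Qed.

End Cones.

(** * Diagrams of complexes on a partially ordered set *)

Section Diagrams.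
Variables (K : pzRingType) (V : Type) (P : rel V).

Record diagram := Diagram {
  dob :> V -> complex K;
  dtr : forall x y, P x y -> chain_map (dob x) (dob y);
  dtr_id : forall x (h : P x x), chain_eq (dtr h) (chain_id _);
  dtr_comp : forall x y z (h : P x y) (h' : P y z) (h'' : P x z),
    chain_eq (chain_comp (dtr h') (dtr h)) (dtr h'') }.

Arguments dtr R {x y} h : rename.

Record diagram_map (R S : diagram) := DiagramMap {
  dfun :> forall x, chain_map (R x) (S x);
  dnat : forall x y (h : P x y),
    chain_eq (chain_comp (dfun y) (dtr R h)) (chain_comp (dtr S h) (dfun x)) }.

Program Definition diagram_id R : diagram_map R R :=
  @DiagramMap R R (fun x => chain_id _) _.
Next Obligation. by []. Qed.

Program Definition diagram_comp R S T (g : diagram_map S T)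
    (f : diagram_map R S) : diagram_map R T :=
  @DiagramMap R T (fun x => chain_comp (g x) (f x)) _.
Next Obligation.
move=> R S T g f x y h n v; have /= -> := dnat f h v.
exact: (dnat g h (f x n v)).
Qed.

Definition diagram_eq R S (f g : diagram_map R S) :=
  forall x, chain_eq (f x) (g x).

Program Definition diagram_cat : category :=
  @Category diagram diagram_map diagram_eq diagram_id diagram_comp _ _ _ _ _ _ _.
Next Obligation. by []. Qed.
Next Obligation. by move=> X Y f g fg x n v; rewrite fg. Qed.
Next Obligation. by move=> X Y f g h fg gh x n v; rewrite fg gh. Qed.
Next Obligation.
by move=> X Y Z g g' f f' gg' ff' x n v; rewrite /= ff' gg'.
Qed.
Next Obligation. by []. Qed.
Next Obligation. by []. Qed.
Next Obligation. by []. Qed.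

Section Vertexwise.
Variable T : functor (chain_cat K) (chain_cat K).

Program Definition diagram_fob (R : diagram) : diagram :=
  @Diagram (fun x => T (R x)) (fun x y h => fmap T (dtr R h)) _ _.
Next Obligation.
move=> R x h; apply: heq_trans (fmap_id T _); apply: fmap_heq.
exact: dtr_id.
Qed.
Next Obligation.
move=> R x y z h h' h''; apply: heq_trans (heq_sym (fmap_comp T _ _)) _.
by apply: fmap_heq; apply: dtr_comp.
Qed.

Program Definition diagram_fmap (R S : diagram) (f : diagram_map R S) :
  diagram_map (diagram_fob R) (diagram_fob S) :=
  @DiagramMap (diagram_fob R) (diagram_fob S) (fun x => fmap T (f x)) _.
Next Obligation.
move=> R S f x y h; apply: heq_trans (heq_sym (fmap_comp T _ _)) _.
apply: heq_trans (fmap_comp T _ _); apply: fmap_heq; exact: dnat.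
Qed.

Program Definition diagram_functor : functor diagram_cat diagram_cat :=
  @Functor diagram_cat diagram_cat diagram_fob diagram_fmap _ _ _.
Next Obligation. by move=> R S f g fg x; exact: (@fmap_heq _ _ T _ _ _ _ (fg x)). Qed.
Next Obligation. by move=> R x; exact: (fmap_id T (R x)). Qed.
Next Obligation. by move=> R S U g f x; exact: (fmap_comp T (g x) (f x)). Qed.

End Vertexwise.

Definition diagram_shift := diagram_functor (chain_shift K).

Definition diagram_qis R S (f : diagram_map R S) := forall x, quasi_iso (f x).

Section DiagramCone.
Variables (R S : diagram) (f : diagram_map R S).

Program Definition diagram_cone : diagram :=
  @Diagram (fun x => cone (f x))
    (fun x y h => cone_map (fun n v => esym (dnat f h v))) _ _.
Next Obligation. by move=> x h n [v w]; congr pair; apply: dtr_id. Qed.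
Next Obligation.
by move=> x y z h h' h'' n [v w]; congr pair;
  [apply: (dtr_comp h h' h'' v) | apply: (dtr_comp h h' h'' w)].
Qed.

Program Definition diagram_cone_in : diagram_map S diagram_cone :=
  @DiagramMap S diagram_cone (fun x => cone_in (f x)) _.
Next Obligation. by move=> x y h n v; congr pair; rewrite /= linear0. Qed.

Program Definition diagram_cone_out :
  diagram_map diagram_cone (diagram_shift R) :=
  @DiagramMap diagram_cone (diagram_shift R) (fun x => cone_out (f x)) _.
Next Obligation. by []. Qed.

End DiagramCone.

Program Definition diagram_model : model :=
  @Model diagram_cat diagram_qis diagram_shift _
    diagram_cone diagram_cone_in diagram_cone_out.
Next Obligation. by move=> R S f qf x; apply: quasi_iso_shift. Qed.

Program Definition unshift_functor : functor (chain_cat K) (chain_cat K) :=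
  @Functor (chain_cat K) (chain_cat K) (@unshift K) (@unshift_map K) _ _ _.
Next Obligation. by move=> X Y f g fg n x; apply: fg. Qed.
Next Obligation. by []. Qed.
Next Obligation. by []. Qed.

Definition diagram_unshift := diagram_functor unshift_functor.

Lemma diagram_unshift_weq (R S : diagram_model) (f : Hom R S) :
  weq f -> @weq diagram_model _ _ (fmap diagram_unshift f).
Proof. by move=> qf x; apply: quasi_iso_unshift. Qed.

(** Used to invert flips, which are inverse to each other only up to the shift. *)
Lemma shift_equivalence : is_equivalence (@lshift diagram_model).
Proof.
pose U := locF (M := diagram_model) (N := diagram_model) diagram_unshift_weq.
have tn (R : diagram) : forall x y (h : P x y), chain_eq
    (chain_comp (shiftK (R y)) (dtr (diagram_unshift (diagram_shift R)) h))
    (chain_comp (dtr R h) (shiftK (R x))).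
  by move=> x y h n v; rewrite /= ccast_chain.
have sn (R : diagram) : forall x y (h : P x y), chain_eq
    (chain_comp (unshiftK (R y)) (dtr (diagram_shift (diagram_unshift R)) h))
    (chain_comp (dtr R h) (unshiftK (R x))).
  by move=> x y h n v; rewrite /= ccast_chain.
pose t R := @DiagramMap (diagram_unshift (diagram_shift R)) R _ (tn R).
pose s R := @DiagramMap (diagram_shift (diagram_unshift R)) R _ (sn R).
apply: (@equivalence_of_inverses _ _ _ U U).
  apply: (@loc_niso _ _ (compF U (@lshift diagram_model)) (idF _)
     (fun R => lmor (t R : @Hom diagram_model _ _))) => [R|R S f].
    by apply: lmor_iso => x; apply: shiftK_qis.
  apply: heq_trans (heq_sym (lmor_comp _ _)) _.
  apply: heq_trans (lmor_comp _ _); apply: lmor_heq => x n v.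
  by rewrite /= ccast_chain.
apply: (@loc_niso _ _ (compF (@lshift diagram_model) U) (idF _)
   (fun R => lmor (s R : @Hom diagram_model _ _))) => [R|R S f].
  by apply: lmor_iso => x; apply: unshiftK_qis.
apply: heq_trans (heq_sym (lmor_comp _ _)) _.
apply: heq_trans (lmor_comp _ _); apply: lmor_heq => x n v.
by rewrite /= ccast_chain.
Qed.

End Diagrams.

Arguments dtr {K V P} d {x y} h.
Arguments dtr_comp {K V P} d {x y z} h h' h'' {n}.
Arguments dtr_id {K V P} d {x} h {n}.

(** * Relabelling the vertices *)

Section Pullback.
Variables (K : pzRingType) (V W : Type) (P : rel V) (Q : rel W) (t : V -> W).
Hypothesis tP : forall x y, P x y -> Q (t x) (t y).

Program Definition pull_ob (R : diagram K Q) : diagram K P :=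
  @Diagram K V P (fun x => R (t x)) (fun x y h => dtr R (tP h)) _ _.
Next Obligation. by move=> R x h; apply: dtr_id. Qed.
Next Obligation. by move=> R x y z h h' h''; apply: dtr_comp. Qed.

Program Definition pull_map (R S : diagram K Q) (f : diagram_map R S) :
  diagram_map (pull_ob R) (pull_ob S) :=
  @DiagramMap _ _ _ (pull_ob R) (pull_ob S) (fun x => f (t x)) _.
Next Obligation. by move=> R S f x y h; apply: (dnat f (tP h)). Qed.

Program Definition pull_functor :
    functor (diagram_model K Q) (diagram_model K P) :=
  @Functor (diagram_model K Q) (diagram_model K P) pull_ob pull_map _ _ _.
Next Obligation. by move=> R S f g fg x; apply: fg. Qed.
Next Obligation. by []. Qed.
Next Obligation. by []. Qed.

Lemma pull_weq (R S : diagram_model K Q) (f : Hom R S) :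
  weq f -> weq (fmap pull_functor f).
Proof. by move=> qf x; apply: qf. Qed.

Lemma quasi_iso_id (X : complex K) : quasi_iso (chain_id X).
Proof. exact: (@quasi_iso_of_cancel _ X X _ (fun n x => x)). Qed.

Program Definition pull_shift (R : diagram_model K Q) :
  Hom (pull_functor (mshift R)) (mshift (pull_functor R)) :=
  @DiagramMap _ _ _ (pull_functor (mshift R)) (mshift (pull_functor R))
    (fun x => chain_id _) _.
Next Obligation. by []. Qed.

Program Definition pull_cone (R S : diagram_model K Q) (f : Hom R S) :
  Hom (pull_functor (mcone f)) (mcone (fmap pull_functor f)) :=
  @DiagramMap _ _ _ (pull_functor (mcone f)) (mcone (fmap pull_functor f))
    (fun x => chain_id _) _.
Next Obligation. by []. Qed.

Definition pull_model_functor :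
  model_functor (diagram_model K Q) (diagram_model K P).
Proof.
apply: (@ModelFunctor _ _ pull_functor pull_weq pull_shift _ _ pull_cone) => //.
- by move=> R x; apply: quasi_iso_id.
- by move=> R S f x; apply: quasi_iso_id.
Defined.

End Pullback.

Section PullbackCancel.
Variables (K : pzRingType) (V W : Type) (P : rel V) (Q : rel W).
Variables (t : V -> W) (s : W -> V).
Hypothesis tP : forall x y, P x y -> Q (t x) (t y).
Hypothesis sQ : forall x y, Q x y -> P (s x) (s y).
Hypotheses (Qrefl : forall x, Q x x) (sK : cancel s t).

Let ts_le x : Q (t (s x)) x. Proof. by rewrite sK. Qed.
Let le_ts x : Q x (t (s x)). Proof. by rewrite sK. Qed.

Program Definition pull_cancel_map (R : diagram K Q) :
    diagram_map (pull_ob sQ (pull_ob tP R)) R :=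
  @DiagramMap _ _ _ (pull_ob sQ (pull_ob tP R)) R
    (fun x => dtr R (ts_le x)) _.
Next Obligation.
move=> R x y h n v; have h' : Q (t (s x)) y by rewrite sK.
exact: (etrans (dtr_comp R (tP (sQ h)) (ts_le y) h' v)
          (esym (dtr_comp R (ts_le x) h h' v))).
Qed.

(** The structure maps of R at the inequalities t (s x) <= x, which hold because
    t (s x) = x, replace a transport along this equality. *)
Lemma pull_cancel : nat_iso
  (compF (loc_tri_functor (pull_model_functor K sQ))
         (loc_tri_functor (pull_model_functor K tP)))
  (idF (Loc (diagram_model K Q))).
Proof.
apply: (@loc_niso _ _ (compF (loc_tri_functor (pull_model_functor K sQ))
         (loc_tri_functor (pull_model_functor K tP))) (idF _)
   (fun R => lmor (pull_cancel_map R : @Hom (diagram_model K Q) _ _)))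
   => [R|R S f].
  apply: lmor_iso => x.
  apply: (@quasi_iso_of_cancel _ (R (t (s x))) (R x) _
    (fun n => dtr R (le_ts x) n)) => n v /=.
    exact: (etrans (dtr_comp R (ts_le x) (le_ts x) (Qrefl _) v) (dtr_id R _ v)).
  exact: (etrans (dtr_comp R (le_ts x) (ts_le x) (Qrefl _) v) (dtr_id R _ v)).
apply: heq_trans (heq_sym (lmor_comp _ _)) _.
apply: heq_trans (lmor_comp _ _); apply: lmor_heq => x n v.
exact: esym (dnat f (ts_le x) v).
Qed.

End PullbackCancel.

Lemma relabel_equivalent (K : pzRingType) (V W : Type) (P : rel V) (Q : rel W)
    (t : V -> W) (s : W -> V) :
    (forall x, P x x) -> (forall x, Q x x) -> cancel t s -> cancel s t ->
    (forall x y, P x y = Q (t x) (t y)) ->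
  tri_equivalent (Loc (diagram_model K Q)) (Loc (diagram_model K P)).
Proof.
move=> Prefl Qrefl tK sK PQ.
have tP x y : P x y -> Q (t x) (t y) by rewrite PQ.
have sQ x y : Q x y -> P (s x) (s y) by rewrite PQ !sK.
exists (loc_tri_functor (pull_model_functor K tP)).
apply: equivalence_of_inverses (pull_cancel K tP sQ Qrefl sK) _.
exact: (pull_cancel K sQ tP Prefl tK).
Qed.

Arguments dnat {K V P R S} d {x y} h {n}.

(** * Flips *)

Section Flip.
Variables (K : pzRingType) (X Y : Type) (PX : rel X) (PY : rel Y) (f : X -> Y).
Hypotheses (PYrefl : forall y, PY y y).
Hypothesis f_mono : forall x x', PX x x' -> PY (f x) (f x').

(** Ladkani's two orders on the disjoint union of X and Y: an element x of X is put
    just below f x in the source order and just above it in the target order. *)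
Definition source_order (u v : X + Y) : bool :=
  match u, v with
  | inl x, inl x' => PX x x'
  | inr y, inr y' => PY y y'
  | inl x, inr y => PY (f x) y
  | inr _, inl _ => false
  end.

Definition target_order (u v : X + Y) : bool :=
  match u, v with
  | inl x, inl x' => PX x x'
  | inr y, inr y' => PY y y'
  | inr y, inl x => PY y (f x)
  | inl _, inr _ => false
  end.

Local Notation src := (diagram_model K source_order).
Local Notation tgt := (diagram_model K target_order).

(** The structure maps at the inequalities x <= f x of the source order and
    f x <= x of the target order. *)
Definition to_image (R : diagram K source_order) x :
    chain_map (R (inl x)) (R (inr (f x))) :=
  @dtr _ _ _ R (inl x) (inr (f x)) (PYrefl (f x)).

Definition of_image (S : diagram K target_order) x :
    chain_map (S (inr (f x))) (S (inl x)) :=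
  @dtr _ _ _ S (inr (f x)) (inl x) (PYrefl (f x)).

Section FlipDiagram.
Variable R : diagram K source_order.

Lemma to_image_square x x' (h : PX x x') :
  chain_eq
    (chain_comp (@dtr _ _ _ R (inr (f x)) (inr (f x')) (f_mono h)) (to_image R x))
    (chain_comp (to_image R x') (@dtr _ _ _ R (inl x) (inl x') h)).
Proof.
move=> n v; have e := @dtr_comp _ _ _ R (inl x) _ (inr (f x')).
exact: etrans (e _ _ _ (f_mono h) _ v) (esym (e _ _ _ (f_mono h) _ v)).
Qed.

Definition flip_ob (u : X + Y) : complex K :=
  match u with
  | inl x => cone (to_image R x)
  | inr y => R (inr y)
  end.

(** The inequality y <= x of the target order is, by definition, the inequality
    y <= f x of Y; it acts through R (f x), which maps to the cone. *)
Definition flip_tr (u v : X + Y) :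
    target_order u v -> chain_map (flip_ob u) (flip_ob v) :=
  match u, v return target_order u v -> chain_map (flip_ob u) (flip_ob v) with
  | inl x, inl x' => fun h => cone_map (to_image_square h)
  | inr y, inr y' => fun h => @dtr _ _ _ R (inr y) (inr y') h
  | inr y, inl x => fun h =>
      chain_comp (cone_in (to_image R x)) (@dtr _ _ _ R (inr y) (inr (f x)) h)
  | inl x, inr y => fun h => match notF h with end
  end.

Program Definition flip : diagram K target_order :=
  @Diagram _ _ _ flip_ob flip_tr _ _.
Next Obligation.
move=> [x|y] h n v; last exact: dtr_id.
by case: v => v w; congr pair; apply: dtr_id.
Qed.
Next Obligation.
move=> [x|y] [x'|y'] [x''|y''] h h' h'' n v //.
- by case: v => v w; congr pair;
    [apply: (@dtr_comp _ _ _ R (inl x) (inl x') (inl x'')) |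
     apply: (@dtr_comp _ _ _ R (inr (f x)) (inr (f x')) (inr (f x'')))].
- congr pair => /=; first exact: linear0.
  exact: (@dtr_comp _ _ _ R (inr y) (inr (f x')) (inr (f x''))).
- by congr pair; apply: (@dtr_comp _ _ _ R (inr y) (inr y') (inr (f x''))).
exact: (@dtr_comp _ _ _ R (inr y) (inr y') (inr y'')).
Qed.

End FlipDiagram.

Lemma flip_map_square (R S : diagram K source_order) (g : diagram_map R S) x :
  chain_eq (chain_comp (g (inr (f x))) (to_image R x))
           (chain_comp (to_image S x) (g (inl x))).
Proof. exact: (@dnat _ _ _ _ _ g (inl x) (inr (f x))). Qed.

Definition flip_map_fun (R S : diagram K source_order) (g : diagram_map R S)
    (u : X + Y) : chain_map (flip R u) (flip S u) :=
  match u return chain_map (flip R u) (flip S u) with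
  | inl x => cone_map (@flip_map_square R S g x)
  | inr y => g (inr y)
  end.

Program Definition flip_map (R S : diagram K source_order) (g : diagram_map R S) :
  diagram_map (flip R) (flip S) :=
  @DiagramMap _ _ _ (flip R) (flip S) (flip_map_fun g) _.
Next Obligation.
move=> R S g [x|y] [x'|y'] h n v //.
- by case: v => v w; congr pair; [apply: (@dnat _ _ _ _ _ g (inl x) (inl x'))
   | apply: (@dnat _ _ _ _ _ g (inr (f x)) (inr (f x')))].
- congr pair => /=; first exact: linear0.
  exact: (@dnat _ _ _ _ _ g (inr y) (inr (f x'))).
exact: (@dnat _ _ _ _ _ g (inr y) (inr y')).
Qed.

Program Definition flip_functor : functor src tgt :=
  @Functor src tgt flip flip_map _ _ _.
Next Obligation.
move=> R S g g' gg' [x|y] n v; last exact: gg'.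
by case: v => v w; congr pair; apply: gg'.
Qed.
Next Obligation. by move=> R [x|y] n v //; case: v. Qed.
Next Obligation. by move=> R S T g g' [x|y] n v //; case: v. Qed.

Lemma flip_weq (R S : src) (g : Hom R S) : weq g -> weq (fmap flip_functor g).
Proof. by move=> qg [x|y]; [apply: quasi_iso_cone_map | apply: qg]. Qed.

(** Both comparisons are the identity on Y, where the flip does nothing. *)
Definition flip_shift_fun (R : src) (u : X + Y) :
    chain_map ((flip_functor (mshift R) : diagram _ _) u)
              ((mshift (flip_functor R) : diagram _ _) u) :=
  match u with
  | inl x => cone_shift (to_image R x)
  | inr y => chain_id _
  end.

Program Definition flip_shift (R : src) :
    Hom (flip_functor (mshift R)) (mshift (flip_functor R)) :=
  @DiagramMap _ _ _ (flip_functor (mshift R)) (mshift (flip_functor R))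
    (flip_shift_fun R) _.
Next Obligation.
move=> R [x|y] [x'|y'] h n v //.
  by case: v => v w; congr pair; apply/esym/linearN.
by congr pair; rewrite /= oppr0.
Qed.

Definition flip_cone_fun (R S : src) (g : Hom R S) (u : X + Y) :
    chain_map ((flip_functor (mcone g) : diagram _ _) u)
              ((mcone (fmap flip_functor g) : diagram _ _) u) :=
  match u with
  | inl x => cone_swap _ (@flip_map_square R S g x)
  | inr y => chain_id _
  end.

Program Definition flip_cone (R S : src) (g : Hom R S) :
    Hom (flip_functor (mcone g)) (mcone (fmap flip_functor g)) :=
  @DiagramMap _ _ _ (flip_functor (mcone g)) (mcone (fmap flip_functor g))
    (flip_cone_fun g) _.
Next Obligation.
move=> R S g [x|y] [x'|y'] h n v //.
  case: v => [[v w] [v' w']]; congr (_, _, (_, _)) => //=.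
  by apply/esym/linearN.
by congr (_, _, (_, _)); rewrite /= ?oppr0.
Qed.

Definition flip_model_functor : model_functor src tgt.
Proof.
apply: (@ModelFunctor src tgt flip_functor flip_weq flip_shift _ _ flip_cone).
- by move=> R [x|y]; [apply: cone_shift_qis | apply: quasi_iso_id].
- by move=> R S g [x|y] n v //; case: v => v w; congr pair; apply/esym/linearN.
- by move=> R S g [x|y]; [apply: cone_swap_qis | apply: quasi_iso_id].
- move=> R S g [x|y] n v //; case: v => v w.
  by congr (_, _, (_, _)); rewrite /= oppr0.
- by move=> R S g [x|y] n v //; case: v => [[v w] [v' w']].
Defined.

Section UnflipDiagram.
Variable S : diagram K target_order.

Lemma of_image_square x x' (h : PX x x') :
  chain_eq
    (chain_comp (@dtr _ _ _ S (inl x) (inl x') h) (of_image S x))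
    (chain_comp (of_image S x') (@dtr _ _ _ S (inr (f x)) (inr (f x')) (f_mono h))).
Proof.
move=> n v; have e := @dtr_comp _ _ _ S (inr (f x)) _ (inl x').
exact: etrans (e _ _ _ (f_mono h) _ v) (esym (e _ _ _ (f_mono h) _ v)).
Qed.

Definition unflip_ob (u : X + Y) : complex K :=
  match u with
  | inl x => cone (of_image S x)
  | inr y => shift (S (inr y))
  end.

(** The inequality x <= y of the source order is the inequality f x <= y of Y; it
    acts on the shift of S (f x), to which the cone maps.  Hence the shift of S y
    at y. *)
Definition unflip_tr (u v : X + Y) :
    source_order u v -> chain_map (unflip_ob u) (unflip_ob v) :=
  match u, v return source_order u v -> chain_map (unflip_ob u) (unflip_ob v) with
  | inl x, inl x' => fun h => cone_map (of_image_square h)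
  | inr y, inr y' => fun h => shift_map (@dtr _ _ _ S (inr y) (inr y') h)
  | inl x, inr y => fun h =>
      chain_comp (shift_map (@dtr _ _ _ S (inr (f x)) (inr y) h))
                 (cone_out (of_image S x))
  | inr y, inl x => fun h => match notF h with end
  end.

Program Definition unflip : diagram K source_order :=
  @Diagram _ _ _ unflip_ob unflip_tr _ _.
Next Obligation.
move=> [x|y] h n v; last exact: dtr_id.
by case: v => v w; congr pair; apply: dtr_id.
Qed.
Next Obligation.
move=> [x|y] [x'|y'] [x''|y''] h h' h'' n v //.
- by case: v => v w; congr pair;
    [apply: (@dtr_comp _ _ _ S (inr (f x)) (inr (f x')) (inr (f x''))) |
     apply: (@dtr_comp _ _ _ S (inl x) (inl x') (inl x''))].
- exact: (@dtr_comp _ _ _ S (inr (f x)) (inr (f x')) (inr y'')).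
- exact: (@dtr_comp _ _ _ S (inr (f x)) (inr y') (inr y'')).
exact: (@dtr_comp _ _ _ S (inr y) (inr y') (inr y'')).
Qed.

End UnflipDiagram.

Lemma unflip_map_square (R S : diagram K target_order) (g : diagram_map R S) x :
  chain_eq (chain_comp (g (inl x)) (of_image R x))
           (chain_comp (of_image S x) (g (inr (f x)))).
Proof. exact: (@dnat _ _ _ _ _ g (inr (f x)) (inl x)). Qed.

Definition unflip_map_fun (R S : diagram K target_order) (g : diagram_map R S)
    (u : X + Y) : chain_map (unflip R u) (unflip S u) :=
  match u return chain_map (unflip R u) (unflip S u) with
  | inl x => cone_map (@unflip_map_square R S g x)
  | inr y => shift_map (g (inr y))
  end.

Program Definition unflip_map (R S : diagram K target_order)
    (g : diagram_map R S) : diagram_map (unflip R) (unflip S) :=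
  @DiagramMap _ _ _ (unflip R) (unflip S) (unflip_map_fun g) _.
Next Obligation.
move=> R S g [x|y] [x'|y'] h n v //.
- by case: v => v w; congr pair;
   [apply: (@dnat _ _ _ _ _ g (inr (f x)) (inr (f x')))
   | apply: (@dnat _ _ _ _ _ g (inl x) (inl x'))].
- exact: (@dnat _ _ _ _ _ g (inr (f x)) (inr y')).
exact: (@dnat _ _ _ _ _ g (inr y) (inr y')).
Qed.

Program Definition unflip_functor : functor tgt src :=
  @Functor tgt src unflip unflip_map _ _ _.
Next Obligation.
move=> R S g g' gg' [x|y] n v; last exact: gg'.
by case: v => v w; congr pair; apply: gg'.
Qed.
Next Obligation. by move=> R [x|y] n v //; case: v. Qed.
Next Obligation. by move=> R S T g g' [x|y] n v //; case: v. Qed.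

Lemma unflip_weq (R S : tgt) (g : Hom R S) :
  weq g -> weq (fmap unflip_functor g).
Proof.
by move=> qg [x|y]; [apply: quasi_iso_cone_map | apply: quasi_iso_shift].
Qed.

(** On Y the comparisons carry the signs that [cone_shift] and [cone_swap] have on
    the first component of a cone, which is what maps to Y. *)
Definition unflip_shift_fun (S : tgt) (u : X + Y) :
    chain_map ((unflip_functor (mshift S) : diagram _ _) u)
              ((mshift (unflip_functor S) : diagram _ _) u) :=
  match u with
  | inl x => cone_shift (of_image S x)
  | inr y => shift_neg _
  end.

Program Definition unflip_shift (S : tgt) :
    Hom (unflip_functor (mshift S)) (mshift (unflip_functor S)) :=
  @DiagramMap _ _ _ (unflip_functor (mshift S)) (mshift (unflip_functor S))
    (unflip_shift_fun S) _.
Next Obligation.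
move=> S [x|y] [x'|y'] h n v //=.
- by case: v => v w; congr pair; apply/esym/linearN.
- by rewrite linearN.
by rewrite linearN.
Qed.

Definition unflip_cone_fun (R S : tgt) (g : Hom R S) (u : X + Y) :
    chain_map ((unflip_functor (mcone g) : diagram _ _) u)
              ((mcone (fmap unflip_functor g) : diagram _ _) u) :=
  match u with
  | inl x => cone_swap _ (@unflip_map_square R S g x)
  | inr y => shift_cone _
  end.

Program Definition unflip_cone (R S : tgt) (g : Hom R S) :
    Hom (unflip_functor (mcone g)) (mcone (fmap unflip_functor g)) :=
  @DiagramMap _ _ _ (unflip_functor (mcone g)) (mcone (fmap unflip_functor g))
    (unflip_cone_fun g) _.
Next Obligation.
move=> R S g [x|y] [x'|y'] h n v //.
- case: v => [[v w] [v' w']]; congr (_, _, (_, _)) => //=.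
  by apply/esym/linearN.
- by case: v => [[v w] [v' w']]; congr pair; rewrite /= linearN.
by case: v => v w; congr pair; rewrite /= linearN.
Qed.

Definition unflip_model_functor : model_functor tgt src.
Proof.
apply: (@ModelFunctor tgt src unflip_functor unflip_weq unflip_shift _ _
  unflip_cone).
- by move=> S [x|y]; [apply: cone_shift_qis | apply: shift_neg_qis].
- move=> R S g [x|y] n v; last by rewrite /= linearN.
  by case: v => v w; congr pair; apply/esym/linearN.
- by move=> R S g [x|y]; [apply: cone_swap_qis | apply: shift_cone_qis].
- move=> R S g [x|y] n v; last by congr pair; rewrite /= oppr0.
  by case: v => v w; congr (_, _, (_, _)); rewrite /= oppr0.
- by move=> R S g [x|y] n v //; case: v => [[v w] [v' w']].
Defined.

(** ** The two flips are quasi-inverse up to the shift *)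

(** In a flipped diagram, the map from f x to x is the inclusion in the cone, and in
    an unflipped one the map from x to f x is the projection of the cone; the two
    composites are therefore computed by the rotation of triangles. *)
Lemma of_image_flip (R : src) x :
  chain_eq (of_image (flip R) x) (cone_in (to_image R x)).
Proof.
move=> n v; congr pair; exact: (@dtr_id _ _ _ R (inr (f x)) _ n v).
Qed.

Lemma to_image_unflip (S : tgt) x :
  chain_eq (to_image (unflip S) x) (cone_out (of_image S x)).
Proof.
move=> n [v w]; exact: (@dtr_id _ _ _ S (inr (f x)) _ (n + 1) v).
Qed.

Definition unflip_flip_fun (R : src) (u : X + Y) :
    chain_map ((mshift R : diagram _ _) u)
              ((unflip_functor (flip_functor R) : diagram _ _) u) :=
  match u with
  | inl x => rotate_in (@of_image_flip R x)
  | inr y => chain_id _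
  end.

Program Definition unflip_flip_map (R : src) :
    Hom (mshift R) (unflip_functor (flip_functor R)) :=
  @DiagramMap _ _ _ (mshift R) (unflip_functor (flip_functor R))
    (unflip_flip_fun R) _.
Next Obligation.
move=> R [x|y] [x'|y'] h n v //.
  congr (_, (_, _)); rewrite /= ?linearN ?linear0 //.
  exact: esym (@to_image_square R x x' h (n + 1) v).
exact: esym (@dtr_comp _ _ _ R (inl x) (inr (f x)) (inr y') _ h h _ v).
Qed.

Definition flip_unflip_fun (S : tgt) (u : X + Y) :
    chain_map ((flip_functor (unflip_functor S) : diagram _ _) u)
              ((mshift S : diagram _ _) u) :=
  match u with
  | inl x => rotate_out (@to_image_unflip S x)
  | inr y => chain_id _
  end.

Program Definition flip_unflip_map (S : tgt) :
    Hom (flip_functor (unflip_functor S)) (mshift S) :=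
  @DiagramMap _ _ _ (flip_functor (unflip_functor S)) (mshift S)
    (flip_unflip_fun S) _.
Next Obligation.
move=> S [x|y] [x'|y'] h n v //.
  case: v => [[v w] z] /=; rewrite linearD; congr (_ + _).
  exact: esym (@of_image_square S x x' h (n + 1) z).
rewrite /= add0r.
exact: (@dtr_comp _ _ _ S (inr y) (inr (f x')) (inl x') h _ h _ v).
Qed.

Let F := loc_tri_functor flip_model_functor.
Let G := loc_tri_functor unflip_model_functor.

Lemma unflip_flip : nat_iso (compF G F) (@lshift src).
Proof.
apply: niso_sym.
apply: (@loc_niso src src (@lshift src) (compF G F)
   (fun R => lmor (unflip_flip_map R))) => [R|R S g].
  by apply: lmor_iso => - [x|y]; [apply: rotate_in_qis | apply: quasi_iso_id].
apply: heq_trans (heq_sym (lmor_comp _ _)) _.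
apply: heq_trans (lmor_comp _ _); apply: lmor_heq => - [x|y] n v //.
congr (_, (_, _)); rewrite /= ?linearN ?linear0 //.
exact: esym (@flip_map_square R S g x (n + 1) v).
Qed.

Lemma flip_unflip : nat_iso (compF F G) (@lshift tgt).
Proof.
apply: (@loc_niso tgt tgt (compF F G) (@lshift tgt)
   (fun S => lmor (flip_unflip_map S))) => [S|R S g].
  by apply: lmor_iso => - [x|y]; [apply: rotate_out_qis | apply: quasi_iso_id].
apply: heq_trans (heq_sym (lmor_comp _ _)) _.
apply: heq_trans (lmor_comp _ _); apply: lmor_heq => - [x|y] n v //.
case: v => [[v w] z] /=; rewrite linearD; congr (_ + _).
exact: esym (@unflip_map_square R S g x (n + 1) z).
Qed.

Lemma flip_equivalent : tri_equivalent (Loc src) (Loc tgt).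
Proof.
exists F; apply: (equivalence_of_quasi_inverse _ _ unflip_flip flip_unflip);
  exact: shift_equivalence.
Qed.

Lemma unflip_equivalent : tri_equivalent (Loc tgt) (Loc src).
Proof.
exists G; apply: (equivalence_of_quasi_inverse _ _ flip_unflip unflip_flip);
  exact: shift_equivalence.
Qed.

End Flip.

(** * Modules over an incidence algebra *)

(** An isomorphism of A with the incidence algebra of P over k: the coefficient of
    the inequality x <= y in r is [coef r y x], and [of_coef] is the inverse
    isomorphism, extended by ignoring coefficients outside of P. *)
Record incidence_ring (k : fieldType) (V : finType) (P : rel V)
    (A : pzRingType) := IncidenceRing {
  inc_refl : reflexive P;
  inc_trans : transitive P;
  coef : A -> V -> V -> k;
  of_coef : (V -> V -> k) -> A;
  coefD : forall r s y x, coef (r + s) y x = coef r y x + coef s y x;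
  coefM : forall r s z x, coef (r * s) z x = \sum_y coef r z y * coef s y x;
  coef1 : forall y x, coef 1 y x = (y == x)%:R;
  of_coefE : forall m y x, coef (of_coef m) y x = if P x y then m y x else 0;
  coefK : forall r, of_coef (coef r) = r }.

Lemma fin_gen_finType (R : pzRingType) (M : lmodType R) (I : finType) (g : I -> M) :
  (forall x, exists c : I -> R, x = \sum_i c i *: g i) -> fin_gen M.
Proof.
move=> gM; exists #|I|, (fun j => g (enum_val j)) => x.
have [c ->] := gM x; exists (fun j => c (enum_val j)).
exact: (reindex _ (onW_bij _ (@enum_val_bij I))).
Qed.

Section IncidenceRing.
Variables (k : fieldType) (V : finType) (P : rel V) (A : pzRingType).
Variable inc : incidence_ring k P A.

Let P_refl : reflexive P := inc_refl inc.
Let P_trans : transitive P := inc_trans inc.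

Local Notation coef := (coef inc).
Local Notation of_coef := (of_coef inc).

Lemma coef_inj r s : (forall y x, P x y -> coef r y x = coef s y x) -> r = s.
Proof.
move=> e; rewrite -[r](coefK inc) -[s](coefK inc); congr of_coef.
apply/funext => y; apply/funext => x; have [xy|nxy] := boolP (P x y).
  exact: e.
by rewrite -[r](coefK inc) -[s](coefK inc) !of_coefE (negPf nxy).
Qed.

Lemma coef0 y x : coef 0 y x = 0.
Proof. by apply: (addrI (coef 0 y x)); rewrite -coefD !addr0. Qed.

Lemma coef_sum (I : finType) (F : I -> A) y x :
  coef (\sum_i F i) y x = \sum_i coef (F i) y x.
Proof.
by elim/big_rec2: _ => [|i r s _ <-]; [apply: coef0 | apply: coefD].
Qed.

Lemma coef_supp r y x : ~~ P x y -> coef r y x = 0.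
Proof. by move=> nxy; rewrite -[r](coefK inc) of_coefE (negPf nxy). Qed.

Definition scalar (t : k) : A := of_coef (fun y x => t * (y == x)%:R).

(** The basis element of the inequality x <= y. *)
Definition unit_at (y x : V) : A :=
  of_coef (fun y' x' => ((y' == y) && (x' == x))%:R).

Lemma coef_scalar t y x : coef (scalar t) y x = t * (y == x)%:R.
Proof.
rewrite of_coefE; case: eqP => [->|_]; first by rewrite P_refl.
by rewrite mulr0 if_same.
Qed.

Lemma coef_unit_at y x y' x' : P x y ->
  coef (unit_at y x) y' x' = ((y' == y) && (x' == x))%:R.
Proof.
move=> xy; rewrite of_coefE; case: eqP => [->|_]; last by rewrite if_same.
by case: eqP => [->|_]; rewrite ?xy ?if_same.
Qed.

Lemma coef_scalarM t r y x : coef (scalar t * r) y x = t * coef r y x.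
Proof.
rewrite coefM (bigD1 y) //= big1 ?addr0 => [|z nzy].
  by rewrite coef_scalar eqxx mulr1.
by rewrite coef_scalar eq_sym (negPf nzy) mulr0 mul0r.
Qed.

Lemma coef_Mscalar t r y x : coef (r * scalar t) y x = coef r y x * t.
Proof.
rewrite coefM (bigD1 x) //= big1 ?addr0 => [|z nzx].
  by rewrite coef_scalar eqxx mulr1.
by rewrite coef_scalar (negPf nzx) mulr0 mulr0.
Qed.

Lemma scalar_comm t r : scalar t * r = r * scalar t.
Proof.
by apply: coef_inj => y x _; rewrite coef_scalarM coef_Mscalar mulrC.
Qed.

Lemma scalarM t t' : scalar (t * t') = scalar t * scalar t'.
Proof.
by apply: coef_inj => y x _; rewrite coef_scalarM !coef_scalar mulrA.
Qed.

Lemma scalarD t t' : scalar (t + t') = scalar t + scalar t'.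
Proof.
by apply: coef_inj => y x _; rewrite coefD !coef_scalar mulrDl.
Qed.

Lemma scalar1 : scalar 1 = 1.
Proof. by apply: coef_inj => y x _; rewrite coef_scalar coef1 mul1r. Qed.

Lemma coef_unit_atM r y x z w : P x y ->
  coef (unit_at y x * r) z w = (z == y)%:R * coef r x w.
Proof.
move=> xy; rewrite coefM (bigD1 x) //= big1 ?addr0 => [|v nvx].
  by rewrite coef_unit_at // eqxx andbT.
by rewrite coef_unit_at // (negPf nvx) andbF mul0r.
Qed.

Lemma unit_atM x y z : P x y -> P y z ->
  unit_at z y * unit_at y x = unit_at z x.
Proof.
move=> xy yz; apply: coef_inj => b a _.
rewrite coef_unit_atM // !coef_unit_at ?(P_trans xy) //.
by rewrite eqxx -natrM mulnb.
Qed.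

Lemma unit_atM0 x y y' z : P x y -> P y' z -> y' != y ->
  unit_at z y' * unit_at y x = 0.
Proof.
move=> xy yz /negPf nyy; apply: coef_inj => b a _.
by rewrite coef_unit_atM // coef_unit_at // nyy mulr0 coef0.
Qed.

Lemma unit_at_sum : \sum_x unit_at x x = 1.
Proof.
apply: coef_inj => y x _; rewrite coef_sum coef1 (bigD1 y) //= big1 ?addr0.
  by rewrite coef_unit_at // eqxx eq_sym.
by move=> z nzy; rewrite coef_unit_at // eq_sym (negPf nzy).
Qed.

(** The only basis elements that survive are those of inequalities with target
    y. *)
Lemma unit_at_expand r y :
  unit_at y y * r = \sum_(x | P x y) scalar (coef r y x) * unit_at y x.
Proof.
apply: coef_inj => z w wz; rewrite coef_unit_atM // big_mkcond coef_sum /=.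
have E x : coef (if P x y then scalar (coef r y x) * unit_at y x else 0) z w =
    (w == x)%:R * ((z == y)%:R * coef r y x).
  case: ifPn => xy; last by rewrite coef0 coef_supp // !mulr0.
  by rewrite coef_scalarM coef_unit_at // -mulnb natrM [LHS]mulrC mulrAC [LHS]mulrC.
rewrite (eq_bigr _ (fun x _ => E x)) (bigD1 w) //= big1 ?addr0 => [|x nxw].
  by rewrite eqxx mul1r.
by rewrite eq_sym (negPf nxw) mul0r.
Qed.

End IncidenceRing.

(** ** From modules to diagrams *)

Section Corner.
Variables (k : fieldType) (V : finType) (P : rel V) (A : pzRingType).
Variable inc : incidence_ring k P A.

Local Notation u := (unit_at inc).
Let P_refl : reflexive P := inc_refl inc.

Section CornerModule.
Variables (M : lmodType A) (x : V).

Definition corner_pred : {pred M} := [pred m | u x x *: m == m].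

Lemma corner_zmod_closed : zmod_closed corner_pred.
Proof.
split=> [|m m']; rewrite !inE; first by rewrite scaler0.
by move=> /eqP em /eqP em'; rewrite scalerBr em em'.
Qed.

HB.instance Definition _ := GRing.isZmodClosed.Build M corner_pred
  corner_zmod_closed.

(** The value at x of the diagram of a module M is e M for the idempotent e of x.
    Inequalities act by the basis elements of A, and k acts through the scalar
    matrices, which are central. *)
Record vertex_space := Corner { corner_val : M; _ : corner_val \in corner_pred }.
HB.instance Definition _ := [isSub for corner_val].
HB.instance Definition _ := [Choice of vertex_space by <:].
HB.instance Definition _ := [SubChoice_isSubZmodule of vertex_space by <:].

Lemma cornerP (m : vertex_space) : u x x *: corner_val m = corner_val m.
Proof. by apply/eqP; case: m. Qed.

Lemma corner_congr (m m' : vertex_space) :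
  m = m' -> corner_val m = corner_val m'.
Proof. by move=> ->. Qed.

Lemma corner_valD (m m' : vertex_space) :
  corner_val (m + m') = corner_val m + corner_val m'.
Proof. exact: (raddfD (val : vertex_space -> M)). Qed.

Lemma corner_scale_proof t (m : vertex_space) :
  scalar inc t *: corner_val m \in corner_pred.
Proof. by rewrite inE scalerA -scalar_comm -scalerA cornerP. Qed.

Definition corner_scale t (m : vertex_space) : vertex_space :=
  Corner (corner_scale_proof t m).

Lemma corner_scalerA t t' (m : vertex_space) :
  corner_scale t (corner_scale t' m) = corner_scale (t * t') m.
Proof. by apply: val_inj; rewrite /= scalerA scalarM. Qed.

Lemma corner_scale1r : left_id 1 corner_scale.
Proof. by move=> m; apply: val_inj; rewrite /= scalar1 scale1r. Qed.

Lemma corner_scalerDr : right_distributive corner_scale +%R.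
Proof.
move=> t m m'; apply: val_inj; rewrite /=.
by rewrite scalerDr.
Qed.

Lemma corner_scalerDl m : {morph corner_scale^~ m : t t' / t + t'}.
Proof.
move=> t t'; apply: val_inj; rewrite /=.
by rewrite scalarD scalerDl.
Qed.

HB.instance Definition _ := GRing.Zmodule_isLmodule.Build k vertex_space
  corner_scalerA corner_scale1r corner_scalerDr corner_scalerDl.

Lemma corner_valP t (m m' : vertex_space) :
  corner_val (t *: m + m') = scalar inc t *: corner_val m + corner_val m'.
Proof. exact: corner_valD. Qed.

Lemma unit_at_corner y (m : M) : P y x -> u x y *: m \in corner_pred.
Proof. by move=> yx; rewrite inE scalerA unit_atM. Qed.

(** A is spanned over k by its basis elements, so that the products of these with
    generators of M span M over k; those that end in x span the value at x. *)
Lemma corner_fin_gen : fin_gen M -> fin_gen vertex_space.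
Proof.
move=> [n [g gM]].
have memg y i : (if P y x then u x y *: g i else 0) \in corner_pred.
  case: ifP => [|_]; first exact: unit_at_corner.
  by rewrite inE scaler0.
apply: (@fin_gen_finType k vertex_space (V * 'I_n)%type
  (fun yi => Corner (memg yi.1 yi.2))) => m.
have [c em] := gM (corner_val m).
exists (fun yi => coef inc (c yi.2) x yi.1); apply: val_inj.
rewrite raddf_sum /= -(pair_bigA _ (fun y i =>
  scalar inc (coef inc (c i) x y) *: (if P y x then u x y *: g i else 0))) /=.
rewrite exchange_big -cornerP em scaler_sumr; apply: eq_bigr => i _ /=.
rewrite scalerA unit_at_expand scaler_suml big_mkcond /=.
by apply: eq_bigr => y _; case: ifP => _; rewrite ?scaler0 // scalerA.
Qed.

End CornerModule.

Definition corner_map (M N : lmodType A) (f : {linear M -> N}) x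
    (m : vertex_space M x) : vertex_space N x.
Proof.
by exists (f (corner_val m)); rewrite inE -linearZ cornerP.
Defined.

Lemma corner_map_linear (M N : lmodType A) (f : {linear M -> N}) x : 
  linear (@corner_map M N f x).
Proof.
by move=> t m m'; apply: val_inj; rewrite /= linearP.
Qed.

Definition corner_move (M : lmodType A) x y (h : P x y) (m : vertex_space M x) :
    vertex_space M y := Corner (unit_at_corner (corner_val m) h).

Lemma corner_move_linear (M : lmodType A) x y (h : P x y) : linear (@corner_move M x y h).
Proof.
move=> t m m'; apply: val_inj; rewrite /=.
by rewrite scalerDr !scalerA scalar_comm.
Qed.

End Corner.

Section Representation.
Variables (k : fieldType) (V : finType) (P : rel V) (A : pzRingType).
Variable inc : incidence_ring k P A.

Local Notation u := (unit_at inc).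

Program Definition rep_at (X : complex A) (x : V) : complex k :=
  @Complex k (fun n => vertex_space inc (X n) x)
    (fun n => mklin (corner_map_linear (inc := inc) (cdiff X) (x := x))) _ _ _.
Next Obligation. by move=> X x n m; apply: val_inj; apply: cdiffK. Qed.
Next Obligation. by move=> X x n; apply: corner_fin_gen; apply: cobj_fg. Qed.
Next Obligation.
move=> X x; have [N XN] := cobj_bounded X; exists N => n nN m.
by apply: val_inj; apply: XN.
Qed.

Definition rep_tr (X : complex A) x y (h : P x y) :
  chain_map (rep_at X x) (rep_at X y).
Proof.
apply: (@mkchain _ (rep_at X x) (rep_at X y)
   (fun n => corner_move h)) => [n|n m].
  exact: corner_move_linear.
by apply: val_inj; rewrite /= linearZ.
Defined.

Program Definition rep (X : complex A) : diagram k P :=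
  @Diagram _ _ _ (rep_at X) (@rep_tr X) _ _.
Next Obligation. by move=> X x h n m; apply: val_inj; apply: cornerP. Qed.
Next Obligation.
move=> X x y z h h' h'' n m; apply: val_inj.
by rewrite /= scalerA unit_atM.
Qed.

Definition rep_map_fun (X Y : complex A) (f : chain_map X Y) x :
  chain_map (rep_at X x) (rep_at Y x).
Proof.
apply: (@mkchain _ (rep_at X x) (rep_at Y x)
   (fun n => corner_map (f n) (x := x))) => [n|n m].
  exact: corner_map_linear.
by apply: val_inj; apply: chain_comm.
Defined.

Program Definition rep_map (X Y : complex A) (f : chain_map X Y) :
  diagram_map (rep X) (rep Y) := @DiagramMap _ _ _ (rep X) (rep Y) (rep_map_fun f) _.
Next Obligation.
by move=> X Y f x y h n m; apply: val_inj; rewrite /= linearZ.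
Qed.

Program Definition rep_functor : functor (cplx A) (diagram_model k P) :=
  @Functor (cplx A) (diagram_model k P) rep rep_map _ _ _.
Next Obligation. by move=> X Y f g fg x n m; apply: val_inj; apply: fg. Qed.
Next Obligation. by move=> X x n m; apply: val_inj. Qed.
Next Obligation. by move=> X Y Z g f x n m; apply: val_inj. Qed.

(** Multiplication by the idempotent of x projects cycles and boundaries of X to
    those of its value at x. *)
Lemma rep_weq (X Y : cplx A) (f : Hom X Y) : weq f -> weq (fmap rep_functor f).
Proof.
move=> qf x n; have [f_inj f_surj] := qf n.
have proj (Z : complex A) m (z : Z m) : u x x *: z \in corner_pred inc x.
  by apply: unit_at_corner; apply: (inc_refl inc).
split=> [m dm [w fm]|m dm].
  have [||m' em'] := f_inj (corner_val m).
  - exact: (corner_congr dm).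
  - by exists (corner_val w); apply: (corner_congr fm).
  exists (Corner (proj _ _ m')); apply: val_inj.
  by rewrite /= linearZ /= -em' cornerP.
have [|w [dw [w' ew]]] := f_surj (corner_val m); first exact: (corner_congr dm).
exists (Corner (proj _ _ w)); split.
  by apply: val_inj; rewrite /= linearZ /= dw scaler0.
exists (Corner (proj _ _ w')); apply: val_inj.
by rewrite /= !linearZ /= -scalerDr -ew cornerP.
Qed.

Definition rep_shift_fun (X : complex A) x :
  chain_map (rep_at (shift X) x) (shift (rep_at X x)).
Proof.
apply: (@mkchain _ (rep_at (shift X) x) (shift (rep_at X x)) (fun n m => m))
  => [n t m m'|n m]; first by apply: val_inj.
by apply: val_inj.
Defined.

Program Definition rep_shift (X : cplx A) :
    Hom (rep_functor (mshift X)) (mshift (rep_functor X)) :=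
  @DiagramMap _ _ _ (rep_functor (mshift X)) (mshift (rep_functor X))
    (rep_shift_fun X) _.
Next Obligation. by move=> X x y h n m; apply: val_inj. Qed.

Section RepCone.
Variables (X Y : complex A) (f : chain_map X Y) (x : V).

Lemma rep_cone_fst n (m : rep_at (cone f) x n) :
  (corner_val m).1 \in corner_pred inc x.
Proof. by rewrite inE; apply/eqP; apply: (congr1 fst (cornerP m)). Qed.

Lemma rep_cone_snd n (m : rep_at (cone f) x n) :
  (corner_val m).2 \in corner_pred inc x.
Proof. by rewrite inE; apply/eqP; apply: (congr1 snd (cornerP m)). Qed.

Definition rep_cone_fun :
  chain_map (rep_at (cone f) x) (cone (rep_map_fun f x)).
Proof.
apply: (@mkchain _ (rep_at (cone f) x) (cone (rep_map_fun f x))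
  (fun n m => (Corner (rep_cone_fst m), Corner (rep_cone_snd m))))
  => [n t m m'|n m]; by congr pair; apply: val_inj.
Defined.

Lemma rep_cone_qis : quasi_iso rep_cone_fun.
Proof.
have pP n (p : cone (rep_map_fun f x) n) :
    ((corner_val p.1, corner_val p.2) : cone f n) \in corner_pred inc x.
  by rewrite inE; apply/eqP; congr pair; apply: cornerP.
apply: (@quasi_iso_of_cancel _ (rep_at (cone f) x) (cone (rep_map_fun f x)) _
  (fun n p => Corner (pP n p))) => n m.
  by apply: val_inj; apply: esym; apply: (surjective_pairing (corner_val m)).
by case: m => m m'; congr pair; apply: val_inj.
Qed.

End RepCone.

Program Definition rep_cone (X Y : cplx A) (f : Hom X Y) :
    Hom (rep_functor (mcone f)) (mcone (fmap rep_functor f)) :=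
  @DiagramMap _ _ _ (rep_functor (mcone f)) (mcone (fmap rep_functor f))
    (rep_cone_fun f) _.
Next Obligation.
by move=> X Y f x y h n m; congr pair; apply: val_inj.
Qed.

Definition rep_model_functor : model_functor (cplx A) (diagram_model k P).
Proof.
apply: (@ModelFunctor (cplx A) (diagram_model k P) rep_functor rep_weq
  rep_shift _ _ rep_cone).
- move=> X x; apply: (@quasi_iso_of_cancel _ (rep_at (shift X) x)
   (shift (rep_at X x)) _ (fun n m => m)) => n m; by [].
- by move=> X Y f x n m; apply: val_inj.
- by move=> X Y f x; apply: rep_cone_qis.
- by move=> X Y f x n m; congr pair; apply: val_inj.
- by move=> X Y f x n m; apply: val_inj.
Defined.

End Representation.

(** ** From diagrams to modules *)

(** A diagram of vector spaces.  The structure maps are total, for their values at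
    pairs that are not in P to be multiplied by vanishing coefficients. *)
Record vdiagram (k : fieldType) (V : finType) (P : rel V) := VDiagram {
  vob :> V -> lmodType k;
  vtr : forall x y, vob x -> vob y;
  vtr_linear : forall x y, linear (@vtr x y);
  vtr_id : forall x v, vtr x v = v;
  vtr_comp : forall x y z v, P x y -> P y z -> vtr z (vtr y v) = @vtr x z v }.

Arguments vtr {k V P} W {x} y : rename.

Section Total.
Variables (k : fieldType) (V : finType) (P : rel V) (A : pzRingType).
Variable inc : incidence_ring k P A.
Variable W : vdiagram k P.

Definition total (_ : incidence_ring k P A) := forall x, W x.
Local Notation T := (total inc).

HB.instance Definition _ := gen_eqMixin T.
HB.instance Definition _ := gen_choiceMixin T.

Definition total_add (v w : T) : T := fun x => v x + w x.
Definition total_opp (v : T) : T := fun x => - v x.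
Definition total_zero : T := fun x => 0.

Lemma total_eq (v w : T) : (forall x, v x = w x) -> v = w.
Proof. exact: functional_extensionality_dep. Qed.

Lemma total_addA : associative total_add.
Proof. by move=> u v w; apply: total_eq => x; apply: addrA. Qed.
Lemma total_addC : commutative total_add.
Proof. by move=> v w; apply: total_eq => x; apply: addrC. Qed.
Lemma total_add0 : left_id total_zero total_add.
Proof. by move=> v; apply: total_eq => x; apply: add0r. Qed.
Lemma total_addN : left_inverse total_zero total_opp total_add.
Proof. by move=> v; apply: total_eq => x; apply: addNr. Qed.

HB.instance Definition _ := GRing.isZmodule.Build T
  total_addA total_addC total_add0 total_addN.

Definition vtrL x y : {linear W x -> W y} := mklin (@vtr_linear _ _ _ W x y).

Definition total_scale (r : A) (v : T) : T :=
  fun y => \sum_x coef inc r y x *: vtrL x y (v x).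

Lemma total_scalerA r s v :
  total_scale r (total_scale s v) = total_scale (r * s) v.
Proof.
apply: total_eq => z; rewrite /total_scale.
transitivity (\sum_y \sum_x (coef inc r z y * coef inc s y x) *: vtrL x z (v x)).
  apply: eq_bigr => y _; rewrite linear_sum scaler_sumr.
  apply: eq_bigr => x _; rewrite linearZ scalerA /=.
  have [xy|nxy] := boolP (P x y); last first.
    by rewrite [coef inc s y x]coef_supp // mulr0 !scale0r.
  have [yz|nyz] := boolP (P y z); last first.
    by rewrite [coef inc r z y]coef_supp // mul0r !scale0r.
  by rewrite vtr_comp.
rewrite exchange_big; apply: eq_bigr => x _ /=.
by rewrite -scaler_suml coefM.
Qed.

Lemma total_scale1r : left_id 1 total_scale.
Proof.
move=> v; apply: total_eq => y; rewrite /total_scale (bigD1 y) //= big1.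
  by rewrite addr0 coef1 eqxx scale1r vtr_id.
by move=> x nxy; rewrite coef1 eq_sym (negPf nxy) scale0r.
Qed.

Lemma total_scalerDr : right_distributive total_scale +%R.
Proof.
move=> r v w; apply: total_eq => y; rewrite -[RHS]/(_ + _) /total_scale.
rewrite -big_split; apply: eq_bigr => x _ /=.
by rewrite -scalerDr -(linearD (vtrL x y)).
Qed.

Lemma total_scalerDl v : {morph total_scale^~ v : r s / r + s}.
Proof.
move=> r s; apply: total_eq => y; rewrite -[RHS]/(_ + _) /total_scale.
by rewrite -big_split; apply: eq_bigr => x _ /=; rewrite coefD scalerDl.
Qed.

HB.instance Definition _ := GRing.Zmodule_isLmodule.Build A T
  total_scalerA total_scale1r total_scalerDr total_scalerDl.

Lemma totalD (v w : T) x : (v + w) x = v x + w x.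
Proof. by []. Qed.

Lemma totalZ r (v : T) y : (r *: v) y = \sum_x coef inc r y x *: vtr W y (v x).
Proof. by []. Qed.

Lemma total_sum (I : finType) (F : I -> T) x : (\sum_i F i) x = \sum_i F i x.
Proof. by elim/big_rec2: _ => // i v w _ <-. Qed.

(** The structure map at y = x replaces a transport of v along this equality. *)
Definition embed x (v : W x) : T := fun y => (y == x)%:R *: vtr W y v.

Lemma embed_self x (v : W x) : embed v x = v.
Proof. by rewrite /embed eqxx scale1r vtr_id. Qed.

Lemma embed_other x y (v : W x) : y != x -> embed v y = 0.
Proof. by rewrite /embed => /negPf ->; rewrite scale0r. Qed.

Lemma embed_linear t x (v w : W x) :
  embed (t *: v + w) = scalar inc t *: embed v + embed w.
Proof.
apply: total_eq => y; rewrite totalD totalZ (bigD1 y) //= big1.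
  rewrite addr0 coef_scalar eqxx mulr1 vtr_id.
  by rewrite /embed vtr_linear scalerDr !scalerA mulrC.
by move=> z nzy; rewrite coef_scalar eq_sym (negPf nzy) mulr0 scale0r.
Qed.

Lemma embed0 x : embed (0 : W x) = 0.
Proof.
by apply: total_eq => y; rewrite /embed -[vtr W y 0]/(vtrL x y 0) linear0 scaler0.
Qed.

Lemma embed_sum x (I : finType) (c : I -> k) (g : I -> W x) :
  embed (\sum_i c i *: g i) = \sum_i scalar inc (c i) *: embed (g i).
Proof.
elim/big_rec2: _ => [|i v w _ <-]; [exact: embed0 | exact: embed_linear].
Qed.

Lemma scalar_total t (v : T) x : (scalar inc t *: v) x = t *: v x.
Proof.
rewrite totalZ (bigD1 x) //= big1 => [|z nzx].
  by rewrite addr0 coef_scalar eqxx mulr1 vtr_id.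
by rewrite coef_scalar eq_sym (negPf nzx) mulr0 scale0r.
Qed.

Lemma unit_at_total x y (v : T) : P x y ->
  unit_at inc y x *: v = embed (vtr W y (v x)).
Proof.
move=> xy; apply: total_eq => z; rewrite totalZ (bigD1 x) //= big1 => [|w nwx].
  rewrite addr0 coef_unit_at // eqxx andbT /embed.
  by case: eqP => [->|_]; rewrite ?scale0r // vtr_id.
by rewrite coef_unit_at // (negPf nwx) andbF scale0r.
Qed.

Lemma total_embed (v : T) : v = \sum_x embed (v x).
Proof.
apply: total_eq => y; rewrite total_sum (bigD1 y) //= big1 ?addr0.
  by rewrite embed_self.
by move=> x nxy; rewrite embed_other // eq_sym.
Qed.

(** The generators at all vertices, extended by zero, together. *)
Lemma total_fin_gen : (forall x, fin_gen (W x)) -> fin_gen T.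
Proof.
move=> Wfg; have [m mP] := fin_all_exists Wfg; have [g gP] := fin_all_exists mP.
apply: (@fin_gen_finType A T {x : V & 'I_(m x)}
  (fun p => embed (g (tag p) (tagged p)))) => v.
have [c cP] := fin_all_exists (fun x => gP x (v x)).
exists (fun p => scalar inc (c (tag p) (tagged p))).
rewrite [LHS]total_embed.
rewrite -(sig_big_dep (fun _ => true) (fun _ _ => true)
  (fun x i => scalar inc (c x i) *: embed (g x i))) /=.
by apply: eq_bigr => x _; rewrite {1}cP embed_sum.
Qed.

End Total.

Section Totalization.
Variables (k : fieldType) (V : finType) (P : rel V) (A : pzRingType).
Variable inc : incidence_ring k P A.

Definition diagram_move (R : diagram k P) n x y (v : R x n) : R y n :=
  if @idP (P x y) is ReflectT h then dtr R h n v else 0.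

Lemma diagram_moveE (R : diagram k P) n x y (h : P x y) (v : R x n) :
  diagram_move y v = dtr R h n v.
Proof.
rewrite /diagram_move; case: {-}_ / idP => [h'|/(_ h)] //.
by rewrite (bool_irrelevance h' h).
Qed.

Lemma diagram_move0 (R : diagram k P) n x y (v : R x n) :
  ~~ P x y -> diagram_move y v = 0.
Proof. by rewrite /diagram_move; case: {-}_ / idP => // h /negP. Qed.

Program Definition diagram_at (R : diagram k P) (n : int) : vdiagram k P :=
  @VDiagram k V P (fun x => R x n) (fun x y => @diagram_move R n x y) _ _ _.
Next Obligation.
move=> R n x y t v w; have [h|nh] := boolP (P x y).
  by rewrite !(diagram_moveE h) linearP.
by rewrite !diagram_move0 // scaler0 addr0.
Qed.
Next Obligation.
by move=> R n x v; rewrite /= (diagram_moveE (inc_refl inc x)) dtr_id.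
Qed.
Next Obligation.
move=> R n x y z v h h'; have h'' := inc_trans inc h h'.
by rewrite (diagram_moveE h) (diagram_moveE h') (diagram_moveE h'')
  -(dtr_comp R h h' h'').
Qed.

Definition tot_ob (R : diagram k P) (n : int) : lmodType A :=
  total (diagram_at R n) inc.

(** A matrix of coefficients vanishes outside of P, so that commutation with the
    structure maps at inequalities is enough for linearity over A. *)
Lemma total_map_linear (W W' : vdiagram k P) (f : forall x, {linear W x -> W' x}) :
  (forall x y (v : W x), P x y -> f y (vtr W y v) = vtr W' y (f x v)) ->
  linear (fun (v : total W inc) => (fun x => f x (v x)) : total W' inc).
Proof.
move=> fN r v w; apply: total_eq => y; rewrite totalD linearD; congr (_ + _).
rewrite !totalZ linear_sum; apply: eq_bigr => x _; rewrite linearZ /=.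
have [h|nh] := boolP (P x y); first by rewrite fN.
by rewrite coef_supp // !scale0r.
Qed.

Definition tot_diff (R : diagram k P) n (v : tot_ob R n) : tot_ob R (n + 1) :=
  fun x => cdiff (R x) (v x).

Lemma tot_diff_linear R n : linear (@tot_diff R n).
Proof.
apply: (@total_map_linear (diagram_at R n) (diagram_at R (n + 1))
  (fun x => cdiff (R x))) => x y v h.
by rewrite /= !(diagram_moveE h) chain_comm.
Qed.

Program Definition tot (R : diagram k P) : complex A :=
  @Complex A (tot_ob R) (fun n => mklin (@tot_diff_linear R n)) _ _ _.
Next Obligation. by move=> R n v; apply: total_eq => x; apply: cdiffK. Qed.
Next Obligation. by move=> R n; apply: total_fin_gen => x; apply: cobj_fg. Qed.
Next Obligation.
move=> R; have [N NP] := fin_all_exists (fun x => cobj_bounded (R x)).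
exists (\max_x N x) => n nN v; apply: total_eq => x; apply: NP.
by apply: leq_ltn_trans nN; apply: leq_bigmax.
Qed.

Definition tot_map (R S : diagram k P) (f : diagram_map R S) :
  chain_map (tot R) (tot S).
Proof.
apply: (@mkchain _ (tot R) (tot S)
   (fun n v => (fun x => f x n (v x)) : tot_ob S n)) => [n|n v].
  apply: (@total_map_linear (diagram_at R n) (diagram_at S n)
    (fun x => f x n)) => x y v h.
  by rewrite /= !(diagram_moveE h); apply: (dnat f h).
by apply: total_eq => x; apply: chain_comm.
Defined.

Program Definition tot_functor : functor (diagram_model k P) (cplx A) :=
  @Functor (diagram_model k P) (cplx A) tot tot_map _ _ _.
Next Obligation. by move=> R S f g fg n v; apply: total_eq => x; apply: fg. Qed.
Next Obligation. by []. Qed.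
Next Obligation. by []. Qed.

Lemma tot_weq (R S : diagram_model k P) (f : Hom R S) :
  weq f -> weq (fmap tot_functor f).
Proof.
move=> qf n; split=> [v dv [w fv]|w dw].
  have ev x : exists v', v x = cdiff (R x) v'.
    apply: (proj1 (qf x n)); first exact: (congr1 (fun t : tot_ob R _ => t x) dv).
    by exists (w x); apply: (congr1 (fun t : tot_ob S _ => t x) fv).
  have [v' ev'] := fin_all_exists ev.
  by exists v'; apply: total_eq.
have ew x : exists p : R x (n + 1)%R * S x n, cdiff (R x) p.1 = 0 /\
    w x = (f : diagram_map R S) x (n + 1) p.1 + cdiff (S x) p.2.
  have [|v [dv [w' e]]] := proj2 (qf x n) (w x).
    exact: (congr1 (fun t : tot_ob S _ => t x) dw).
  by exists (v, w').
have [p pP] := fin_all_exists ew.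
exists (fun x => (p x).1); split; first by apply: total_eq => x; case: (pP x).
by exists (fun x => (p x).2); apply: total_eq => x; case: (pP x).
Qed.

Definition tot_shift (R : diagram k P) :
  chain_map (tot (@diagram_shift k V P R)) (shift (tot R)).
Proof.
apply: (@mkchain _ (tot (@diagram_shift k V P R)) (shift (tot R)) (fun n v => v))
  => [n r v w|n v] //.
Defined.

Section TotCone.
Variables (R S : diagram k P) (f : diagram_map R S).

Definition tot_cone : chain_map (tot (diagram_cone f)) (cone (tot_map f)).
Proof.
apply: (@mkchain _ (tot (diagram_cone f)) (cone (tot_map f))
  (fun n v => ((fun x => (v x).1) : tot_ob R (n + 1),
               (fun x => (v x).2) : tot_ob S n))) => [n r v w|n v] //.
have fl x : linear (fun p : diagram_at (diagram_cone f) n x =>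
  p.1 : diagram_at R (n + 1) x) by [].
have sl x : linear (fun p : diagram_at (diagram_cone f) n x =>
  p.2 : diagram_at S n x) by [].
congr pair.
  apply: (@total_map_linear (diagram_at (diagram_cone f) n)
    (diagram_at R (n + 1)) (fun x => mklin (fl x))) => x y p h.
  by rewrite /= !(diagram_moveE h).
apply: (@total_map_linear (diagram_at (diagram_cone f) n)
  (diagram_at S n) (fun x => mklin (sl x))) => x y p h.
by rewrite /= !(diagram_moveE h).
Defined.

Lemma tot_cone_qis : quasi_iso tot_cone.
Proof.
apply: (@quasi_iso_of_cancel _ (tot (diagram_cone f)) (cone (tot_map f)) _
  (fun n p => (fun x => (p.1 x, p.2 x)) : tot_ob (diagram_cone f) n)) => n v.
  by apply: total_eq => x; apply: esym; apply: (surjective_pairing (v x)).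
exact: esym (surjective_pairing v).
Qed.

End TotCone.

Definition tot_model_functor : model_functor (diagram_model k P) (cplx A).
Proof.
apply: (@ModelFunctor (diagram_model k P) (cplx A) tot_functor tot_weq
  tot_shift _ _ tot_cone).
- move=> R; apply: (@quasi_iso_of_cancel _ (tot (@diagram_shift k V P R))
   (shift (tot R)) _ (fun n m => m)) => n m; by [].
- by move=> R S f n v.
- by move=> R S f; apply: tot_cone_qis.
- by move=> R S f n v.
- by move=> R S f n v.
Defined.

End Totalization.

(** ** The equivalence of modules and diagrams *)

Section IncidenceEquivalence.
Variables (k : fieldType) (V : finType) (P : rel V) (A : pzRingType).
Variable inc : incidence_ring k P A.

Local Notation u := (unit_at inc).
Let D := diagram_model k P.
Let F := loc_tri_functor (rep_model_functor inc).
Let G := loc_tri_functor (tot_model_functor inc).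

(** An element of e M, for the idempotent e of x and M the sum of the values of R,
    is a family concentrated at x. *)
Definition rep_tot_fun (R : diagram k P) x : chain_map (rep inc (tot inc R) x) (R x).
Proof.
apply: (@mkchain _ (rep inc (tot inc R) x) (R x)
  (fun n m => corner_val m x)) => [n t m m'|n m] //.
by rewrite corner_valP totalD scalar_total.
Defined.

Lemma corner_total n (R : diagram k P) x (m : rep inc (tot inc R) x n) :
  corner_val m = embed inc (W := diagram_at inc R n) (corner_val m x).
Proof.
by rewrite -{1}cornerP unit_at_total ?vtr_id //; apply: (inc_refl inc).
Qed.

Lemma embed_corner n (R : diagram k P) x (v : R x n) :
  embed inc (W := diagram_at inc R n) v \in corner_pred inc x.
Proof.
by rewrite inE unit_at_total ?vtr_id ?embed_self //; apply: (inc_refl inc).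
Qed.

Lemma rep_tot_qis R x : quasi_iso (rep_tot_fun R x).
Proof.
apply: (@quasi_iso_of_cancel _ (rep inc (tot inc R) x) (R x) _
  (fun n v => Corner (embed_corner v))) => n v.
  by apply: val_inj; apply: esym; apply: corner_total.
exact: (@embed_self _ _ _ _ inc (diagram_at inc R n) x v).
Qed.

Program Definition rep_tot_map (R : D) :
    @Hom D (rep inc (tot inc R)) R :=
  @DiagramMap _ _ _ (rep inc (tot inc R)) R (rep_tot_fun R) _.
Next Obligation.
move=> R x y h n m; rewrite /= unit_at_total //.
by rewrite embed_self /= (diagram_moveE h).
Qed.

Lemma rep_tot : nat_iso (compF F G) (idF (Loc D)).
Proof.
apply: (@loc_niso D D (compF F G) (idF (Loc D)) (fun R => lmor (rep_tot_map R)))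
  => [R|R S f].
  by apply: lmor_iso => x; apply: rep_tot_qis.
apply: heq_trans (heq_sym (lmor_comp _ _)) _.
by apply: heq_trans (lmor_comp _ _); apply: lmor_heq => x n v.
Qed.

Lemma unit_at_corner_sum (M : lmodType A) (v : forall x, vertex_space inc M x) x y :
  P x y -> u y x *: (\sum_z corner_val (v z)) = u y x *: corner_val (v x).
Proof.
move=> xy; rewrite scaler_sumr (bigD1 x) //= big1 ?addr0 // => z nzx.
rewrite -cornerP scalerA unit_atM0 ?scale0r //; last by rewrite eq_sym.
exact: (inc_refl inc).
Qed.

Lemma sum_unit_at (M : lmodType A) (m : M) : \sum_x u x x *: m = m.
Proof. by rewrite -scaler_suml unit_at_sum scale1r. Qed.

Lemma corner_val_sum (M : lmodType A) x (I : finType) (m : I -> vertex_space inc M x) :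
  corner_val (\sum_i m i) = \sum_i corner_val (m i).
Proof.
by elim/big_rec2: _ => // i m1 m2 _ <-; apply: corner_valD.
Qed.

(** The idempotents of the vertices decompose the identity, so that each element
    is the sum of its components. *)
Definition tot_rep_map (X : complex A) : chain_map (tot inc (rep inc X)) X.
Proof.
apply: (@mkchain _ (tot inc (rep inc X)) X
  (fun n v => \sum_x corner_val (v x))) => [n r v w|n v].
  rewrite (eq_bigr (fun x => corner_val ((r *: v) x) + corner_val (w x)))
    => [|x _]; last by rewrite totalD corner_valD.
  rewrite big_split; congr (_ + _).
  rewrite -[RHS]sum_unit_at; apply: eq_bigr => y _.
  rewrite scalerA unit_at_expand scaler_suml totalZ corner_val_sum [RHS]big_mkcond.
  apply: eq_bigr => x _ /=; case: ifPn => [xy|nxy].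
    by rewrite (diagram_moveE xy) -scalerA unit_at_corner_sum.
  by rewrite diagram_move0 // scaler0.
by rewrite linear_sum.
Defined.

Lemma tot_rep_qis (X : complex A) : quasi_iso (tot_rep_map X).
Proof.
have cP n x (m : X n) : u x x *: m \in corner_pred inc x.
  by apply: unit_at_corner; apply: (inc_refl inc).
apply: (@quasi_iso_of_cancel _ (tot inc (rep inc X)) X _
  (fun n m => (fun x => Corner (cP n x m)) : tot_ob inc (rep inc X) n)) => n v.
  apply: total_eq => x; apply: val_inj => /=.
  by rewrite unit_at_corner_sum ?cornerP //; apply: (inc_refl inc).
exact: sum_unit_at.
Qed.

Lemma tot_rep : nat_iso (compF G F) (idF (Loc (cplx A))).
Proof.
apply: (@loc_niso (cplx A) (cplx A) (compF G F) (idF (Loc (cplx A)))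
  (fun X => @lmor (cplx A) _ _ (tot_rep_map X))) => [X|X Y f].
  by apply: lmor_iso; apply: tot_rep_qis.
apply: heq_trans (heq_sym (lmor_comp _ _)) _.
apply: heq_trans (lmor_comp _ _); apply: lmor_heq => n v.
by rewrite /= linear_sum.
Qed.

Lemma modules_to_diagrams : tri_equivalent (Loc (cplx A)) (Loc D).
Proof. by exists F; apply: equivalence_of_inverses tot_rep rep_tot. Qed.

Lemma diagrams_to_modules : tri_equivalent (Loc D) (Loc (cplx A)).
Proof. by exists G; apply: equivalence_of_inverses rep_tot tot_rep. Qed.

End IncidenceEquivalence.

(** * Bound quivers whose parallel paths are equal *)

Section PathCoefficients.
Variables (k : fieldType) (V : finType) (e : rel V).
Implicit Types (f g : path_algebra k e) (p q : qpath e).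

(** The image of f in the incidence algebra: a path from x to y contributes to the
    inequality x <= y, whatever its intermediate vertices. *)
Definition path_coef f (y x : V) : k :=
  \sum_(p <- msupp f) f@_p * ((qtgt p == y) && (qsrc p == x))%:R.

Lemma path_coef_linear a f g y x :
  path_coef (a *: f + g) y x = a * path_coef f y x + path_coef g y x.
Proof.
pose F p : k := ((qtgt p == y) && (qsrc p == x))%:R.
have extE h (d : {fset qpath e}) : (msupp h `<=` d)%fset ->
    path_coef h y x = \sum_(p <- d) h@_p * F p.
  move=> le; rewrite /path_coef (big_fset_incl _ le) // => p _ /mcoeff_outdom ->.
  by rewrite mul0r.
pose d := (msupp f `|` msupp g)%fset.
rewrite (extE f d (fsubsetUl _ _)) (extE g d (fsubsetUr _ _)) (extE _ d).
  rewrite mulr_sumr -big_split /=; apply: eq_bigr => p _.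
  by rewrite mcoeffD mcoeffZ mulrDl mulrA.
apply: fsubset_trans (msuppD_le _ _) _.
by rewrite fsubUset (fsubset_trans (msuppZ_le _ _)) ?fsubsetUl ?fsubsetUr.
Qed.

Lemma path_coef0 y x : path_coef 0 y x = 0.
Proof. by rewrite /path_coef msupp0 big_seq_fset0. Qed.

Lemma path_coefD f g y x : path_coef (f + g) y x = path_coef f y x + path_coef g y x.
Proof. by rewrite -[f]scale1r path_coef_linear mul1r scale1r. Qed.

Lemma path_coefZ a f y x : path_coef (a *: f) y x = a * path_coef f y x.
Proof. by rewrite -[a *: f]addr0 path_coef_linear path_coef0 addr0. Qed.

Lemma path_coefN f y x : path_coef (- f) y x = - path_coef f y x.
Proof. by rewrite -scaleN1r path_coefZ mulN1r. Qed.

Lemma path_coef_sum (I : finType) (F : I -> path_algebra k e) y x :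
  path_coef (\sum_i F i) y x = \sum_i path_coef (F i) y x.
Proof.
by elim/big_rec2: _ => [|i r s _ <-]; [apply: path_coef0 | apply: path_coefD].
Qed.

Lemma path_coef_basis p y x :
  path_coef (pbasis k p) y x = ((qtgt p == y) && (qsrc p == x))%:R.
Proof.
rewrite /path_coef [@pbasis k V e]unlock msuppU oner_eq0 big_seq_fset1.
by rewrite mcoeffUU mul1r.
Qed.

Lemma path_coef_mul_basis q p z x : path_coef (pamul_basis k q p) z x =
  \sum_y path_coef (pbasis k q) z y * path_coef (pbasis k p) y x.
Proof.
rewrite (bigD1 (qsrc q)) //= big1 ?addr0 => [|y nyq]; last first.
  by rewrite path_coef_basis [_ == y]eq_sym (negPf nyq) andbF mul0r.
rewrite !path_coef_basis eqxx andbT.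
case: p q => [[x0 p] xp] [[y0 q] yq]; have [exy|nxy] := eqVneq (last x0 p) y0.
  have xpq : path e x0 (p ++ q) by rewrite cat_path [path _ _ _]xp exy.
  rewrite (pamul_basis_cat _ _ _ xpq exy) path_coef_basis.
  by rewrite /qtgt /qsrc /= last_cat exy -natrM mulnb.
by rewrite pamul_basis_eq0 // path_coef0 /qtgt /qsrc /= mulr0.
Qed.

Lemma path_coefM f g z x : path_coef (f * g) z x =
  \sum_y path_coef f z y * path_coef g y x.
Proof.
elim/path_algebra_ind: f => [|a q f IHf].
  by rewrite mul0r path_coef0 big1 // => y _; rewrite path_coef0 mul0r.
rewrite mulrDl path_coefD IHf.
rewrite [RHS](eq_bigr (fun y => a * (path_coef (pbasis k q) z y * path_coef g y x) +
   path_coef f z y * path_coef g y x)) => [|y _]; last first.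
  by rewrite path_coef_linear mulrDl mulrA.
rewrite big_split -mulr_sumr /=; congr (_ + _).
have -> : (a *: pbasis k q) * g = a *: (pbasis k q * g).
  by rewrite -[a *: pbasis k q]addr0 [LHS]pamul_linl pamul0l addr0.
rewrite path_coefZ; congr (_ * _); elim/path_algebra_ind: g {IHf} => [|b p g IHg].
  by rewrite mulr0 path_coef0 big1 // => y _; rewrite path_coef0 mulr0.
rewrite [_ * _]pamul_linr path_coef_linear IHg pamulB path_coef_mul_basis.
rewrite mulr_sumr -big_split; apply: eq_bigr => y _ /=.
by rewrite path_coef_linear mulrDr mulrCA.
Qed.

Lemma path_coef1 y x : path_coef 1 y x = (y == x)%:R.
Proof.
rewrite path_coef_sum (bigD1 x) //= big1 ?addr0 => [|z nzx].
  by rewrite path_coef_basis /qtgt /qsrc /= eqxx andbT eq_sym.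
by rewrite path_coef_basis /qtgt /qsrc /= (negPf nzx) andbF.
Qed.

End PathCoefficients.

(** When the relations hold in the incidence algebra and identify all parallel
    paths, the bound quiver algebra is the incidence algebra of the reachability
    order. *)
Section BoundQuiver.
Variables (k : fieldType) (V : finType) (e : rel V).
Variable S : path_algebra k e -> Prop.
Hypothesis S_coef : forall f y x, S f -> path_coef f y x = 0.
Hypothesis parallel : forall p q : qpath e, qsrc p = qsrc q ->
  qtgt p = qtgt q -> in_ideal S (pbasis k p - pbasis k q).

Local Notation Q := (quotient_ring S).

Lemma ideal_coef f y x : in_ideal S f -> path_coef f y x = 0.
Proof.
move=> If; elim: If y x => {f} [f Sf||f g _ IHf _ IHg|a f _ IHf|a f _ IHf] y x.
- exact: S_coef.
- exact: path_coef0.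
- by rewrite path_coefD path_coefN IHf IHg subrr.
- by rewrite path_coefM big1 // => z _; rewrite IHf mulr0.
by rewrite path_coefM big1 // => z _; rewrite IHf mul0r.
Qed.

Lemma pi_eq f g : in_ideal S (f - g) -> \pi_Q f = \pi_Q g.
Proof.
by move=> I; apply/eqP; rewrite piE Quotient.equivE; apply/asboolP.
Qed.

Lemma ideal_repr f : in_ideal S (f - repr (\pi_Q f)).
Proof.
apply/asboolP; have /eqP : \pi_Q f = \pi_Q (repr (\pi_Q f)) by rewrite reprK.
by rewrite piE Quotient.equivE.
Qed.

Definition qcoef (r : Q) := path_coef (repr r).

Lemma qcoef_pi f y x : qcoef (\pi_Q f) y x = path_coef f y x.
Proof.
have := ideal_coef y x (ideal_repr f); rewrite path_coefD path_coefN => /eqP.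
by rewrite subr_eq0 => /eqP.
Qed.

Lemma chosen_path x y : {p : option (qpath e) |
  if p is Some q then qsrc q = x /\ qtgt q = y else ~~ connect e x y}.
Proof.
apply: cid; case: (boolP (connect e x y)) => [/connectP[s xs ->]|nxy].
  by exists (Some (exist _ (x, s) xs)).
by exists None.
Qed.

Definition path_class x y : path_algebra k e :=
  oapp (@pbasis k V e) 0 (projT1 (chosen_path x y)).

Lemma path_class_coef x y y' x' : path_coef (path_class x y) y' x' =
  (connect e x y && ((y' == y) && (x' == x)))%:R.
Proof.
rewrite /path_class; case: (chosen_path x y) => [[p|] /=].
  move=> [<- <-]; rewrite path_coef_basis ![qtgt _ == _]eq_sym ![qsrc _ == _]eq_sym.
  have -> // : connect e (qsrc p) (qtgt p).
  by apply/connectP; exists (val p).2; first exact: (valP p).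
by move=> /negPf ->; rewrite path_coef0.
Qed.

Definition of_qcoef (m : V -> V -> k) : Q :=
  \pi_Q (\sum_y \sum_x m y x *: path_class x y).

Lemma of_qcoefE m y x :
  qcoef (of_qcoef m) y x = if connect e x y then m y x else 0.
Proof.
rewrite qcoef_pi path_coef_sum (bigD1 y) //= [X in _ + X]big1 ?addr0 => [|z nzy].
  rewrite path_coef_sum (bigD1 x) //= big1 ?addr0 => [|z nzx].
    by rewrite path_coefZ path_class_coef !eqxx andbT; case: ifP;
       rewrite ?mulr1 ?mulr0.
  by rewrite path_coefZ path_class_coef [x == z]eq_sym (negPf nzx) !andbF mulr0.
rewrite path_coef_sum big1 // => w _.
by rewrite path_coefZ path_class_coef [y == z]eq_sym (negPf nzy) andbF mulr0.
Qed.

Lemma path_class_eq p : in_ideal S (path_class (qsrc p) (qtgt p) - pbasis k p).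
Proof.
rewrite /path_class; case: (chosen_path _ _) => [[q|] /=].
  by move=> [sq tq]; apply: parallel.
move=> /negP[]; apply/connectP; exists (val p).2 => //; exact: (valP p).
Qed.

Lemma in_idealD f g : in_ideal S f -> in_ideal S g -> in_ideal S (f + g).
Proof.
move=> If Ig; rewrite -[g]opprK; apply: in_idealB => //.
by rewrite -sub0r; apply: in_idealB => //; apply: in_ideal0.
Qed.

Lemma in_idealZ a f : in_ideal S f -> in_ideal S (a *: f).
Proof.
move=> If; pose g : path_algebra k e := a *: paone k e.
have -> : a *: f = pamul g f.
  rewrite -[g]addr0 pamul_linl pamul0l addr0; congr (_ *: _).
  exact: esym (mul1r f).
exact: (in_idealMl g If).
Qed.

Lemma sum_path_class (p : qpath e) :
  \sum_y \sum_x path_coef (pbasis k p) y x *: path_class x y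
    = path_class (qsrc p) (qtgt p).
Proof.
rewrite (bigD1 (qtgt p)) //= [X in _ + X]big1 ?addr0 => [|y nyp].
  rewrite (bigD1 (qsrc p)) //= big1 ?addr0 => [|x nxp].
    by rewrite path_coef_basis !eqxx scale1r.
  by rewrite path_coef_basis [_ == x]eq_sym (negPf nxp) andbF scale0r.
rewrite big1 // => x _.
by rewrite path_coef_basis [_ == y]eq_sym (negPf nyp) scale0r.
Qed.

Lemma in_ideal_linear a f f' g g' : in_ideal S (f - f') ->
  in_ideal S (g - g') -> in_ideal S ((a *: f + g) - (a *: f' + g')).
Proof.
move=> If Ig; rewrite opprD addrACA -scalerBr.
exact: in_idealD (in_idealZ a If) Ig.
Qed.

Lemma of_qcoef_pi f : of_qcoef (path_coef f) = \pi_Q f.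
Proof.
apply: pi_eq; elim/path_algebra_ind: f => [|a p f IHf].
  rewrite big1 ?subr0 => [|y _]; first exact: in_ideal0.
  by rewrite big1 // => x _; rewrite path_coef0 scale0r.
set h := \sum_y _ in IHf.
have -> : \sum_y \sum_x path_coef (a *: pbasis k p + f) y x *: path_class x y =
    a *: path_class (qsrc p) (qtgt p) + h.
  rewrite -sum_path_class scaler_sumr -big_split; apply: eq_bigr => y _ /=.
  rewrite scaler_sumr -big_split; apply: eq_bigr => x _ /=.
  by rewrite path_coef_linear scalerDl scalerA.
exact: in_ideal_linear (path_class_eq p) IHf.
Qed.

Variable P : rel V.
Hypothesis P_connect : forall x y, P x y = connect e x y.

Definition bound_quiver_incidence : incidence_ring k P Q.
Proof.
apply: (@IncidenceRing k V P Q _ _ qcoef of_qcoef).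
- by move=> x; rewrite P_connect connect0.
- by move=> y x z; rewrite !P_connect; apply: connect_trans.
- move=> r s y x; rewrite -[r]reprK -[s]reprK.
  have -> : \pi_Q (repr r) + \pi_Q (repr s) = \pi_Q (repr r + repr s).
    by rewrite !piE.
  by rewrite !qcoef_pi path_coefD.
- move=> r s z x; rewrite -[r]reprK -[s]reprK.
  have -> : \pi_Q (repr r) * \pi_Q (repr s) = \pi_Q (repr r * repr s).
    by rewrite [RHS]pi_qrmul.
  by rewrite qcoef_pi path_coefM; apply: eq_bigr => y _; rewrite !qcoef_pi.
- move=> y x; rewrite -(path_coef1 k e) -qcoef_pi.
  by have -> : \pi_Q 1 = qrone S by rewrite piE.
- by move=> m y x; rewrite P_connect of_qcoefE.
by move=> r; rewrite -[RHS]reprK -of_qcoef_pi.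
Defined.

End BoundQuiver.

(** ** Graded quivers *)

Section GradedQuiver.
Variables (k : fieldType) (V : finType) (e : rel V).
Variable S : path_algebra k e -> Prop.

(** The vertex sequences s and t, read as paths from x, are equal in the bound
    quiver algebra. *)
Definition path_sim (x : V) (s t : seq V) :=
  forall (xs : path e x s) (xt : path e x t),
    in_ideal S (pbasis k (exist _ (x, s) xs) - pbasis k (exist _ (x, t) xt)).

Lemma path_sim_refl x s : path_sim x s s.
Proof.
by move=> xs xt; rewrite (bool_irrelevance xs xt) subrr; apply: in_ideal0.
Qed.

Lemma path_sim_trans x s t r : path e x t ->
  path_sim x s t -> path_sim x t r -> path_sim x s r.
Proof.
move=> xt st tr xs xr; rewrite -[X in X - _](subrK (pbasis k (exist _ (x, t) xt))).
by rewrite -addrA; apply: in_idealD.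
Qed.

Lemma path_sim_cat x s t r : last x s = last x t -> path e x s -> path e x t ->
  path_sim x s t -> path_sim x (s ++ r) (t ++ r).
Proof.
move=> est xs xt st xsr xtr.
have rP : path e (last x s) r by move: xsr; rewrite cat_path => /andP[].
have rP' : path e (last x t) r by rewrite -est.
rewrite -(pamul_basis_cat k xs rP xsr erefl).
rewrite -(pamul_basis_cat k xt rP xtr (esym est)) -!pamulB.
rewrite -[X in in_ideal _ X]mulrBr.
exact: in_idealMl (st xs xt).
Qed.

Lemma path_sim_precat x y r s t : last x r = y -> path e x r ->
  path e y s -> path e y t ->
  path_sim y s t -> path_sim x (r ++ s) (r ++ t).
Proof.
move=> er xr ys yt st xrs xrt.
rewrite -(pamul_basis_cat k xr ys xrs er) -(pamul_basis_cat k xr yt xrt er).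
rewrite -!pamulB -[X in in_ideal _ X]mulrBl.
exact: in_idealMr (st ys yt).
Qed.

Variable rank : V -> nat.
Hypothesis rank_arrow : forall x y, e x y -> rank y = (rank x).+1.
Hypothesis squares : forall x y z z', e z y -> e z' y -> z != z' ->
  connect e x z -> connect e x z' ->
  exists w, [/\ connect e x w, e w z, e w z' & path_sim w [:: z; y] [:: z'; y]].

Lemma rank_last x s : path e x s -> rank (last x s) = (rank x + size s)%N.
Proof.
elim: s x => [|y s IHs] x /=; first by rewrite addn0.
by move=> /andP[xy ys]; rewrite IHs // (rank_arrow xy) addSnnS.
Qed.

(** By induction on the length.  If the last arrows start at different vertices, a
    square joins these, and both paths are compared with paths that go through its
    initial vertex.  The grading ensures that parallel paths have the same length,
    so that the induction hypothesis applies to either of them. *)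
Lemma graded_path_sim x s t : path e x s -> path e x t ->
  last x s = last x t -> path_sim x s t.
Proof.
have [n] := ubnP (size s); elim: n s t => // n IHn s t sn xs xt est.
have : size s = size t.
  by apply: (@addnI (rank x)); rewrite -!rank_last ?est.
case/lastP: s sn xs est => [|s y] sn xs est.
  by case: t xt {est} => // xt _; apply: path_sim_refl.
case/lastP: t xt est => [|t y'] xt; first by rewrite size_rcons.
rewrite !last_rcons !size_rcons => ey [est]; subst y'.
move: sn xs xt; rewrite size_rcons ltnS !rcons_path.
move=> sn /andP[xs sy] /andP[xt ty].
have [e_last|n_last] := eqVneq (last x s) (last x t).
  rewrite -!cats1; apply: path_sim_cat => //.
  exact: IHn.
have xz : connect e x (last x s) by apply/connectP; exists s.
have xz' : connect e x (last x t) by apply/connectP; exists t.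
have [w [/connectP[r xr er] wz wz' sq]] := squares sy ty n_last xz xz'.
set z := last x s in sy wz sq; set z' := last x t in ty wz' sq.
have xrz : path e x (rcons r z) by rewrite rcons_path xr -er.
have xrz' : path e x (rcons r z') by rewrite rcons_path xr -er.
have wzy : path e w [:: z; y] by rewrite /= wz sy.
have wzy' : path e w [:: z'; y] by rewrite /= wz' ty.
have xrzy : path e x (r ++ [:: z; y]) by rewrite cat_path xr -er.
have xrzy' : path e x (r ++ [:: z'; y]) by rewrite cat_path xr -er.
rewrite -!cats1.
apply: (path_sim_trans xrzy).
  rewrite -[[:: z; y]]cat1s catA; apply: path_sim_cat; rewrite ?cats1 ?last_rcons //.
  by apply: IHn => //; rewrite last_rcons.
apply: (path_sim_trans xrzy'); first exact: (path_sim_precat (esym er)).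
rewrite -[[:: z'; y]]cat1s catA; apply: path_sim_cat; rewrite ?cats1 ?last_rcons //.
apply: IHn => //; last by rewrite last_rcons.
have -> // : size (rcons r z') = size s.
by rewrite est; apply: (@addnI (rank x)); rewrite -!rank_last // last_rcons.
Qed.

Lemma graded_parallel (p q : qpath e) : qsrc p = qsrc q -> qtgt p = qtgt q ->
  in_ideal S (pbasis k p - pbasis k q).
Proof.
case: p q => [[x s] xs] [[x' t] xt]; rewrite /qsrc /qtgt /= => ex.
by case: x' / ex xt => xt elast; apply: (graded_path_sim xs xt elast).
Qed.

End GradedQuiver.

Local Open Scope nat_scope.

(** * The rectangle with a branch *)

Section RectangleOrder.
Variables (u v : nat) (w : corner).

Definition rect_order (x y : vertex u v) : bool :=
  match x, y with
  | inl (inl i), inl (inl j) => i <= j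
  | inl (inr i), inl (inr j) => i <= j
  | inl (inl i), inl (inr j) => i <= j
  | inl (inr _), inl (inl _) => false
  | inr i, inr j => i <= j
  | inl (inl _), inr _ =>
    match w with lower_right | upper_right => true | _ => false end
  | inl (inr _), inr _ => if w is lower_right then true else false
  | inr _, inl (inl _) => if w is upper_left then true else false
  | inr _, inl (inr _) =>
    match w with lower_left | upper_left => true | _ => false end
  end.

(** The rows start at level v, to leave room for a branch on the left. *)
Definition rect_rank (x : vertex u v) : nat :=
  match x, w with
  | inl (inl i), _ => v + i
  | inl (inr i), _ => v + i.+1
  | inr i, lower_right => v + u.+1 + i
  | inr i, upper_right => v + u + i
  | inr i, lower_left => i.+1
  | inr i, upper_left => i
  end.

Local Notation arr := (@arrow u v w).

Lemma rect_order_refl x : rect_order x x.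
Proof. by case: x => [[i|i]|i] /=. Qed.

Lemma rect_order_trans y x z : rect_order x y -> rect_order y z -> rect_order x z.
Proof.
by case: x y z => [[i|i]|i] [[j|j]|j] [[l|l]|l] //=; case: w => //;
  apply: leq_trans.
Qed.

Lemma arrow_rank x y : arr x y -> rect_rank y = (rect_rank x).+1.
Proof.
case: x y => [[i|i]|i] [[j|j]|j] //=; case: w => //=;
  do ?[by move=> /eqP ->; lia | by move=> /andP[/eqP ? /eqP ->]; lia].
Qed.

Lemma arrow_order x y : arr x y -> rect_order x y.
Proof.
case: x y => [[i|i]|i] [[j|j]|j] //=; case: w => //=;
  by do ?[move=> /eqP ->].
Qed.

Lemma last_ord n (i : 'I_n) : exists j : 'I_n, j.+1 = n.
Proof. by case: n i => [[]|n] // i; exists ord_max. Qed.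

Lemma pred_ord n (i : 'I_n) : 0 < i -> exists j : 'I_n, i = j.+1 :> nat.
Proof.
case: i => [[|i] lin] //= _.
by exists (Ordinal (ltnW lin)).
Qed.

(** The last arrow of a path from x to y. *)
Lemma rect_order_pred x y : rect_order x y -> x != y ->
  exists2 z, arr z y & rect_order x z.
Proof.
have le_last n (i j : 'I_n) : j.+1 = n -> i <= j by move=> jn; rewrite -ltnS jn.
have lt_pred n (i j : 'I_n) : i <= j -> i != j ->
    exists2 l : 'I_n, j = l.+1 :> nat & i <= l.
  rewrite leq_eqVlt => /predU1P[/val_inj ->|ij _]; first by rewrite eqxx.
  have [|l lj] := @pred_ord _ j; first exact: leq_ltn_trans ij.
  by exists l => //; rewrite -ltnS -lj.
case: x y => [[i|i]|i] [[j|j]|j] //=.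
- move=> ij nij; have [|l lj il] := lt_pred _ _ _ ij; first by apply: contraNneq nij => ->.
  by exists (vt v l); rewrite //= lj.
- by move=> ij _; exists (vt v j); rewrite /= ?eqxx.
- case: (posnP j) => [j0|/pred_ord[l lj]]; last first.
    by exists (vc u l); rewrite //= lj.
  have [l lu] := last_ord i.
  by case: w => // _ _; [exists (vb v l) | exists (vt v l)]; rewrite //= ?lu ?j0 ?eqxx //;
    apply: le_last.
- move=> ij nij; have [|l lj il] := lt_pred _ _ _ ij; first by apply: contraNneq nij => ->.
  by exists (vb v l); rewrite //= lj.
- case: (posnP j) => [j0|/pred_ord[l lj]]; last first.
    by exists (vc u l); rewrite //= lj.
  have [l lu] := last_ord i.
  by case: w => // _ _; exists (vb v l); rewrite //= ?lu ?j0 ?eqxx //; apply: le_last.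
- case: (posnP j) => [j0|/pred_ord[l lj]]; last first.
    by exists (vt v l); rewrite //= lj.
  have [l lv] := last_ord i.
  by case: w => // _ _; exists (vc u l); rewrite //= ?lv ?j0 ?eqxx //; apply: le_last.
- case: (posnP j) => [j0|/pred_ord[l lj]]; last first.
    by exists (vb v l); rewrite //= lj.
  have [l lv] := last_ord i.
  by case: w => // _ _; [exists (vc u l) | exists (vt v j)]; rewrite //= ?lv ?j0 ?eqxx //;
    apply: le_last.
- move=> ij nij; have [|l lj il] := lt_pred _ _ _ ij; first by apply: contraNneq nij => ->.
  by exists (vc u l); rewrite //= lj.
Qed.

Lemma rect_order_connect x y : rect_order x y = connect arr x y.
Proof.
apply/idP/idP => [|/connectP[s xs ->]].
  have [n] := ubnP (rect_rank y); elim: n y => // n IHn y yn xy.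
  have [->|nxy] := eqVneq x y; first exact: connect0.
  have [z zy xz] := rect_order_pred xy nxy.
  apply: connect_trans (connect1 zy); apply: IHn => //.
  by move: yn; rewrite (arrow_rank zy).
elim: s x xs => [|z s IHs] x /=; first by rewrite rect_order_refl.
move=> /andP[/arrow_order xz zs]; exact: rect_order_trans xz (IHs _ zs).
Qed.

(** Two different arrows to the same vertex y, from vertices above a common x, form
    the end of a square.  The only other vertex with two incoming arrows is the
    lower left corner when the branch enters there, but its two predecessors, on
    the top row and on the branch, are not above a common vertex. *)
Lemma arrow_merge x y z z' : arr z y -> arr z' y -> z != z' ->
  rect_order x z -> rect_order x z' ->
  exists i j : 'I_u, [/\ j = i.+1 :> nat, y = vb v j &
    (z = vt v j /\ z' = vb v i) \/ (z = vb v i /\ z' = vt v j)].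
Proof.
case: z z' y => [[a|a]|a] [[b|b]|b] [[c|c]|c] //=;
  try (by case: w => //=; lia);
  try (by case: w => //= h h' /eqP[]; congr (inl (inl _)); apply: val_inj;
          move: h h' => /=; lia);
  try (by case: w => //= h h' /eqP[]; congr (inl (inr _)); apply: val_inj;
          move: h h' => /=; lia);
  try (by case: w => //= h h' /eqP[]; congr (inr _); apply: val_inj;
          move: h h' => /=; lia);
  try (by case: w => //=; case: x => [[d|d]|d]).
- by move=> /eqP -> /eqP -> /eqP[].
- by move=> /eqP -> /eqP cb _ _ _; exists b, c; split=> //; left.
- by case: x => [[d|d]|d] /=; case: w => //; lia.
- by move=> /eqP ca /eqP -> _ _ _; exists a, c; split=> //; right.
by case: x => [[d|d]|d] /=; case: w => //; lia.
Qed.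

Lemma rect_squares (k : fieldType) x y z z' : arr z y -> arr z' y -> z != z' ->
  connect arr x z -> connect arr x z' ->
  exists t, [/\ connect arr x t, arr t z, arr t z' &
    path_sim (@commutativity k u v w) t [:: z; y] [:: z'; y]].
Proof.
rewrite -!rect_order_connect => zy zy' nzz' xz xz'.
have [i [j [ij ey ez]]] := arrow_merge zy zy' nzz' xz xz'.
have sq : path_sim (@commutativity k u v w) (vt v i)
    [:: vt v j; vb v j] [:: vb v i; vb v j].
  move=> pP qP; apply: in_ideal_gen; exists i, j.
  exists (exist (fun r => path arr r.1 r.2) (_, _) pP).
  by exists (exist (fun r => path arr r.1 r.2) (_, _) qP); split.
have sq' : path_sim (@commutativity k u v w) (vt v i)
    [:: vb v i; vb v j] [:: vt v j; vb v j].
  move=> pP qP; rewrite -[X in in_ideal _ X]opprB -[X in in_ideal _ X]sub0r.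
  by apply: in_idealB; [apply: in_ideal0 | apply: sq].
have titj : arr (vt v i) (vt v j) by rewrite /= ij.
have tibi : arr (vt v i) (vb v i) by rewrite /= eqxx.
have xti : rect_order x (vt v j) -> rect_order x (vb v i) ->
    rect_order x (vt v i).
  by case: (x) => [[d|d]|d] //=; case: w => //; lia.
rewrite ey; case: ez xz xz' => - [-> ->] xz xz'; exists (vt v i);
  by rewrite -rect_order_connect xti.
Qed.

Definition rect_incidence (k : fieldType) :
  incidence_ring k rect_order (rect_algebra k u v w).
Proof.
apply: bound_quiver_incidence rect_order_connect => [f y x|p q].
  move=> [i [j [p [q [ij ep eq ->]]]]].
  rewrite path_coefD path_coefN !path_coef_basis /qsrc /qtgt ep eq /=.
  by rewrite subrr.
exact: (graded_parallel arrow_rank (@rect_squares k)).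
Defined.

End RectangleOrder.

Section Rectangles.
Variables (k : fieldType) (u v : nat).

Local Notation rect_diagrams w :=
  (Loc (diagram_model k (@rect_order u v w))).

Lemma rect_to_diagrams w :
  tri_equivalent (Db (rect_algebra k u v w)) (rect_diagrams w).
Proof.
apply: tri_equivalent_trans (@Loc_dist_stable _) (tri_equivalent_Db_Loc _) _.
exact: modules_to_diagrams (rect_incidence u v w k).
Qed.

Lemma diagrams_to_rect w :
  tri_equivalent (rect_diagrams w) (Db (rect_algebra k u v w)).
Proof.
apply: tri_equivalent_trans (@Db_dist_stable _) _ (tri_equivalent_Loc_Db _).
exact: diagrams_to_modules (rect_incidence u v w k).
Qed.

Lemma rect_equivalent w w' :
  tri_equivalent (rect_diagrams w) (rect_diagrams w') ->
  tri_equivalent (Db (rect_algebra k u v w)) (Db (rect_algebra k u v w')).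
Proof.
move=> e; apply: tri_equivalent_trans (@Db_dist_stable _) _ (diagrams_to_rect _).
exact: tri_equivalent_trans (@Loc_dist_stable _) (rect_to_diagrams w) e.
Qed.

End Rectangles.

(** ** Moving the branch *)

Section RectangleFlips.
Variables (k : fieldType) (u v : nat).

Local Notation rect_diagrams u w :=
  (Loc (diagram_model k (@rect_order u v w))).

Lemma relabel_both (V W : Type) (P : rel V) (Q : rel W) (t : V -> W) (s : W -> V) :
    (forall x, P x x) -> cancel t s -> cancel s t ->
    (forall x y, P x y = Q (t x) (t y)) ->
  tri_equivalent (Loc (diagram_model k Q)) (Loc (diagram_model k P)) /\
  tri_equivalent (Loc (diagram_model k P)) (Loc (diagram_model k Q)).
Proof.
move=> Prefl tK sK PQ; have Qrefl x : Q x x by rewrite -(sK x) -PQ.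
split; first exact: relabel_equivalent PQ.
by apply: (@relabel_equivalent k _ _ Q P s t) => // x y; rewrite PQ !sK.
Qed.

(** A row and the branch, where the elements of the row are below (out), or above
    (inn), those of the branch. *)
Definition row_order (out inn : bool) (y y' : 'I_u + 'I_v) : bool :=
  match y, y' with
  | inl i, inl i' => i <= i'
  | inr i, inr i' => i <= i'
  | inl _, inr _ => out
  | inr _, inl _ => inn
  end.

Let row_le (i i' : 'I_u) := i <= i'.

(** The first row is the domain of the flip and the second one its codomain.  In
    the source order the first row is the top one; in the target order, for which
    [upper] is true, it is the bottom one. *)
Definition of_rows (upper : bool) (x : 'I_u + ('I_u + 'I_v)) : vertex u v :=
  match x with
  | inl i => if upper then vb v i else vt v i
  | inr (inl i) => if upper then vt v i else vb v i
  | inr (inr i) => vc u i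
  end.

Definition to_rows (upper : bool) (x : vertex u v) : 'I_u + ('I_u + 'I_v) :=
  match x with
  | inl (inl i) => if upper then inr (inl i) else inl i
  | inl (inr i) => if upper then inl i else inr (inl i)
  | inr i => inr (inr i)
  end.

Lemma of_rowsK b : cancel (of_rows b) (to_rows b).
Proof. by case: b => [] [i|[i|i]]. Qed.

Lemma to_rowsK b : cancel (to_rows b) (of_rows b).
Proof. by case: b => [] [[i|i]|i]. Qed.

(** The flip along the vertical arrows.  The branch is attached to the second row,
    which is first the bottom row and then the top row. *)
Lemma lower_upper (out : bool)
    (lower := if out then lower_right else lower_left)
    (upper := if out then upper_right else upper_left) :
  tri_equivalent (rect_diagrams u lower) (rect_diagrams u upper) /\
  tri_equivalent (rect_diagrams u upper) (rect_diagrams u lower).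
Proof.
have row_refl y : row_order out (~~ out) y y by case: y => i /=.
have f_mono (i i' : 'I_u) : row_le i i' ->
  row_order out (~~ out) (inl i) (inl i') by [].
have src_refl x : source_order row_le (row_order out (~~ out)) inl x x.
  by case: x => [i|[i|i]] /=; rewrite ?/row_le.
have tgt_refl x : target_order row_le (row_order out (~~ out)) inl x x.
  by case: x => [i|[i|i]] /=; rewrite ?/row_le.
have srcE x y : source_order row_le (row_order out (~~ out)) inl x y =
    @rect_order u v lower (of_rows false x) (of_rows false y).
  by rewrite /lower; case: (out) x y => [] [i|[i|i]] [j|[j|j]].
have tgtE x y : target_order row_le (row_order out (~~ out)) inl x y =
    @rect_order u v upper (of_rows true x) (of_rows true y).
  by rewrite /upper; case: (out) x y => [] [i|[i|i]] [j|[j|j]].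
have [to_src of_src] := relabel_both src_refl (of_rowsK false) (to_rowsK false) srcE.
have [to_tgt of_tgt] := relabel_both tgt_refl (of_rowsK true) (to_rowsK true) tgtE.
split.
  apply: tri_equivalent_trans (@Loc_dist_stable _) to_src _.
  apply: tri_equivalent_trans (@Loc_dist_stable _) _ of_tgt.
  exact: flip_equivalent f_mono.
apply: tri_equivalent_trans (@Loc_dist_stable _) to_tgt _.
apply: tri_equivalent_trans (@Loc_dist_stable _) _ of_src.
exact: unflip_equivalent f_mono.
Qed.

End RectangleFlips.

Section MoveAcross.
Variables (k : fieldType) (u v : nat).

(** A cell of the rectangle is given by its row, false being the top one, and its
    column. *)
Definition cell_order n (x y : bool * 'I_n) : bool :=
  (x.1 ==> y.1) && (x.2 <= y.2).

(** The last column, with the branch above its top vertex only. *)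
Definition column_order (x y : bool + 'I_v) : bool :=
  match x, y with
  | inl r, inl r' => r ==> r'
  | inr c, inr c' => c <= c'
  | inl r, inr _ => ~~ r
  | inr _, inl _ => false
  end.

Let last_column (x : bool * 'I_u) : bool + 'I_v := inl x.1.
Let branch_le (c c' : 'I_v) := c <= c'.
Let first_top (c : 'I_v) : bool * 'I_u.+1 := (false, ord0).

Local Notation before := (bool * 'I_u + (bool + 'I_v))%type.
Local Notation after := ('I_v + bool * 'I_u.+1)%type.

Definition rect_cell n (r : bool) (i : 'I_n) : vertex n v :=
  if r then vb v i else vt v i.

Definition of_before (x : before) : vertex u.+1 v :=
  match x with
  | inl (r, i) => rect_cell r (lift ord_max i)
  | inr (inl r) => rect_cell r ord_max
  | inr (inr c) => vc u.+1 c
  end.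

Definition cell_before r (i : 'I_u.+1) : before :=
  if unlift ord_max i is Some j then inl (r, j) else inr (inl r).

Definition to_before (x : vertex u.+1 v) : before :=
  match x with
  | inl (inl i) => cell_before false i
  | inl (inr i) => cell_before true i
  | inr c => inr (inr c)
  end.

Lemma of_beforeK : cancel of_before to_before.
Proof.
by move=> [[[] i]|[[]|c]] //=; rewrite /cell_before ?liftK ?unlift_none.
Qed.

Lemma to_beforeK : cancel to_before of_before.
Proof. by move=> [[i|i]|c] //=; rewrite /cell_before; case: unliftP => [j|] ->. Qed.

(** The flip puts the last column before the others. *)
Definition to_after (x : before) : after :=
  match x with
  | inl (r, i) => inr (r, lift ord0 i)
  | inr (inl r) => inr (r, ord0)
  | inr (inr c) => inl c
  end.

Definition of_after (x : after) : before :=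
  match x with
  | inr (r, i) => if unlift ord0 i is Some j then inl (r, j) else inr (inl r)
  | inl c => inr (inr c)
  end.

Lemma to_afterK : cancel to_after of_after.
Proof. by move=> [[r i]|[r|c]] //=; rewrite ?liftK ?unlift_none. Qed.

Lemma of_afterK : cancel of_after to_after.
Proof. by move=> [c|[r i]] //=; case: unliftP => [j|] ->. Qed.

Definition rect_of_after (x : after) : vertex u.+1 v :=
  match x with inl c => vc u.+1 c | inr (r, i) => rect_cell r i end.

Definition after_of_rect (x : vertex u.+1 v) : after :=
  match x with
  | inl (inl i) => inr (false, i)
  | inl (inr i) => inr (true, i)
  | inr c => inl c
  end.

Lemma rect_of_afterK : cancel rect_of_after after_of_rect.
Proof. by move=> [c|[[] i]]. Qed.

Lemma after_of_rectK : cancel after_of_rect rect_of_after.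
Proof. by move=> [[i|i]|c]. Qed.

Let source1 := source_order (@cell_order u) column_order last_column.
Let target1 := target_order (@cell_order u) column_order last_column.
Let source2 := source_order branch_le (@cell_order u.+1) first_top.
Let target2 := target_order branch_le (@cell_order u.+1) first_top.

(** Flipping the other columns to the right of the last one makes the branch leave
    the top left corner; flipping it back, as the set of elements just above this
    corner, puts it below. *)
Lemma right_to_left : tri_equivalent
  (Loc (diagram_model k (@rect_order u.+1 v upper_right)))
  (Loc (diagram_model k (@rect_order u.+1 v upper_left))).
Proof.
have cell_refl n x : @cell_order n x x by rewrite /cell_order implybb leqnn.
have column_refl x : column_order x x by case: x => [[]|c] /=.
have last_mono x y : cell_order x y -> column_order (last_column x) (last_column y).
  by case/andP.
have first_mono c c' : branch_le c c' -> cell_order (first_top c) (first_top c').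
  by [].
have source1_refl x : source1 x x by case: x => x; rewrite /= ?column_refl ?cell_refl.
have target1_refl x : target1 x x by case: x => x; rewrite /= ?column_refl ?cell_refl.
have source2_refl x : source2 x x.
  by case: x => x; rewrite /= ?cell_refl /branch_le ?leqnn.
have bumpE (i : 'I_u) : bump u i = i by rewrite /bump leqNgt ltn_ord.
have source1E x y : source1 x y = @rect_order u.+1 v upper_right
    (of_before x) (of_before y).
  case: x y => [[[] i]|[[]|c]] [[[] j]|[[]|d]] //=;
    rewrite /cell_order /= ?bumpE ?leqnn //;
    by [have := ltn_ord i; lia | have := ltn_ord j; lia].
have target1E x y : target1 x y = target2 (to_after x) (to_after y).
  case: x y => [[[] i]|[[]|c]] [[[] j]|[[]|d]] //=; rewrite /cell_order.
have source2E x y : source2 x y = @rect_order u.+1 v upper_left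
    (rect_of_after x) (rect_of_after y).
  by case: x y => [c|[[] i]] [d|[[] j]].
have [to_source1 _] := relabel_both k source1_refl of_beforeK to_beforeK source1E.
have [_ to_target2] := relabel_both k target1_refl to_afterK of_afterK target1E.
have [_ of_source2] :=
  relabel_both k source2_refl rect_of_afterK after_of_rectK source2E.
apply: tri_equivalent_trans (@Loc_dist_stable _) to_source1 _.
apply: tri_equivalent_trans (@Loc_dist_stable _) _ of_source2.
apply: tri_equivalent_trans (@Loc_dist_stable _)
  (flip_equivalent k column_refl last_mono) _.
apply: tri_equivalent_trans (@Loc_dist_stable _) to_target2 _.
exact: unflip_equivalent (cell_refl _) first_mono.
Qed.

End MoveAcross.

(** [lower_upper] exchanges the rows for a branch on either side, and
    [right_to_left] carries the branch across the top row. *)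
Theorem theorem1p1 (k : closedFieldType) (u v : nat)
    (hu : (1 <= u)%N) (hv : (1 <= v)%N) :
  tri_equivalent (Db (A_lower_right k u v)) (Db (A_upper_right k u v)) /\
  tri_equivalent (Db (A_upper_right k u v)) (Db (A_lower_left k u v)) /\
  tri_equivalent (Db (A_lower_left k u v)) (Db (A_upper_left k u v)).
Proof.
have [lr_ur _] := lower_upper k u v true; have [ll_ul ul_ll] := lower_upper k u v false.
split; first exact: rect_equivalent lr_ur.
split; last exact: rect_equivalent ll_ul.
apply: rect_equivalent; apply: tri_equivalent_trans (@Loc_dist_stable _) _ ul_ll.
by case: u hu {lr_ur ll_ul} => // u' _; apply: right_to_left.
Qed.
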